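(* Let $(A,\mathfrak{m})$ be a Noetherian local ring of dimension $d$ and let $M$ be a finitely generated $A$-module. If $M$ is a faithful $A$-module and $\mu_d(\mathfrak{m}, M) = 1$, then $A$ is Cohen-Macaulay and $M$ is a canonical module of $A$.
   Context: The $d$-th Bass number of $M$ with respect to $\mathfrak{m}$ is $\mu_d(\mathfrak{m},M) = \dim_{A/\mathfrak{m}} \operatorname{Ext}^d_A(A/\mathfrak{m}, M)$. $M$ is faithful if its annihilator in $A$ is zero. *)

(* Defs.v *)
Set Warnings "-all".
From HB Require Import structures.
From mathcomp Require Import all_boot all_order all_algebra.
From mathcomp Require Import boolp functions.
From mathcomp Require Import freeg.

Set Implicit Arguments.
Unset Strict Implicit.
Unset Printing Implicit Defensive.

Import GRing.Theory.

Local Open Scope ring_scope.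
Local Open Scope quotient_scope.

(* Submodules and ideals are boolean predicates here and below; by excluded
   middle this covers all submodules and ideals. *)
Section Submodule.
Variables (A : comNzRingType) (V : lmodType A) (S : submodClosed V).

Record submod := Submod { submod_val : V; _ : submod_val \in S }.

HB.instance Definition _ := [isSub for submod_val].
HB.instance Definition _ := [Choice of submod by <:].
HB.instance Definition _ := [SubChoice_isSubLmodule of submod by <:].
End Submodule.

Section QuotientModule.
Variables (A : comNzRingType) (V : lmodType A) (S : submodClosed V).

Definition quotmod_den : {pred V} := S.

Fact quotmod_den_closed : zmod_closed quotmod_den.
Proof.
split=> [|u v Su Sv]; first exact: rpred0.
by apply: rpredD => //; rewrite -scaleN1r rpredZ.
Qed.

HB.instance Definition _ :=
  GRing.isZmodClosed.Build V quotmod_den quotmod_den_closed.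

Definition quotmod : Type := Quotient.quot quotmod_den.

HB.instance Definition _ := GRing.Zmodule.on quotmod.

Definition quotmod_pi (v : V) : quotmod := \pi_(Quotient.quot quotmod_den) v.

Lemma quotmod_piD : {morph quotmod_pi : u v / u + v}.
Proof. exact: raddfD. Qed.

Lemma quotmod_pi0 : quotmod_pi 0 = 0.
Proof. exact: raddf0. Qed.

Lemma quotmod_pi_eq u v : (quotmod_pi u = quotmod_pi v) <-> (u - v \in S).
Proof. rewrite -[_ \in _]/(_ \in quotmod_den) Quotient.idealrBE; split=> [h|/eqP//]; exact/eqP. Qed.

Lemma quotmod_ind (P : quotmod -> Prop) :
  (forall v, P (quotmod_pi v)) -> forall x, P x.
Proof. by move=> h; elim/quotW. Qed.

Definition quotmod_scale (a : A) (x : quotmod) : quotmod :=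
  quotmod_pi (a *: repr (x : Quotient.quot quotmod_den)).

Lemma quotmod_scale_pi a v :
  quotmod_scale a (quotmod_pi v) = quotmod_pi (a *: v).
Proof.
apply/quotmod_pi_eq; rewrite -scalerBr; apply: rpredZ.
rewrite -[_ \in _]/(_ \in quotmod_den).
by rewrite Quotient.idealrBE reprK.
Qed.

Fact quotmod_scaleA a b x :
  quotmod_scale a (quotmod_scale b x) = quotmod_scale (a * b) x.
Proof. by elim/quotmod_ind: x => v; rewrite !quotmod_scale_pi scalerA. Qed.

Fact quotmod_scale1 : left_id 1 quotmod_scale.
Proof. by elim/quotmod_ind => v; rewrite quotmod_scale_pi scale1r. Qed.

Fact quotmod_scaleDr : right_distributive quotmod_scale +%R.
Proof.
move=> a; elim/quotmod_ind => u; elim/quotmod_ind => v.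
by rewrite -quotmod_piD !quotmod_scale_pi scalerDr quotmod_piD.
Qed.

Fact quotmod_scaleDl x : {morph quotmod_scale^~ x : a b / a + b}.
Proof.
elim/quotmod_ind: x => v a b.
by rewrite !quotmod_scale_pi scalerDl quotmod_piD.
Qed.

HB.instance Definition _ := GRing.Zmodule_isLmodule.Build A quotmod
  quotmod_scaleA quotmod_scale1 quotmod_scaleDr quotmod_scaleDl.
End QuotientModule.

Section ResidueModule.
Variables (A : comNzRingType) (m : idealr A).

(* A/m as an A-module. *)
Definition residue_module : Type := {ideal_quot m}.

HB.instance Definition _ := GRing.Zmodule.on residue_module.

Definition residue_scale (a : A) (x : residue_module) : residue_module :=
  (\pi_({ideal_quot m}) a : {ideal_quot m}) * (x : {ideal_quot m}).

Fact residue_scaleA a b x :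
  residue_scale a (residue_scale b x) = residue_scale (a * b) x.
Proof. by rewrite /residue_scale mulrA -rmorphM. Qed.

Fact residue_scale1 : left_id 1 residue_scale.
Proof. by move=> x; rewrite /residue_scale rmorph1 mul1r. Qed.

Fact residue_scaleDr : right_distributive residue_scale +%R.
Proof. by move=> a x y; apply: mulrDr. Qed.

Fact residue_scaleDl x : {morph residue_scale^~ x : a b / a + b}.
Proof. by move=> a b; rewrite /residue_scale rmorphD mulrDl. Qed.

HB.instance Definition _ := GRing.Zmodule_isLmodule.Build A residue_module
  residue_scaleA residue_scale1 residue_scaleDr residue_scaleDl.

Lemma residue_module_killed a (x : residue_module) : a \in m -> a *: x = 0.
Proof.
move=> am; rewrite -[LHS]/(residue_scale a x) /residue_scale.
suff -> : \pi_({ideal_quot m}) a = 0 by rewrite mul0r.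
by rewrite -(rmorph0 \pi_({ideal_quot m})); apply/eqP;
  rewrite -Quotient.idealrBE subr0.
Qed.
End ResidueModule.

Section ResidueSpace.
Variables (A : comNzRingType) (m : idealr A) (E : lmodType A).

(* An A-module E annihilated by m, viewed as a vector space over A/m. *)
Definition residue_space of (forall a (x : E), a \in m -> a *: x = 0) : Type :=
  E.

Hypothesis mE : forall a (x : E), a \in m -> a *: x = 0.
Local Notation Ek := (residue_space mE).

HB.instance Definition _ := GRing.Zmodule.on Ek.

Definition residue_space_scale (c : {ideal_quot m}) (x : Ek) : Ek :=
  repr c *: (x : E).

Lemma residue_space_scale_pi a (x : Ek) :
  residue_space_scale (\pi_({ideal_quot m}) a) x = a *: (x : E).
Proof.
apply/eqP; rewrite -subr_eq0 /residue_space_scale -scalerBl; apply/eqP/mE.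
by rewrite Quotient.idealrBE reprK.
Qed.

Fact residue_space_scaleA b c x :
  residue_space_scale b (residue_space_scale c x)
    = residue_space_scale (b * c) x.
Proof.
elim/quotW: b => b; elim/quotW: c => c.
by rewrite -rmorphM !residue_space_scale_pi scalerA.
Qed.

Fact residue_space_scale1 : left_id 1 residue_space_scale.
Proof.
by move=> x; rewrite -(rmorph1 \pi_({ideal_quot m})) residue_space_scale_pi
  scale1r.
Qed.

Fact residue_space_scaleDr : right_distributive residue_space_scale +%R.
Proof. by move=> c x y; apply: scalerDr. Qed.

Fact residue_space_scaleDl x : {morph residue_space_scale^~ x : b c / b + c}.
Proof.
elim/quotW => b; elim/quotW => c.
by rewrite -rmorphD !residue_space_scale_pi scalerDl.
Qed.

HB.instance Definition _ := GRing.Zmodule_isLmodule.Build {ideal_quot m} Ek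
  residue_space_scaleA residue_space_scale1
  residue_space_scaleDr residue_space_scaleDl.
End ResidueSpace.

(* V has a K-basis of n elements; used with K = A/m. *)
Definition has_dimension (K : nzRingType) (V : lmodType K) (n : nat) : Prop :=
  exists e : 'I_n -> V, forall v : V,
    exists! c : {ffun 'I_n -> K}, v = \sum_i c i *: e i.

Section Resolutions.
Variable A : comNzRingType.
Implicit Types M N : lmodType A.

Definition projective (P : lmodType A) : Prop :=
  forall (U V : lmodType A) (p : {linear U -> V}), (forall v, exists u, p u = v) ->
  forall f : {linear P -> V}, exists g : {linear P -> U}, p \o g =1 f.

Definition injective_module (E : lmodType A) : Prop :=
  forall (U V : lmodType A) (j : {linear U -> V}), injective j ->
  forall f : {linear U -> E}, exists g : {linear V -> E}, g \o j =1 f.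

Record projective_resolution N := ProjectiveResolution {
  pres_obj : nat -> lmodType A;
  pres_dif : forall i, {linear pres_obj i.+1 -> pres_obj i};
  pres_aug : {linear pres_obj 0%N -> N};
  pres_projective : forall i, projective (pres_obj i);
  pres_aug_surj : forall x, exists y, pres_aug y = x;
  pres_exact0 : forall y, pres_aug y = 0 <-> exists z, pres_dif 0%N z = y;
  pres_exactS : forall i y, pres_dif i y = 0 <-> exists z, pres_dif i.+1 z = y
}.

Record injective_resolution M := InjectiveResolution {
  ires_obj : nat -> lmodType A;
  ires_dif : forall i, {linear ires_obj i -> ires_obj i.+1};
  ires_aug : {linear M -> ires_obj 0%N};
  ires_injective : forall i, injective_module (ires_obj i);
  ires_aug_inj : injective ires_aug;
  ires_exact0 : forall y, ires_dif 0%N y = 0 <-> exists z, ires_aug z = y;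
  ires_exactS : forall i y, ires_dif i.+1 y = 0 <-> exists z, ires_dif i z = y
}.

Definition finite_injective_dimension M : Prop :=
  exists (R : injective_resolution M) (n : nat),
    forall i (x : ires_obj R i), (n < i)%N -> x = 0.

Section StandardResolution.

Section Kernel.
Variables (U V : lmodType A) (f : {linear U -> V}).
Definition ker_pred : {pred U} := [pred u | f u == 0].
Fact ker_pred_closed : subsemimod_closed ker_pred.
Proof.
apply: GRing.submod_closed_semi; split=> [|a u v]; rewrite !inE ?raddf0 //.
by move=> /eqP fu /eqP fv; rewrite linearP fu fv scaler0 addr0.
Qed.
HB.instance Definition _ :=
  GRing.isSubmodClosed.Build A U ker_pred ker_pred_closed.
Definition kernel : lmodType A := submod ker_pred.
End Kernel.

Definition free_on N : lmodType A := {freeg N / A}.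

Section Lift.
Variables (N V : lmodType A) (f : N -> V).
Definition free_lift : free_on N -> V := fglift f.
Fact free_lift_linear : linear free_lift.
Proof.
have liftB : {morph free_lift : x y / x - y} by exact: lift_is_additive.
have lift0 : free_lift 0 = 0 by rewrite -[0 in LHS](subrr 0) liftB subrr.
have liftD : {morph free_lift : x y / x + y}.
  move=> x y; rewrite -{1}[y]opprK liftB; congr (_ + _).
  by rewrite -(sub0r y) liftB lift0 sub0r opprK.
move=> a x y; rewrite liftD; congr (_ + _).
rewrite -[in RHS](freeg_sumE x) -[a *: x]/(fgscale a x) /fgscale.
rewrite !(big_morph free_lift liftD lift0) scaler_sumr.
by apply: eq_bigr => z _; rewrite /free_lift !liftU scalerA.
Qed.

HB.instance Definition _ :=
  GRing.isLinear.Build A (free_on N) V *:%R free_lift free_lift_linear.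

Definition free_gen (x : N) : free_on N := << x >>.

Lemma free_liftE x : free_lift (free_gen x) = f x.
Proof. by rewrite /free_lift liftU scale1r. Qed.
End Lift.

Lemma free_on_ext N (V : lmodType A) (f g : {linear free_on N -> V}) :
  (forall x, f (free_gen x) = g (free_gen x)) -> f =1 g.
Proof.
move=> fg x; rewrite -[x]freeg_sumE.
rewrite -[\sum_(_ <- _) _]/(\sum_(z <- dom x) (<< coeff z x *g z >> : free_on N)).
rewrite !raddf_sum; apply: eq_bigr => z _.
have -> : (<< coeff z x *g z >> : free_on N) = coeff z x *: free_gen z.
  by apply/eqP/freeg_eqP=> y; rewrite coeffZ !coeffU mul1r.
by apply: etrans (linearZ_LR f _ _) _; rewrite fg; apply: esym (linearZ_LR g _ _).
Qed.

Lemma free_on_projective N : projective (free_on N).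
Proof.
move=> U V p p_surj f.
have [g pg] := choice (fun x => p_surj (f (free_gen x))).
exists (free_lift g); apply: free_on_ext => x /=.
by rewrite free_liftE.
Qed.

Definition free_cover N : {linear free_on N -> N} := free_lift (@id N).

Lemma free_cover_surj N (x : N) : exists y, free_cover N y = x.
Proof. by exists (free_gen x); rewrite [LHS]free_liftE. Qed.

(* The standard free resolution: syzygy 0 = N, and syzygy i.+1 is the kernel of
   the surjection onto syzygy i from the free module on its underlying set. *)
Fixpoint syzygy N (i : nat) : lmodType A :=
  if i is j.+1 then kernel (free_cover (syzygy N j)) else N.

Definition std_dif N i :
    {linear free_on (syzygy N i.+1) -> free_on (syzygy N i)} :=
  (val : kernel (free_cover (syzygy N i)) -> free_on (syzygy N i))
    \o free_cover (syzygy N i.+1).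

Lemma std_exact N i y :
  free_cover (syzygy N i) y = 0 <-> exists z, std_dif N i z = y.
Proof.
split=> [y0|[z <-]].
  have yk : y \in ker_pred (free_cover (syzygy N i)) by rewrite inE y0.
  have [z zy] := free_cover_surj (Submod yk : syzygy N i.+1).
  by exists z; rewrite /= zy.
by rewrite /=; case: (free_cover _ z) => w /=; rewrite inE => /eqP.
Qed.

Lemma std_exactS N i y :
  std_dif N i y = 0 <-> exists z, std_dif N i.+1 z = y.
Proof.
rewrite -std_exact /=; split=> [y0|->]; last by [].
apply: val_inj; exact: y0.
Qed.

Definition std_resolution N : projective_resolution N :=
  @ProjectiveResolution N (fun i => free_on (syzygy N i)) (std_dif N)
    (free_cover N) (fun i => @free_on_projective (syzygy N i))
    (@free_cover_surj N) (@std_exact N 0) (@std_exactS N).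
End StandardResolution.

Section Ext.
Variables (N : lmodType A) (P : projective_resolution N) (M : lmodType A).
Local Notation F := (pres_obj P).

Definition cocycle (i : nat) : {pred (F i -> M)} :=
  [pred f : F i -> M | `[< linear f /\ f \o pres_dif P i =1 \0 >]].
Arguments cocycle i _ : clear implicits.

Fact cocycle_closed i : subsemimod_closed (cocycle i).
Proof.
apply: GRing.submod_closed_semi; split.
  by apply/asboolP; split=> // a u v; rewrite scaler0 addr0.
move=> a f g /asboolP[fl f0] /asboolP[gl g0]; apply/asboolP; split.
  move=> b u v; rewrite !fctE fl gl !scalerDr !scalerA [b * a]mulrC.
  exact: addrACA.
move=> u; rewrite /= !fctE; have /= -> := f0 u; have /= -> := g0 u.
by rewrite scaler0 addr0.
Qed.

HB.instance Definition _ i :=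
  GRing.isSubmodClosed.Build A (F i -> M) (cocycle i) (cocycle_closed i).

Definition is_coboundary (i : nat) : (F i -> M) -> Prop :=
  match i with
  | 0 => fun f => f =1 \0
  | j.+1 => fun f => exists g : {linear F j -> M}, f =1 g \o pres_dif P j
  end.

Definition coboundary (i : nat) : {pred submod (cocycle i)} :=
  [pred f | `[< is_coboundary (val f) >]].
Arguments coboundary i _ : clear implicits.

Fact coboundary_closed i : subsemimod_closed (coboundary i).
Proof.
apply: GRing.submod_closed_semi; split.
  apply/asboolP; case: i => [|j] //=.
  by exists \0 => u.
move=> a f g /asboolP fB /asboolP gB; apply/asboolP.
case: i f g fB gB => [|j] f g /=.
  by move=> f0 g0 u; rewrite !fctE f0 g0 scaler0 addr0.
move=> [f' ff'] [g' gg'].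
exists (a \*: f' \+ g') => u.
by rewrite !fctE ff' gg'.
Qed.

HB.instance Definition _ i :=
  GRing.isSubmodClosed.Build A (submod (cocycle i)) (coboundary i)
    (coboundary_closed i).

(* H^i(Hom(P, M)), computed from an arbitrary projective resolution P of N. *)
Definition Ext_of (i : nat) : lmodType A := quotmod (coboundary i).

Section Corestrict.
Variables (Q V W : lmodType A) (e : {linear V -> W}) (f : {linear Q -> V}).
Hypothesis ef0 : forall u, e (f u) = 0.

Fact corestrict_subproof u : f u \in ker_pred e.
Proof. by rewrite inE ef0. Qed.

Definition corestrict (u : Q) : kernel e := Submod (corestrict_subproof u).

Fact corestrict_linear : linear corestrict.
Proof. move=> a u v; apply: val_inj; exact: (linearP f). Qed.

HB.instance Definition _ :=
  GRing.isLinear.Build A Q (kernel e) *:%R corestrict corestrict_linear.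
End Corestrict.

Lemma projective_lift (Q U V W : lmodType A) (d : {linear U -> V})
    (e : {linear V -> W}) (f : {linear Q -> V}) :
    projective Q -> (forall v, e v = 0 <-> exists u, d u = v) ->
    (forall u, e (f u) = 0) ->
  exists s : {linear Q -> U}, forall u, d (s u) = f u.
Proof.
move=> projQ exde ef0.
have ed0 u : e (d u) = 0 by apply/exde; exists u.
have surj (v : kernel e) : exists u, corestrict ed0 u = v.
  case: v => v vk; have /exde[u uv] : e v = 0 by apply/eqP; move: vk; rewrite inE.
  by exists u; apply: val_inj.
have [s sE] := projQ _ _ (corestrict ed0) surj (corestrict ef0).
by exists s => u; have /(congr1 val) := sE u.
Qed.

Section Homotopy.
Variable a : A.
Hypothesis aN : forall x : N, a *: x = 0.

Let homotopy i : {linear F i -> F i.+1} -> Prop :=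
  match i with
  | 0 => fun s => forall u, a *: u = pres_dif P 0 (s u)
  | j.+1 => fun s => exists t : {linear F j -> F j.+1},
      forall u, a *: u = pres_dif P j.+1 (s u) + t (pres_dif P j u)
  end.

Let homotopy_exists i : exists s, @homotopy i s.
Proof.
elim: i => [|i [s hs]].
  have [|s sE] := @projective_lift _ _ _ _ (pres_dif P 0) (pres_aug P)
    (a \*: idfun) (@pres_projective _ P 0) (@pres_exact0 _ P).
    by move=> u; rewrite /= linearZ_LR aN.
  by exists s => u; rewrite sE.
have dd u : pres_dif P i (pres_dif P i.+1 u) = 0.
  by apply/pres_exactS; exists u.
have ds v : pres_dif P i (s (pres_dif P i v)) = a *: pres_dif P i v.
  case: i s hs dd v => [|i] s hs dd v /=; first by rewrite -hs.
  have [t tE] := hs; rewrite (tE (pres_dif P i.+1 v)).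
  have -> : pres_dif P i (pres_dif P i.+1 v) = 0.
    by apply/pres_exactS; exists v.
  by rewrite raddf0 addr0.
have [|s' s'E] := @projective_lift _ _ _ _ (pres_dif P i.+1) (pres_dif P i)
    (a \*: idfun \- (s \o pres_dif P i))
    (@pres_projective _ P i.+1) (@pres_exactS _ P i).
  by move=> u; rewrite /= raddfB /= ds linearZ_LR subrr.
by exists s', s => u; rewrite s'E /= subrK.
Qed.

(* Anything annihilating N annihilates Ext(N, M); this makes Ext(A/m, M) a
   vector space over A/m. *)
Lemma Ext_of_killed i (x : Ext_of i) : a *: x = 0.
Proof.
elim/quotmod_ind: x => -[f fZ].
rewrite -[LHS]/(quotmod_scale a _) quotmod_scale_pi.
rewrite -(quotmod_pi0 (coboundary i)).
apply/quotmod_pi_eq; rewrite subr0; apply/asboolP.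
have /asboolP[fl f0] := fZ.
have {fl} [g fg] : exists g : {linear F i -> M}, f = g.
  pose g : {linear F i -> M} :=
    HB.pack f (GRing.isLinear.Build A (F i) M *:%R f fl).
  by exists g.
have {}f0 u : g (pres_dif P i u) = 0 by rewrite -fg; apply: f0.
suff : is_coboundary (a *: f) by [].
have {fZ}-> : a *: f = g \o ( *:%R a) by apply/funext => u /=; rewrite linearZ_LR fg.
have [s] := homotopy_exists i.
case: i {f fg} g f0 s => [|i] g g0 s hs.
  by move=> u; rewrite /= hs g0.
have [t tE] := hs; exists (g \o t) => u.
by rewrite /= tE raddfD -[LHS]/(g _ + g _) g0 add0r.
Qed.
End Homotopy.
End Ext.

Definition Ext (i : nat) N M : lmodType A := Ext_of (std_resolution N) M i.
End Resolutions.

Section Statement.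
Variable A : comNzRingType.
Implicit Types (M : lmodType A) (m : idealr A).

Definition finitely_generated M : Prop :=
  exists (n : nat) (g : 'I_n -> M),
    forall x, exists c : 'I_n -> A, x = \sum_i c i *: g i.

Definition noetherian : Prop :=
  forall I : submodClosed A^o, finitely_generated (submod I).

(* Elements of idealr A are proper ideals. *)
Definition maximal_ideal m : Prop :=
  forall I : idealr A, {subset m <= I} -> I =i m.

Definition local_ring m : Prop :=
  maximal_ideal m /\ forall I : idealr A, maximal_ideal I -> I =i m.

Definition faithful M : Prop :=
  forall a : A, (forall x : M, a *: x = 0) -> a = 0.

(* A chain p 0 < ... < p n has length n; the values p i with i > n are
   irrelevant. *)
Definition prime_chain (p : nat -> prime_idealr A) (n : nat) : Prop :=
  forall i, (i < n)%N ->
    {subset p i <= p i.+1} /\ exists2 a, a \in p i.+1 & a \notin p i.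

Definition krull_dim (d : nat) : Prop :=
  (exists p, prime_chain p d) /\ forall p n, prime_chain p n -> (n <= d)%N.

Definition contains_annihilator M (p : prime_idealr A) : Prop :=
  forall a : A, (forall x : M, a *: x = 0) -> a \in p.

(* The Krull dimension of A / Ann M. *)
Definition module_dim M (d : nat) : Prop :=
  (exists p, prime_chain p d /\ contains_annihilator M (p 0%N)) /\
  forall p n, prime_chain p n -> contains_annihilator M (p 0%N) -> (n <= d)%N.

(* y lies in (s_0, ..., s_{n-1}) M *)
Definition in_seq_mul M (s : seq A) (y : M) : Prop :=
  exists z : 'I_(size s) -> M, y = \sum_(i < size s) s`_i *: z i.

Definition regular_sequence M (s : seq A) : Prop :=
  (forall i (y : M), (i < size s)%N ->
     in_seq_mul (take i s) (s`_i *: y) -> in_seq_mul (take i s) y) /\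
  exists y : M, ~ in_seq_mul s y.

Definition depth m M (t : nat) : Prop :=
  (exists s, [/\ size s = t, {subset s <= m} & regular_sequence M s]) /\
  forall s, {subset s <= m} -> regular_sequence M s -> (size s <= t)%N.

Lemma Ext_residue_killed m M i (a : A) (x : Ext i (residue_module m) M) :
  a \in m -> a *: x = 0.
Proof.
by move=> am; apply: Ext_of_killed => y; apply: residue_module_killed.
Qed.

(* mu_i(m, M) = n *)
Definition bass_number m M (i n : nat) : Prop :=
  has_dimension (residue_space (@Ext_residue_killed m M i)) n.

(* depth and dimension are natural numbers, so the zero module, which has no
   regular sequence, is excluded. *)
Definition cohen_macaulay_module m M : Prop :=
  exists t, depth m M t /\ module_dim M t.

Definition cohen_macaulay_ring m : Prop := cohen_macaulay_module m A^o.

Definition maximal_cohen_macaulay m M : Prop :=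
  cohen_macaulay_module m M /\ exists d, module_dim M d /\ krull_dim d.

(* The type of M is dim Ext^t(A/m, M) for t = depth M. *)
Definition has_type m M (r : nat) : Prop :=
  exists t, depth m M t /\ bass_number m M t r.

(* Bruns-Herzog, Definition 3.3.1: over a Cohen-Macaulay local ring, a maximal
   Cohen-Macaulay module of type 1 and of finite injective dimension. *)
Definition canonical_module m M : Prop :=
  [/\ finitely_generated M, maximal_cohen_macaulay m M, has_type m M 1
    & finite_injective_dimension M].
End Statement.

(* Main.v *)
(* Let I be the minimal injective resolution of M, J its subcomplex of m-power
   torsion elements, and E = J_d. Shifting Ext along syzygies, mu_d(m, M) = 1
   says that E has a simple socle. Then R = End_A(E) is commutative, because an
   endomorphism acts as a scalar on the elements killed by an ideal a with A/a
   torsion; each J_i is a finite power of E, and the differentials of J are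
   matrices over R.

   Choose parameters x_1, ..., x_d filter-regular on M. Low Koszul cohomology of
   J is killed by powers of the elements y of m, which yields homotopies
   y^N = d S + T d modulo some of the x_j, and the Koszul cohomology of J on all
   d parameters vanishes above degree d. Determinants of these homotopies over R
   show first that H^d(J) <> 0 (otherwise M/(x_1, ..., x_(d-1))M would be
   torsion, against Krull's height theorem, M being faithful), and then that
   J_(d-1) -> E is zero. So the x_j are coregular on Z = ker (E -> J_(d+1)), and
   a descending induction on i gives J_i = 0 for i < d; hence the x_j form an
   M-regular sequence. As M is faithful, the Artin-Rees lemma forces Z = E, so
   J_i = 0 for i > d as well. Thus Ext^i(A/m, M) = 0 for i > d and M has finite
   injective dimension; and the x_j, being coregular on E, are A-regular by
   Krull's intersection theorem. *)
Require Import Defs.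
From HB Require Import structures.
From mathcomp Require Import boolp classical_sets functions.
From mathcomp Require Import all_boot all_order all_algebra.
From mathcomp Require Import generic_quotient ring_quotient mxpoly.
From mathcomp Require Import ring zify.

Set Implicit Arguments.
Unset Strict Implicit.
Unset Printing Implicit Defensive.

Import GRing.Theory.
Local Open Scope ring_scope.

Section SquareZero.
Variables (A : comNzRingType) (V : lmodType A).

(* The ring A + V with V square-zero: identities between linear combinations
   in V become ring identities. *)
Definition sqzero : Type := (A * V)%type.
HB.instance Definition _ := GRing.Zmodule.on sqzero.
Definition sqmul (p q : sqzero) : sqzero := (p.1 * q.1, p.1 *: q.2 + q.1 *: p.2).
Definition sqA (a : A) : sqzero := (a, 0).
Definition sqV (v : V) : sqzero := (0, v).

Fact sqmulA : associative sqmul.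
Proof.
move=> [a u] [b v] [c w]; congr (_, _); rewrite /= ?mulrA //.
by rewrite !scalerDr !scalerA addrA [c * a]mulrC [c * b]mulrC.
Qed.
Fact sqmulC : commutative sqmul.
Proof. by move=> [a u] [b v]; congr (_, _); rewrite /= ?[a * b]mulrC // addrC. Qed.
Fact sqmul1 : left_id (sqA 1) sqmul.
Proof. by move=> [a u]; congr (_, _); rewrite /= ?mul1r // scale1r scaler0 addr0. Qed.
Fact sqmulD : left_distributive sqmul +%R.
Proof.
move=> [a u] [b v] [c w]; congr (_, _); rewrite /= ?mulrDl //.
by rewrite scalerDl scalerDr addrACA.
Qed.
Fact sq_neq0 : sqA 1 != 0 :> sqzero.
Proof. by apply/negP => /eqP[] /eqP; rewrite oner_eq0. Qed.
HB.instance Definition _ := GRing.Zmodule_isComNzRing.Build sqzero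
  sqmulA sqmulC sqmul1 sqmulD sq_neq0.

Lemma sqV_inj : injective sqV. Proof. by move=> u v []. Qed.
Lemma sqVD u v : sqV (u + v) = sqV u + sqV v.
Proof. by congr (_, _); rewrite addr0. Qed.
Lemma sqVN u : sqV (- u) = - sqV u.
Proof. by congr (_, _); rewrite oppr0. Qed.
Lemma sqV0 : sqV 0 = 0. Proof. by []. Qed.
Lemma sqVZ a u : sqV (a *: u) = sqA a * sqV u.
Proof. by congr (_, _) => /=; rewrite ?mulr0 // scale0r addr0. Qed.
Lemma sqAD a b : sqA (a + b) = sqA a + sqA b.
Proof. by congr (_, _); rewrite addr0. Qed.
Lemma sqAN a : sqA (- a) = - sqA a.
Proof. by congr (_, _); rewrite oppr0. Qed.
Lemma sqA0 : sqA 0 = 0. Proof. by []. Qed.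
Lemma sqA1 : sqA 1 = 1. Proof. by []. Qed.
Lemma sqAM a b : sqA (a * b) = sqA a * sqA b.
Proof. by congr (_, _); rewrite /= !scaler0 addr0. Qed.
Lemma sqAX a n : sqA (a ^+ n) = sqA a ^+ n.
Proof. by elim: n => // n IHn; rewrite !exprS sqAM IHn. Qed.
Definition sqE := (sqVD, sqVN, sqV0, sqVZ, sqAD, sqAN, sqA0, sqA1, sqAM, sqAX).
End SquareZero.

Ltac lincomb := apply: sqV_inj; rewrite ?sqE; ring.

(** * Submodules, quotients and linear maps *)

Lemma zorn_predicates (T : Type) (P : (T -> Prop) -> Prop) (D0 : T -> Prop) :
  P D0 ->
  (forall F : (T -> Prop) -> Prop,
     (exists D, F D) -> (forall D, F D -> P D) ->
     (forall D D', F D -> F D' ->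
        (forall x, D x -> D' x) \/ (forall x, D' x -> D x)) ->
     P (fun x => exists2 D, F D & D x)) ->
  exists D, [/\ P D, forall x, D0 x -> D x &
    forall D', P D' -> (forall x, D x -> D' x) -> forall x, D' x -> D x].
Proof.
move=> P0 chainP.
pose Q (D : set T) := (forall x, ~ D x) \/ (P D /\ forall x, D0 x -> D x).
have [|D [QD maxD]] := @Zorn_bigcup T Q.
  move=> F FQ totF.
  have [[D [FD [x Dx]]]|noF] :=
    EM (exists D, F D /\ exists x, D x); last first.
    by left=> x [D FD Dx]; apply: noF; exists D; split=> //; exists x.
  right; have Qne D' : F D' -> (exists x, D' x) -> P D' /\ forall x, D0 x -> D' x.
    by move=> FD' [y D'y]; case: (FQ _ FD') => // none; case: (none y).
  split; last by move=> y D0y; exists D => //; have [_] := Qne D FD (ex_intro _ x Dx); apply.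
  pose G (D' : T -> Prop) := F D' /\ exists y, D' y.
  have -> : (\bigcup_(X in F) X)%classic = (fun y => exists2 D', G D' & D' y).
    apply/funext => y; apply/propext; split=> [[D' FD' D'y]|[D' [FD' _] D'y]].
      by exists D' => //; split=> //; exists y.
    by exists D'.
  apply: chainP; first by exists D; split=> //; exists x.
    by move=> D' [FD' ne]; have [] := Qne D' FD' ne.
  by move=> D1 D2 [F1 _] [F2 _]; apply: totF.
have [[y D0y]|D0e] := EM (exists y, D0 y).
  case: QD => [De|[PD D0D]].
    have D0Q : Q D0 by right.
    case: (maxD D0); last by [].
    by split=> [z Dz|/(_ _ D0y)]; [case: (De z)|exact: De].
  exists D; split=> // D' PD' DD' x D'x; apply: contrapT => nDx.
  case: (maxD D'); first by split=> [z /DD'|/(_ _ D'x)].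
  by right; split=> // z /D0D /DD'.
case: QD => [De|[PD D0D]].
  exists D; have DD0 : D = D0.
    by apply/funext=> z; apply/propext; split=> [/De//|D0z]; case: D0e; exists z.
  rewrite {1}DD0; split=> // [x D0x|D' PD' DD' x D'x]; first by case: D0e; exists x.
  apply: contrapT => nDx; case: (maxD D'); first by split=> [z /DD'|/(_ _ D'x)].
  by right; split=> // z D0z; case: D0e; exists z.
exists D; split=> // D' PD' DD' x D'x; apply: contrapT => nDx.
case: (maxD D'); first by split=> [z /DD'|/(_ _ D'x)].
by right; split=> // z /D0D /DD'.
Qed.

Section Submodules.
Variable A : comNzRingType.
Implicit Types U V W : lmodType A.

Definition smod V (P : V -> Prop) :=
  P 0 /\ forall a u v, P u -> P v -> P (a *: u + v).

Lemma smod0 V (P : V -> Prop) : smod P -> P 0. Proof. by case. Qed.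
Lemma smodZ V (P : V -> Prop) a u : smod P -> P u -> P (a *: u).
Proof. by case=> P0 PL Pu; rewrite -[a *: u]addr0; apply: PL. Qed.
Lemma smodD V (P : V -> Prop) u v : smod P -> P u -> P v -> P (u + v).
Proof. by case=> P0 PL Pu Pv; rewrite -[u]scale1r; apply: PL. Qed.
Lemma smodN V (P : V -> Prop) u : smod P -> P u -> P (- u).
Proof. by move=> sP Pu; rewrite -scaleN1r; apply: smodZ. Qed.
Lemma smodB V (P : V -> Prop) u v : smod P -> P u -> P v -> P (u - v).
Proof. by move=> sP Pu Pv; apply: smodD => //; apply: smodN. Qed.
Lemma smodDr V (P : V -> Prop) u v : smod P -> P u -> P (u + v) -> P v.
Proof. by move=> sP Pu Puv; rewrite -[v](addKr u) addrC; apply: smodB. Qed.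
Lemma smodBr V (P : V -> Prop) u v : smod P -> P u -> P (u - v) -> P v.
Proof. by move=> sP Pu Puv; rewrite -[v](subKr u); apply: smodB. Qed.
Lemma smodBl V (P : V -> Prop) u v : smod P -> P v -> P (u - v) -> P u.
Proof. by move=> sP Pu Puv; rewrite -[u](subrK v); apply: smodD. Qed.
Lemma smod_sum V (P : V -> Prop) (I : Type) (r : seq I) (Q : pred I) (F : I -> V) :
  smod P -> (forall i, Q i -> P (F i)) -> P (\sum_(i <- r | Q i) F i).
Proof.
move=> sP PF; apply: (big_ind P) => //; first exact: smod0.
by move=> u v; apply: smodD.
Qed.

Definition mkpred V (P : V -> Prop) (_ : smod P) : {pred V} := [pred v | `[<P v>]].
Arguments mkpred V P _ : clear implicits.

Lemma mkpredE V (P : V -> Prop) (sP : smod P) v : v \in mkpred V P sP <-> P v.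
Proof. by rewrite inE; split=> [/asboolP|Pv] //; apply/asboolP. Qed.

Fact mkpred_closed V (P : V -> Prop) (sP : smod P) :
  subsemimod_closed (mkpred V P sP).
Proof.
apply: GRing.submod_closed_semi; split=> [|a u v /mkpredE Pu /mkpredE Pv].
  exact: (mkpredE sP 0).2 (smod0 sP).
by apply: (mkpredE sP _).2; apply: sP.2.
Qed.

HB.instance Definition _ V (P : V -> Prop) (sP : smod P) :=
  GRing.isSubmodClosed.Build A V (mkpred V P sP) (mkpred_closed sP).

Lemma mklin U V (f : U -> V) : linear f -> exists g : {linear U -> V}, g =1 f.
Proof.
move=> fl; pose g : {linear U -> V} :=
  HB.pack f (GRing.isLinear.Build A U V *:%R f fl).
by exists g.
Qed.

Fact Lin_sig U V (f : U -> V) : linear f -> {g : {linear U -> V} | g =1 f}.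
Proof. by move=> fl; apply/cid/mklin. Qed.
Definition Lin U V (f : U -> V) (fl : linear f) : {linear U -> V} := sval (Lin_sig fl).
Lemma LinE U V (f : U -> V) (fl : linear f) : Lin fl =1 f.
Proof. by rewrite /Lin; case: Lin_sig. Qed.

(* Submodules and quotients are sealed behind their universal maps, to keep the
   unifier away from their construction. *)
Fact psub_sig V (P : V -> Prop) (sP : smod P) : {U : lmodType A & {i : {linear U -> V} |
  [/\ forall u, P (i u), injective i & forall v, P v -> exists u, i u = v]}}.
Proof.
exists (submod (mkpred V P sP)).
exists (Lin (linearP (val : submod (mkpred V P sP) -> V))).
split=> [u|u v|v Pv]; rewrite ?LinE.
- by apply/mkpredE; apply: (valP u).
- exact: val_inj.
by exists (Submod ((mkpredE sP v).2 Pv)); rewrite LinE.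
Qed.
Definition psub V (P : V -> Prop) (sP : smod P) : lmodType A := projT1 (psub_sig sP).
Definition pval V (P : V -> Prop) (sP : smod P) : {linear psub sP -> V} :=
  sval (projT2 (psub_sig sP)).
Lemma pvalP V (P : V -> Prop) (sP : smod P) (u : psub sP) : P (pval sP u).
Proof. by have [+ _ _] := svalP (projT2 (psub_sig sP)); apply. Qed.
Lemma pval_inj V (P : V -> Prop) (sP : smod P) : injective (pval sP).
Proof. by have [] := svalP (projT2 (psub_sig sP)). Qed.
Lemma pval_ex V (P : V -> Prop) (sP : smod P) v : P v -> exists u, pval sP u = v.
Proof. by have [_ _] := svalP (projT2 (psub_sig sP)); apply. Qed.

Fact pquo_sig V (P : V -> Prop) (sP : smod P) : {Q : lmodType A & {p : {linear V -> Q} |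
  (forall v, p v = 0 <-> P v) /\ forall x, exists v, p v = x}}.
Proof.
exists (quotmod (mkpred V P sP)).
have pl : linear (quotmod_pi (mkpred V P sP)).
  move=> a u v; rewrite quotmod_piD; congr (_ + _).
  by rewrite -[RHS]/(quotmod_scale a _) quotmod_scale_pi.
exists (Lin pl); split=> [v|x].
  rewrite LinE -(quotmod_pi0 (mkpred V P sP)).
  by split=> [/quotmod_pi_eq|Pv]; [rewrite subr0 mkpredE|apply/quotmod_pi_eq; rewrite subr0 mkpredE].
by elim/quotmod_ind: x => v; exists v; rewrite LinE.
Qed.
Definition pquo V (P : V -> Prop) (sP : smod P) : lmodType A := projT1 (pquo_sig sP).
Definition pproj V (P : V -> Prop) (sP : smod P) : {linear V -> pquo sP} :=
  sval (projT2 (pquo_sig sP)).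
Lemma pproj_eq0 V (P : V -> Prop) (sP : smod P) v : pproj sP v = 0 <-> P v.
Proof. by have [+ _] := svalP (projT2 (pquo_sig sP)); apply. Qed.
Lemma pproj_surj V (P : V -> Prop) (sP : smod P) x : exists v, pproj sP v = x.
Proof. by have [_] := svalP (projT2 (pquo_sig sP)); apply. Qed.

Lemma lin_factor_surj U V W (d : {linear U -> V}) (g : {linear U -> W}) :
  (forall v, exists u, d u = v) -> (forall u, d u = 0 -> g u = 0) ->
  exists h : {linear V -> W}, forall u, h (d u) = g u.
Proof.
move=> /choice[s sE] gd.
have gE u : g (s (d u)) = g u.
  by apply/eqP; rewrite -subr_eq0 -linearB; apply/eqP/gd; rewrite linearB sE subrr.
have hl : linear (g \o s).
  move=> a u v /=; rewrite -linearP; apply/eqP; rewrite -subr_eq0 -linearB.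
  by apply/eqP/gd; rewrite linearB linearP !sE subrr.
by exists (Lin hl) => u; rewrite LinE /= gE.
Qed.

Lemma lin_factor_inj U V W (d : {linear U -> V}) (g : {linear W -> V}) :
  injective d -> (forall w, exists u, d u = g w) ->
  exists h : {linear W -> U}, forall w, d (h w) = g w.
Proof.
move=> d_inj /choice[s sE].
have sl : linear s by move=> a u v; apply: d_inj; rewrite sE (linearP d) (linearP g) !sE.
by exists (Lin sl) => w; rewrite LinE.
Qed.

Lemma inj_ker0 U V (d : {linear U -> V}) :
  (forall u, d u = 0 -> u = 0) -> injective d.
Proof.
move=> d0 u v /eqP; rewrite -subr_eq0 -linearB => /eqP/d0/eqP.
by rewrite subr_eq0 => /eqP.
Qed.

Lemma smod_ker U V (f : {linear U -> V}) : smod (fun u => f u = 0).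
Proof.
by split=> [|a u v fu fv]; rewrite ?linear0 // linearP fu fv scaler0 addr0.
Qed.

Lemma smod_img U V (f : {linear U -> V}) (P : U -> Prop) :
  smod P -> smod (fun v => exists2 u, P u & f u = v).
Proof.
move=> sP; split=> [|a _ _ [u Pu <-] [v Pv <-]]; first by exists 0; [exact: smod0|rewrite linear0].
by exists (a *: u + v); [exact: sP.2|rewrite linearP].
Qed.

Lemma smod_im U V (f : {linear U -> V}) : smod (fun v => exists u, f u = v).
Proof.
split=> [|a _ _ [u <-] [v <-]]; first by exists 0; rewrite linear0.
by exists (a *: u + v); rewrite linearP.
Qed.

Lemma smodT V : smod (fun _ : V => True). Proof. by []. Qed.
Lemma smod_eq0 V : smod (fun v : V => v = 0).
Proof. by split=> // a u v -> ->; rewrite scaler0 addr0. Qed.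

Lemma smodI V (P Q : V -> Prop) : smod P -> smod Q -> smod (fun v => P v /\ Q v).
Proof.
by move=> [P0 PL] [Q0 QL]; split=> // a u v [? ?] [? ?]; split; [exact: PL|exact: QL].
Qed.

Definition saddp V (P Q : V -> Prop) := fun v => exists2 u, P u & Q (v - u).
Lemma smod_add V (P Q : V -> Prop) : smod P -> smod Q -> smod (saddp P Q).
Proof.
move=> sP sQ; split=> [|a u v [u' Pu Qu] [v' Pv Qv]].
  by exists 0; [exact: smod0|rewrite subr0; exact: smod0].
exists (a *: u' + v'); first exact: sP.2.
have -> : a *: u + v - (a *: u' + v') = a *: (u - u') + (v - v').
  by rewrite scalerBr opprD addrACA.
exact: sQ.2.
Qed.

Lemma smod_line V (v : V) : smod (fun u => exists a : A, u = a *: v).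
Proof.
split=> [|a _ _ [b ->] [c ->]]; first by exists 0; rewrite scale0r.
by exists (a * b + c); rewrite scalerDl scalerA.
Qed.

Lemma smod_chain V (F : (V -> Prop) -> Prop) :
  (exists D, F D) -> (forall D, F D -> smod D) ->
  (forall D D', F D -> F D' -> (forall x, D x -> D' x) \/ (forall x, D' x -> D x)) ->
  smod (fun x => exists2 D, F D & D x).
Proof.
move=> [D0 FD0] Fs tot; split; first by exists D0 => //; apply: smod0 (Fs _ FD0).
move=> a u v [D FD Du] [D' FD' D'v].
have [DD'|D'D] := tot _ _ FD FD'.
  by exists D' => //; apply: (Fs _ FD').2 => //; apply: DD'.
by exists D => //; apply: (Fs _ FD).2 => //; apply: D'D.
Qed.

End Submodules.
Arguments pval {A V P} sP.
Arguments pproj {A V P} sP.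
Arguments pval_inj {A V P} sP [x1 x2] _.

Section Spans.
Variable A : comNzRingType.
Implicit Types U V W : lmodType A.

Fixpoint lspan V (s : seq V) (v : V) : Prop :=
  if s is x :: s' then exists a : A, lspan s' (v - a *: x) else v = 0.

Lemma smod_span V (s : seq V) : smod (lspan s).
Proof.
elim: s => [|x s IHs] /=; first exact: smod_eq0.
split=> [|a u v [b ub] [c vc]].
  by exists 0; rewrite scale0r subr0; apply: smod0.
exists (a * b + c).
have -> : a *: u + v - (a * b + c) *: x = a *: (u - b *: x) + (v - c *: x).
  by rewrite scalerDl opprD addrACA scalerBr scalerA.
exact: IHs.2.
Qed.

Lemma span_mem V (s : seq V) x : x \in s -> lspan s x.
Proof.
elim: s => //= y s IHs; rewrite inE => /orP[/eqP ->|/IHs xs].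
  by exists 1; rewrite scale1r subrr; apply: smod0 (smod_span s).
by exists 0; rewrite scale0r subr0.
Qed.

Lemma span_sub V (P : V -> Prop) (s : seq V) v :
  smod P -> (forall x, x \in s -> P x) -> lspan s v -> P v.
Proof.
move=> sP; elim: s v => [|x s IHs] v /= Ps; first by move=> ->; apply: smod0.
move=> [a va]; rewrite -[v](subrK (a *: x)); apply: smodD => //.
  by apply: IHs => // y ys; apply: Ps; rewrite inE ys orbT.
by apply: smodZ => //; apply: Ps; rewrite mem_head.
Qed.

Lemma span_map U V (f : {linear U -> V}) (s : seq U) u :
  lspan s u -> lspan (map f s) (f u).
Proof.
elim: s u => [|x s IHs] u /=; first by move=> ->; rewrite linear0.
by move=> [a ua]; exists a; rewrite -linearZ_LR -linearB; apply: IHs.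
Qed.

Lemma span_map_inv U V (f : {linear U -> V}) (s : seq U) v :
  lspan (map f s) v -> exists2 u, lspan s u & f u = v.
Proof.
elim: s v => [|x s IHs] v /=; first by move=> ->; exists 0; rewrite ?linear0.
move=> [a /IHs[u us fu]]; exists (u + a *: x); first by exists a; rewrite addrK.
by rewrite linearD linearZ_LR fu subrK.
Qed.

Lemma span_cat V (s t : seq V) v :
  lspan (s ++ t) v <-> exists2 u, lspan s u & lspan t (v - u).
Proof.
elim: s v => [|x s IHs] v /=.
  by split=> [vt|[u -> ]]; [exists 0; rewrite ?subr0|rewrite subr0].
split=> [[a /IHs[u us ut]]|[u [a us] ut]].
  exists (u + a *: x); first by exists a; rewrite addrK.
  by rewrite opprD addrA addrAC.
by exists a; apply/IHs; exists (u - a *: x) => //; rewrite opprB addrA subrK.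
Qed.

Lemma span_ord V (s : seq V) v :
  lspan s v <-> exists c : 'I_(size s) -> A, v = \sum_(i < size s) c i *: s`_i.
Proof.
elim: s v => [|x s IHs] v /=.
  by split=> [->|[c ->]]; [exists (fun=> 0)|]; rewrite big_ord0.
split=> [[a /IHs[c cE]]|[c ->]].
  exists (fun i => if unlift ord0 i is Some j then c j else a).
  rewrite big_ord_recl /= unlift_none -[v](subrK (a *: x)) cE addrC.
  by congr (_ + _); apply: eq_bigr => i _; rewrite liftK.
exists (c ord0); apply/IHs; exists (fun i => c (lift ord0 i)).
by rewrite big_ord_recl /= addrC addKr.
Qed.

Definition fgp V (P : V -> Prop) :=
  exists2 s : seq V, (forall x, x \in s -> P x) & forall v, P v -> lspan s v.
Definition fgm V := exists s : seq V, forall v, lspan s v.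
Definition noethm V := forall P : V -> Prop, smod P -> fgp P.

Lemma fgmE V : finitely_generated V -> fgm V.
Proof.
move=> [n [g gE]]; exists [seq g i | i <- enum 'I_n] => v; have [c ->] := gE v.
apply: smod_sum; first exact: smod_span.
move=> i _; apply: smodZ; first exact: smod_span.
by apply: span_mem; apply: map_f; rewrite mem_enum.
Qed.

Lemma fgm_surj U V (f : {linear U -> V}) :
  (forall v, exists u, f u = v) -> fgm U -> fgm V.
Proof.
by move=> fs [s sE]; exists (map f s) => v; have [u <-] := fs v; apply: span_map.
Qed.

Lemma fgm_pair U V : fgm U -> fgm V -> fgm (U * V)%type.
Proof.
move=> [s sE] [t tE].
pose i1 (u : U) : (U * V)%type := (u, 0); pose i2 (v : V) : (U * V)%type := (0, v).
have i1l : linear i1.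
  by move=> a u v; rewrite /i1; congr pair => //=; rewrite scaler0 addr0.
have i2l : linear i2.
  by move=> a u v; rewrite /i2; congr pair => //=; rewrite scaler0 addr0.
exists (map (Lin i1l) s ++ map (Lin i2l) t) => -[u v]; apply/span_cat.
exists (Lin i1l u); first exact: span_map.
have -> : (u, v) - Lin i1l u = Lin i2l v; last exact: span_map.
by rewrite !LinE /i1 /i2; congr pair => /=; rewrite ?subrr ?subr0.
Qed.

Lemma fgp_sub V (P : V -> Prop) (sP : smod P) : fgp P -> fgm (psub sP).
Proof.
move=> [s sP' sE].
have [t tE] : exists t : seq (psub sP), map (pval sP) t = s.
  elim: s sP' {sE} => [|x s IHs] sP'; first by exists [::].
  have [t tE] := IHs (fun y ys => sP' y (mem_behead (s := x :: s) ys)).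
  have [x' x'E] := pval_ex sP (sP' x (mem_head _ _)).
  by exists (x' :: t); rewrite -tE -x'E.
exists t => v; have := sE _ (pvalP v); rewrite -tE => /span_map_inv[u us uv].
by rewrite -(pval_inj sP uv).
Qed.

Definition regm : lmodType A := A^o.

Lemma regmE (a b : A) : a *: (b : regm) = a * b. Proof. by []. Qed.

Hypothesis Anoeth : noetherian A.

Lemma noethm_ring : noethm regm.
Proof.
move=> P sP; have [s sE] := fgmE (Anoeth (mkpred sP)).
have [i iE] := mklin (linearP (val : submod (mkpred sP) -> regm)).
exists (map i s) => [x /mapP[u _ ->]|v Pv].
  by rewrite iE; apply/mkpredE; apply: (valP u).
have vP : v \in mkpred sP by apply/mkpredE.
by rewrite -[v]/(val (Submod vP)) -iE; apply: span_map; apply: sE.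
Qed.

Lemma span_lift V (Q : regm -> V -> Prop) (s : seq regm) :
  (forall a b c u v, Q b u -> Q c v -> Q (a * b + c) (a *: u + v)) -> Q 0 0 ->
  (forall x, x \in s -> exists v, Q x v) ->
  exists2 t : seq V, (forall v, v \in t -> exists x, Q x v) &
    forall a, lspan s a -> exists2 v, lspan t v & Q a v.
Proof.
move=> QL Q0; elim: s => [|x s IHs] sQ.
  by exists [::] => // a /= ->; exists 0.
have [y ys|t tQ tE] := IHs; first by apply: sQ; rewrite inE ys orbT.
have [v xv] := sQ x (mem_head _ _).
exists (v :: t) => [w|a /= [b /tE[w wt Qw]]].
  by rewrite inE => /orP[/eqP ->|/tQ //]; exists x.
exists (b *: v + w); first by exists b; rewrite addrC addKr.
by have := QL b _ _ _ _ xv Qw; congr Q; rewrite regmE addrC subrK.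
Qed.

Lemma fgp_span V (s : seq V) (P : V -> Prop) :
  smod P -> (forall v, P v -> lspan s v) -> fgp P.
Proof.
elim: s P => [|x s IHs] P sP Ps.
  by exists [::].
pose Q (a : regm) v := P v /\ lspan s (v - a *: x).
have QL a b c u v : Q b u -> Q c v -> Q (a * b + c) (a *: u + v).
  move=> [Pu us] [Pv vs]; split; first exact: sP.2.
  have -> : a *: u + v - (a * b + c) *: x = a *: (u - b *: x) + (v - c *: x).
    by rewrite scalerDl opprD addrACA scalerBr scalerA.
  exact: (smod_span s).2.
have Q0 : Q 0 0.
  by split; rewrite ?scale0r ?subrr; [exact: smod0|exact: smod0 (smod_span s)].
have sI : smod (fun a : regm => exists v, Q a v).
  split=> [|a b c [u bu] [v cv]]; first by exists 0.
  by exists (a *: u + v); apply: QL.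
have [t tI tE] := noethm_ring sI.
have [t' t'Q t'E] := span_lift QL Q0 tI.
have [||s' s'P s'E] := IHs (fun v => P v /\ lspan s v).
- by apply: smodI => //; apply: smod_span.
- by move=> v [].
exists (t' ++ s') => [v|v Pv].
  by rewrite mem_cat => /orP[/t'Q[a []]|/s'P[]].
have [a va] := Ps _ Pv.
have /tE/t'E[w wt' [Pw ws]] : exists v, Q a v by exists v.
apply/span_cat; exists w => //; apply: s'E; split; first exact: smodB.
have -> : v - w = (v - a *: x) - (w - a *: x) by rewrite opprB addrA subrK.
by apply: smodB => //; apply: smod_span.
Qed.

Lemma noethm_fg V : fgm V -> noethm V.
Proof. by move=> [s sE] P sP; apply: fgp_span sP _ => v _; exact: sE. Qed.

Lemma fgm_sub V (P : V -> Prop) (sP : smod P) : fgm V -> fgm (psub sP).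
Proof. by move=> /noethm_fg nV; apply: fgp_sub; apply: nV. Qed.

Lemma fgm_quo V (P : V -> Prop) (sP : smod P) : fgm V -> fgm (pquo sP).
Proof. by apply: fgm_surj; apply: pproj_surj. Qed.

Lemma fgm_inj U V (f : {linear U -> V}) : injective f -> fgm V -> fgm U.
Proof.
move=> f_inj /noethm_fg nV.
have [w|g gE] := lin_factor_inj f_inj (g := pval (smod_im f)).
  by have [u] := pvalP w; exists u.
apply: (fgm_surj (f := g)); last by apply: fgp_sub; apply: nV; apply: smod_im.
move=> u; have [|w wE] := pval_ex (smod_im f) (v := f u); first by exists u.
by exists w; apply: f_inj; rewrite gE.
Qed.

Lemma fgm_ring : fgm regm.
Proof.
exists [:: (1 : A) : regm] => a /=; exists a.
by rewrite regmE mulr1 subrr.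
Qed.

Lemma noeth_max V (F : (V -> Prop) -> Prop) :
  noethm V -> (exists D, F D) -> (forall D, F D -> smod D) ->
  exists2 D, F D & forall D', F D' -> (forall x, D x -> D' x) -> forall x, D' x -> D x.
Proof.
move=> nV [D0 FD0] Fs.
have [|D [FD _ Dmax]] := @zorn_predicates V F D0 FD0; last by exists D.
move=> G Gne GF Gtot.
have sG : smod (fun x => exists2 D, G D & D x).
  by apply: smod_chain => // D /GF/Fs.
have [s sG' sE] := nV _ sG.
have [D GD Ds] : exists2 D, G D & forall x, x \in s -> D x.
  elim: s sG' {sE} => [|x s IHs] sG'; first by have [D GD] := Gne; exists D.
  have [y ys|D GD Ds] := IHs; first by apply: sG'; rewrite inE ys orbT.
  have [D' GD' D'x] := sG' x (mem_head _ _).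
  have [DD'|D'D] := Gtot _ _ GD GD'.
    by exists D' => // y; rewrite inE => /orP[/eqP ->|/Ds/DD'].
  by exists D => // y; rewrite inE => /orP[/eqP ->|/Ds //]; apply: D'D.
have -> : (fun x => exists2 D, G D & D x) = D; last exact: GF.
apply/funext=> x; apply/propext; split=> [Gx|Dx]; last by exists D.
by apply: span_sub (sE _ Gx) => //; apply: Fs (GF _ GD).
Qed.

Lemma noeth_stable V (P : nat -> V -> Prop) :
  noethm V -> (forall n, smod (P n)) -> (forall n v, P n v -> P n.+1 v) ->
  exists N, forall n v, P n v -> P N v.
Proof.
move=> nV sP incP.
have leP n k v : P n v -> P (n + k)%N v.
  by move=> Pv; elim: k => [|k IHk]; rewrite ?addn0 // addnS; apply: incP.
have sU : smod (fun v => exists n, P n v).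
  split=> [|a u v [n Pu] [k Pv]]; first by exists 0%N; apply: smod0.
  by exists (n + k)%N; apply: (sP _).2; [apply: leP|rewrite addnC; apply: leP].
have [s sP' sE] := nV _ sU.
have [N sN] : exists N, forall x, x \in s -> P N x.
  elim: s sP' {sE} => [|x s IHs] sP'; first by exists 0%N.
  have [y ys|N sN] := IHs; first by apply: sP'; rewrite inE ys orbT.
  have [k Pk] := sP' x (mem_head _ _); exists (N + k)%N => y.
  rewrite inE => /orP[/eqP ->|/sN Py]; last exact: leP.
  by rewrite addnC; apply: leP.
by exists N => n v Pv; apply: span_sub (sE _ _) => //; exists n.
Qed.

End Spans.
Arguments regm : clear implicits.

(** * Injective modules *)

Section InjectiveExtension.
Variable A : comNzRingType.
Implicit Types U V W E F : lmodType A.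

Lemma inj_extend E U V (f : {linear U -> V}) (g : {linear U -> E}) :
  injective_module E -> (forall u, f u = 0 -> g u = 0) ->
  exists h : {linear V -> E}, forall u, h (f u) = g u.
Proof.
move=> Einj fg0; have sI := smod_im f.
have [w|f' f'E] := lin_factor_inj (pval_inj sI) (g := f).
  by apply: pval_ex; exists w.
have f's w : exists u, f' u = w.
  by have [u fu] := pvalP w; exists u; apply: (pval_inj sI); rewrite f'E.
have [u f'u0|h hE] := lin_factor_surj (g := g) f's.
  by apply: fg0; rewrite -f'E f'u0 linear0.
have [k kE] := Einj _ _ (pval sI) (pval_inj sI) h.
by exists k => u; rewrite -hE -f'E; apply: kE.
Qed.

Lemma mul_linear V (v : V) : linear (fun a : regm A => (a : A) *: v).
Proof. by move=> a b c; rewrite scalerDl scalerA. Qed.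

Lemma inj_cyclic E V (v : V) (e : E) :
  injective_module E -> (forall a, a *: v = 0 -> a *: e = 0) ->
  exists f : {linear V -> E}, f v = e.
Proof.
move=> Einj ve0.
have [u|h hE] := inj_extend (f := Lin (mul_linear v)) (g := Lin (mul_linear e)) Einj.
  by rewrite !LinE; apply: ve0.
by exists h; have := hE (1 : A); rewrite !LinE !scale1r.
Qed.

Lemma inj_retract E F (i : {linear F -> E}) (r : {linear E -> F}) :
  injective_module E -> (forall x, r (i x) = x) -> injective_module F.
Proof.
move=> Einj ri U V j jinj f.
have [g gE] := Einj _ _ j jinj (i \o f).
by exists (r \o g) => u /=; rewrite -[RHS]ri; congr (r _); apply: gE.
Qed.

Lemma inj_split E V (j : {linear E -> V}) :
  injective_module E -> injective j ->
  exists r : {linear V -> E}, forall x, r (j x) = x.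
Proof. by move=> Einj jinj; have [r rE] := Einj _ _ j jinj idfun; exists r. Qed.

Lemma inj_pair E F :
  injective_module E -> injective_module F -> injective_module (E * F)%type.
Proof.
move=> Einj Finj U V j jinj f.
have [g1 g1E] := Einj _ _ j jinj (fst \o f).
have [g2 g2E] := Finj _ _ j jinj (snd \o f).
have gl : linear (fun v => (g1 v, g2 v)) by move=> a u v; rewrite !linearP.
exists (Lin gl) => u; rewrite /= LinE [RHS]surjective_pairing.
by congr pair; [exact: g1E|exact: g2E].
Qed.

Lemma inj_fun (X : Type) E : injective_module E -> injective_module (X -> E).
Proof.
move=> Einj U V j jinj f.
have ex (x : X) : exists g : {linear V -> E}, forall u, g (j u) = f u x.
  have fl : linear (fun u => f u x) by move=> a u v; rewrite linearP.
  by have [g gE] := Einj _ _ j jinj (Lin fl); exists g => u; rewrite -(LinE fl); apply: gE.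
have [g gE] := choice ex.
have gl : linear (fun v x => g x v).
  by move=> a u v; apply/funext => x; rewrite linearP.
by exists (Lin gl) => u; apply/funext => x; rewrite /= LinE gE.
Qed.

(* Linear maps are handled as functional submodules of V * E. *)
Lemma baer E :
  (forall (P : regm A -> Prop) (sP : smod P) (f : {linear psub sP -> E}),
     exists e, forall x, f x = (pval sP x : A) *: e) ->
  injective_module E.
Proof.
move=> baerE U V j jinj f.
pose good (G : V * E -> Prop) := smod G /\ forall e, G (0, e) -> e = 0.
pose G0 (p : V * E) := exists u, (j u, f u) = p.
have gr_l : linear (fun u => (j u, f u)) by move=> a u v; rewrite !linearP.
have G0E p : G0 p <-> exists u, Lin gr_l u = p.
  by split=> -[u up]; exists u; move: up; rewrite LinE.
have gG0 : good G0.
  split; last by move=> e [u [ju <-]]; rewrite (jinj u 0) ?linear0.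
  have [i0 iL] := smod_im (Lin gr_l); split; first exact/G0E.
  by move=> a p q /G0E Gp /G0E Gq; apply/G0E; apply: iL.
have [|G [[sG fG] G0G maxG]] := @zorn_predicates (V * E)%type good G0 gG0.
  move=> F Fne Fg Ftot; split; first by apply: smod_chain => // D /Fg[].
  by move=> e [D /Fg[_ Df] De]; apply: Df.
have Guniq v e e' : G (v, e) -> G (v, e') -> e = e'.
  move=> Ge Ge'; apply/eqP; rewrite -subr_eq0; apply/eqP/fG.
  have -> : (0, e - e') = (v, e) - (v, e') by rewrite -[RHS]/(v - v, e - e') subrr.
  exact: smodB.
have Gtot v : exists e, G (v, e).
  pose P (a : regm A) := exists e, G ((a : A) *: v, e).
  have PL a b c u w : G (b *: v, u) -> G (c *: v, w) ->
      G ((a * b + c) *: v, a *: u + w).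
    move=> Gu Gw; have -> : ((a * b + c) *: v, a *: u + w) =
      a *: ((b *: v, u) : V * E) + (c *: v, w) by congr pair; rewrite /= scalerDl scalerA.
    exact: sG.2.
  have sP : smod P.
    split=> [|a b c [e be] [e' ce']].
      by exists 0; rewrite scale0r; apply: smod0 sG.
    by exists (a *: e + e'); apply: PL.
  have [g gE] := choice (fun x => pvalP (sP := sP) x).
  have gl : linear g.
    move=> a b c; apply: (Guniq _ _ _ (gE _)).
    by have := PL a _ _ _ _ (gE b) (gE c); rewrite linearP.
  have [e eE] := baerE P sP (Lin gl).
  have Pe a w : G (a *: v, w) -> w = a *: e.
    move=> Gw; have [x xE] : exists x, pval sP x = a.
      by apply: pval_ex; exists w.
    rewrite -xE -eE LinE; apply: (Guniq _ _ _ _ (gE x)).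
    by rewrite xE.
  exists e.
  pose G' (p : V * E) := exists b, G (p - b *: (v, e)).
  have sG' : smod G'.
    split=> [|a p q [b pb] [c qc]].
      by exists 0; rewrite scale0r subr0; apply: smod0.
    exists (a * b + c).
    have -> : a *: p + q - (a * b + c) *: (v, e) =
      a *: (p - b *: (v, e)) + (q - c *: (v, e)).
      by rewrite scalerBr scalerDl opprD addrACA scalerA.
    exact: sG.2.
  have gG' : good G'.
    split=> // w [b Gb]; have H : G ((- b) *: v, w - b *: e).
      by rewrite scaleNr -sub0r.
    by rewrite -[w](subrK (b *: e)) (Pe _ _ H) scaleNr addNr.
  apply: (maxG G' gG').
    by move=> p Gp; exists 0; rewrite scale0r subr0.
  by exists 1; rewrite scale1r subrr; apply: smod0.
have [g gE] := choice Gtot.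
have gl : linear g.
  move=> a u v; apply: (Guniq _ _ _ (gE _)).
  have -> : (a *: u + v, a *: g u + g v) = a *: ((u, g u) : V * E) + (v, g v) by [].
  exact: sG.2.
exists (Lin gl) => u /=; rewrite LinE; apply: (Guniq _ _ _ (gE _)).
by apply: G0G; exists u.
Qed.

End InjectiveExtension.

Local Notation "M ^z" := (zmodule M) (at level 2, format "M ^z") : type_scope.

Section DivisibleInjective.

Lemma int_ideal_principal (P : regm int -> Prop) : smod P ->
  exists2 g : int, P g & forall x, P x -> exists k, x = k * g.
Proof.
move=> sP; have [Pz|nz] := EM (forall x, P x -> x = 0).
  by exists 0; [exact: smod0 sP|move=> x /Pz ->; exists 0; rewrite mul0r].
have [n [n0 Pn]] : exists n : nat, (0 < n)%N /\ P n%:Z.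
  have [x [Px x0]] : exists x, P x /\ x <> 0.
    by apply: contrapT => H; apply: nz => x Px; apply: contrapT => x0; apply: H; exists x.
  exists `|x|%N; split; first by rewrite absz_gt0; apply/eqP.
  case: x Px x0 => k Px x0 //=.
  have : P (- (Negz k : int)) := smodN sP Px.
  by rewrite NegzE opprK.
have ex : exists n, (0 < n)%N && `[<P n%:Z>] by exists n; rewrite n0; apply/asboolP.
case: (ex_minnP ex) => g /andP[g0 /asboolP Pg] gmin.
exists g%:Z => // x Px; exists (x %/ g%:Z)%Z.
have gn0 : g%:Z != 0 by rewrite eqz_nat -lt0n.
have Pr : P ((x %% g%:Z)%Z).
  exact: (smodB sP Px (smodZ (x %/ g%:Z)%Z sP Pg)).
rewrite {1}(divz_eq x g%:Z); have r_ge0 := modz_ge0 x gn0.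
have r_lt : (`|(x %% g%:Z)%Z| < g)%N.
  by rewrite -ltz_nat gez0_abs // ltz_pmod // ltz_nat.
suff -> : (x %% g%:Z)%Z = 0 by rewrite addr0.
apply/eqP; rewrite -absz_eq0; apply: contraLR r_lt; rewrite -leqNgt -lt0n => r0.
by apply: gmin; rewrite r0; apply/asboolP; rewrite gez0_abs.
Qed.

Lemma divisible_injective (D : lmodType int) :
  (forall (k : int) (x : D), k != 0 -> exists y, k *: y = x) -> injective_module D.
Proof.
move=> divD; apply: baer => P sP f.
have [g Pg gE] := int_ideal_principal sP.
have [u ug] := pval_ex sP Pg.
have fk x : exists k, x = k *: u.
  have [k kE] := gE _ (pvalP x); exists k; apply: (pval_inj sP).
  by rewrite linearZ_LR ug kE.
have [g0|gn0] := eqVneq g 0.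
  exists 0 => x; have [k ->] := fk x.
  have -> : u = 0 by apply: (pval_inj sP); rewrite ug g0 linear0.
  by rewrite !(linear0, scaler0).
have [y yE] := divD g (f u) gn0.
exists y => x; have [k ->] := fk x.
by rewrite linearZ_LR -yE linearZ_LR ug scalerA.
Qed.

Definition integral_rat (q : rat^z) := exists k : int, q = (k%:~R : rat).
Lemma smod_integral_rat : smod integral_rat.
Proof.
split=> [|a _ _ [k ->] [l ->]]; first by exists 0.
by exists (k * a + l); rewrite scalezrE intrD intrM mulrzr.
Qed.

Definition QZ : lmodType int := pquo smod_integral_rat.

Lemma QZ_injective : injective_module QZ.
Proof.
apply: divisible_injective => k x k0; have [q <-] := pproj_surj x.
exists (pproj smod_integral_rat ((q : rat) / k%:~R : rat)).
rewrite -linearZ_LR; congr (pproj _ _); rewrite scalezrE.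
by rewrite -[LHS]mulrzr divfK // intr_eq0.
Qed.

Lemma QZ_separates (V : lmodType int) (v : V) :
  v != 0 -> exists f : {linear V -> QZ}, f v != 0.
Proof.
move=> v0; have sP : smod (fun a : regm int => (a : int) *: v = 0).
  split=> [|a b c bv cv]; first by rewrite scale0r.
  by rewrite scalerDl -scalerA bv cv scaler0 addr0.
have [g gv gE] := int_ideal_principal sP.
have [q [qz qg]] : exists q : rat, ~ integral_rat q /\ integral_rat (g%:~R * q).
  have [g0|gn0] := eqVneq g 0.
    exists (1 / 2%:Q); split; last by exists 0; rewrite g0 mul0r.
    move=> [k kE]; have : (1 : int) = k * 2.
      apply/eqP; rewrite -(eqr_int rat); apply/eqP.
      by rewrite intrM -kE mul1r mulVf.
    by move=> /(congr1 (fun z => (z %% 2)%Z)); rewrite modzMl.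
  exists (g%:~R^-1); split; last by exists 1; rewrite mulfV // intr_eq0.
  move=> [k kE]; have gk : (1 : int) = k * g.
    apply/eqP; rewrite -(eqr_int rat); apply/eqP.
    by rewrite intrM -kE mulVf // intr_eq0.
  by case/eqP: v0; rewrite -[v]scale1r gk -scalerA gv scaler0.
have [a av0|f fv] := inj_cyclic (v := v) (e := pproj smod_integral_rat q) QZ_injective.
  have [k ->] := gE a av0; rewrite -linearZ_LR; apply/pproj_eq0.
  have [l lE] := qg; exists (k * l); rewrite scalezrE -mulrzr !intrM -lE.
  by rewrite mulrC mulrA.
by exists f; rewrite fv; apply/eqP => /pproj_eq0.
Qed.

End DivisibleInjective.

Section Coinduced.
Variable A : comNzRingType.

Definition int_linear : {pred (A^z -> QZ)} := [pred f | `[<linear f>]].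
Fact int_linear_closed : zmod_closed int_linear.
Proof.
split=> [|f g]; first by apply/asboolP => a u v; rewrite scaler0 addr0.
move=> /asboolP fl /asboolP gl; apply/asboolP => a u v.
by rewrite !fctE fl gl scalerBr opprD addrACA.
Qed.
HB.instance Definition _ :=
  GRing.isZmodClosed.Build (A^z -> QZ) int_linear int_linear_closed.

Record coind := Coind { coind_val : A^z -> QZ; _ : coind_val \in int_linear }.
HB.instance Definition _ := [isSub for coind_val].
HB.instance Definition _ := [Choice of coind by <:].
HB.instance Definition _ := [SubChoice_isSubZmodule of coind by <:].

Lemma coind_linear (f : coind) : linear (coind_val f).
Proof. by case: f => f /=; move=> /asboolP. Qed.

Fact coind_scale_subproof (a : A) (f : coind) :
  (fun b : A^z => coind_val f ((a * b : A) : A^z)) \in int_linear.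
Proof.
apply/asboolP => k u v; rewrite -coind_linear; congr (coind_val f _).
by rewrite !scalezrE mulrDr mulrzAr.
Qed.
Definition coind_scale a f : coind := Coind (coind_scale_subproof a f).

Lemma coind_eq (f g : coind) : (forall b, coind_val f b = coind_val g b) -> f = g.
Proof. by move=> fg; apply: val_inj; apply/funext. Qed.

Fact coind_scaleA a b x : coind_scale a (coind_scale b x) = coind_scale (a * b) x.
Proof. by apply: coind_eq => c /=; rewrite mulrA [a * b]mulrC. Qed.
Fact coind_scale1 : left_id 1 coind_scale.
Proof. by move=> f; apply: coind_eq => c /=; rewrite mul1r. Qed.
Fact coind_scaleDr : right_distributive coind_scale +%R.
Proof. by move=> a f g; apply: coind_eq => c. Qed.
Fact coind_scaleDl x : {morph coind_scale^~ x : a b / a + b}.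
Proof.
move=> a b; apply: coind_eq => c /=; rewrite mulrDl.
by have := coind_linear x 1 (a * c : A) (b * c : A); rewrite !scale1r.
Qed.
HB.instance Definition _ := GRing.Zmodule_isLmodule.Build A coind
  coind_scaleA coind_scale1 coind_scaleDr coind_scaleDl.

Lemma coind_valZ a (f : coind) b : coind_val (a *: f) b = coind_val f (a * b).
Proof. by []. Qed.
Lemma coind_valD (f g : coind) b : coind_val (f + g) b = coind_val f b + coind_val g b.
Proof. by []. Qed.

Lemma coind_mk (V : lmodType A) (g : {linear (V^z : lmodType int) -> QZ}) :
  exists h : {linear V -> coind},
    forall v (b : A), coind_val (h v) b = g (b *: v).
Proof.
have gl v : (fun b : A^z => g (((b : A) *: v) : V^z)) \in int_linear.
  apply/asboolP => k a b; rewrite -linearP; congr (g _).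
  by rewrite !scalezrE scalerDl scalerMzl.
have hl : linear (fun v => Coind (gl v)).
  move=> a u v; apply: coind_eq => b; rewrite coind_valD coind_valZ /=.
  by rewrite -linearD; congr (g _); rewrite scalerDr !scalerA mulrC.
by exists (Lin hl) => v b; rewrite LinE.
Qed.

Lemma coind_injective : injective_module coind.
Proof.
move=> U V j jinj f.
have jl : linear (j : (U^z : lmodType int) -> (V^z : lmodType int)).
  by move=> k u v; rewrite linearD !scalezrE raddfMz.
have fl : linear ((fun u => coind_val (f u) 1) : (U^z : lmodType int) -> QZ).
  move=> k u v; rewrite linearD coind_valD; congr (_ + _).
  rewrite scalezrE -scaler_int linearZ_LR coind_valZ mulr1.
  have := coind_linear (f u) k (1 : A) (0 : A).
  have -> : coind_val (f u) 0 = 0.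
    by have := coind_linear (f u) (-1) (0 : A) (0 : A); rewrite addr0 scaler0 scaleN1r addNr.
  by rewrite !addr0 scalezrE.
have [|g gE] := QZ_injective (j := Lin jl) _ (Lin fl).
  by move=> u v; rewrite !LinE; apply: jinj.
have [h hE] := coind_mk g; exists h => u; apply: coind_eq => b /=.
rewrite hE -linearZ_LR; have /= := gE (b *: u); rewrite !LinE => ->.
by rewrite linearZ_LR coind_valZ mulr1.
Qed.

Lemma coind_separates (V : lmodType A) (v : V) :
  v != 0 -> exists f : {linear V -> coind}, f v != 0.
Proof.
move=> v0; have [g gv] := @QZ_separates (V^z) v v0.
have [h hE] := coind_mk g; exists h; apply: contra_neq gv => hv0.
by rewrite -[v]scale1r -hE hv0.
Qed.

Lemma enough_injectives (V : lmodType A) :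
  exists (E : lmodType A) (j : {linear V -> E}), injective_module E /\ injective j.
Proof.
exists ({linear V -> coind} -> coind).
have jl : linear (fun (v : V) (f : {linear V -> coind}) => f v).
  by move=> a u v; apply/funext => f; rewrite linearP.
exists (Lin jl); split; first exact/inj_fun/coind_injective.
apply: inj_ker0 => v; rewrite LinE => v0; apply/eqP; apply: contrapT => /negP/coind_separates[f].
by have /(congr1 (fun g => g f)) /= -> := v0; rewrite eqxx.
Qed.

End Coinduced.

(** * Injective hulls and the minimal injective resolution *)

Section Hull.
Variable A : comNzRingType.
Implicit Types U V W E : lmodType A.

Definition essential V E (j : {linear V -> E}) :=
  forall e, e != 0 -> exists a : A, a *: e != 0 /\ exists v, j v = a *: e.

Lemma injective_hull V : exists (E : lmodType A) (j : {linear V -> E}),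
  [/\ injective_module E, injective j & essential j].
Proof.
have [E0 [j [E0inj jinj]]] := enough_injectives V.
pose ess (N : E0 -> Prop) := [/\ smod N, forall v, N (j v) &
  forall e, N e -> e != 0 -> exists a : A, a *: e != 0 /\ exists v, j v = a *: e].
have ess_im : ess (fun e => exists v, j v = e).
  split=> [|v|e [v <-] v0]; [exact: smod_im|by exists v|].
  by exists 1; rewrite scale1r; split=> //; exists v.
have [|N [[sN jN eN] _ maxN]] := @zorn_predicates E0 ess _ ess_im.
  move=> F [D0 FD0] Fess tot; split.
  - by apply: smod_chain => // [|D /Fess[]] //; exists D0.
  - by move=> v; exists D0 => //; have [_ + _] := Fess _ FD0; apply.
  - by move=> e [D /Fess[_ _ eD] De]; apply: eD.
pose dis (D : E0 -> Prop) := smod D /\ forall x, D x -> N x -> x = 0.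
have dis0 : dis (fun x => x = 0) by split=> //; exact: smod_eq0.
have [|D [[sD dD] _ maxD]] := @zorn_predicates E0 dis _ dis0.
  move=> F Fne Fdis tot; split; first by apply: smod_chain => // D /Fdis[].
  by move=> e [D /Fdis[_ dD] De]; apply: dD.
pose q := pproj sD; pose i := pval sN.
have qi_inj u : (q \o i) u = 0 -> i u = 0.
  by move=> /pproj_eq0 Du; apply: dD Du (pvalP u).
have [h hE] := inj_extend E0inj qi_inj.
have hN x : N x -> h (q x) = x by move=> /(pval_ex sN)[u <-]; rewrite [LHS]hE.
have key v : q v != 0 -> exists a : A, [/\ a *: v != 0, N (a *: h (q v)) & a *: h (q v) != 0].
  move=> qv0; have nD : ~ D v by move=> Dv; case/eqP: qv0; apply/pproj_eq0.
  pose D' := saddp D (fun u => exists a : A, u = a *: v).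
  have sD' : smod D' by apply: smod_add => //; apply: smod_line.
  have [x [D'x Nx x0]] : exists x, [/\ D' x, N x & x != 0].
    apply: contrapT => H; apply: nD; apply: (maxD D') => [|y Dy|]; last 1 first.
    - by exists 0; [exact: smod0|exists 1; rewrite subr0 scale1r].
    - split=> // x D'x Nx; apply/eqP; apply: contrapT => /negP x0.
      by apply: H; exists x.
    by exists y => //; exists 0; rewrite subrr scale0r.
  have [d Dd [a ax]] := D'x; exists a.
  have qx : q x = a *: q v.
    rewrite -[x](subrK d) ax linearD linearZ_LR.
    by rewrite [q d](pproj_eq0 sD d).2 // addr0.
  have hx : a *: h (q v) = x by rewrite -linearZ_LR -qx hN.
  rewrite hx; split=> //; apply: contraNneq x0 => av0.
  by rewrite -hx -!linearZ_LR av0 !linear0.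
have essh : ess (fun e => exists w, h w = e).
  split=> [|v|e [w <-] hw0]; [exact: smod_im|by exists (q (j v)); apply: hN|].
  have [v vw] := pproj_surj w; rewrite -vw in hw0 *.
  have [|a [_ Na a0]] := key v; first by apply: contraNneq hw0 => ->; rewrite linear0.
  have [b [b0 [v' v'E]]] := eN _ Na a0.
  by exists (b * a); rewrite -scalerA; split=> //; exists v'.
have imN w : N (h w).
  by apply: (maxN _ essh) => [x Nx|]; [exists (q x); apply: hN|exists w].
have [w|r rE] := lin_factor_inj (pval_inj sN) (g := h \o q).
  by apply: pval_ex; apply: imN.
have [v|j' j'E] := lin_factor_inj (pval_inj sN) (g := j); first by apply: pval_ex.
exists (psub sN), j'; split.
- apply: (inj_retract (i := i) (r := r) E0inj) => u; apply: (pval_inj sN).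
  by rewrite rE /= hN //; apply: pvalP.
- by move=> u v /(congr1 (pval sN)); rewrite !j'E; apply: jinj.
- move=> e e0; have [|a [a0 [v vE]]] := eN _ (pvalP e).
    by apply: contraNneq e0 => e0'; apply/eqP/(pval_inj sN); rewrite e0' linear0.
  exists a; split.
    by apply: contraNneq a0 => ae0; rewrite -linearZ_LR ae0 linear0.
  by exists v; apply: (pval_inj sN); rewrite j'E vE linearZ_LR.
Qed.

Definition hull V : lmodType A := projT1 (cid (injective_hull V)).
Definition hull_in V : {linear V -> hull V} :=
  projT1 (cid (projT2 (cid (injective_hull V)))).
Lemma hullP V :
  [/\ injective_module (hull V), injective (@hull_in V) & essential (@hull_in V)].
Proof. exact: projT2 (cid (projT2 (cid (injective_hull V)))). Qed.
Lemma hull_injective V : injective_module (hull V). Proof. by have [] := hullP V. Qed.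
Lemma hull_in_inj V : injective (@hull_in V). Proof. by have [] := hullP V. Qed.
Lemma hull_essential V : essential (@hull_in V). Proof. by have [] := hullP V. Qed.

Variable M : lmodType A.

(* The minimal injective resolution of M: cosyz i is the i-th cosyzygy and
   hull (cosyz i) the i-th injective module. *)
Fixpoint cosyz (i : nat) : lmodType A :=
  if i is j.+1 then pquo (smod_im (@hull_in (cosyz j))) else M.

Definition mres i : lmodType A := hull (cosyz i).
Definition mproj i : {linear mres i -> cosyz i.+1} := pproj (smod_im (@hull_in (cosyz i))).
Definition min_in i : {linear cosyz i -> mres i} := @hull_in (cosyz i).
Definition mdif i : {linear mres i -> mres i.+1} := min_in i.+1 \o mproj i.

Lemma mproj_surj i x : exists y, mproj i y = x. Proof. exact: pproj_surj. Qed.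
Lemma mproj_eq0 i x : mproj i x = 0 <-> exists y, min_in i y = x.
Proof. exact: pproj_eq0. Qed.
Lemma mproj_in i x : mproj i (min_in i x) = 0.
Proof. by apply/mproj_eq0; exists x. Qed.
Lemma min_in_inj i : injective (min_in i). Proof. exact: hull_in_inj. Qed.
Lemma mdif_eq0 i x : mdif i x = 0 <-> exists y, min_in i y = x.
Proof.
rewrite -mproj_eq0; split=> [|x0]; last by rewrite /= x0 linear0.
by move=> x0; apply: (@min_in_inj i.+1); rewrite linear0.
Qed.
Lemma mdifS_eq0 i x : mdif i.+1 x = 0 <-> exists y, mdif i y = x.
Proof.
split=> [/mdif_eq0[y <-]|[y <-]]; last by apply/mdif_eq0; exists (mproj i y).
by have [z <-] := mproj_surj y; exists z.
Qed.
Lemma mdif2 i x : mdif i.+1 (mdif i x) = 0.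
Proof. by apply/mdifS_eq0; exists x. Qed.
End Hull.

(** * Determinants and primes *)

Section Determinants.
Variable A : comNzRingType.

Lemma det_congruent (P : regm A -> Prop) n (B C : 'M[A]_n) :
  smod P -> (forall i j, P (B i j - C i j)) -> P (\det B - \det C).
Proof.
move=> sP BC; rewrite /determinant.
apply: (big_ind2 (fun x y => P (x - y))) => [|a b c d ab cd|s _].
- by rewrite subrr; apply: smod0 sP.
- by rewrite opprD addrACA; apply: smodD.
rewrite -mulrBr; apply: (smodZ (V := regm A)) => //.
apply: (big_ind2 (fun x y => P (x - y))) => [|a b c d ab cd|i _] //.
  by rewrite subrr; apply: smod0 sP.
have -> : a * c - b * d = c * (a - b) + b * (c - d).
  by rewrite !mulrBr [c * a]mulrC [c * b]mulrC addrA subrK.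
by apply: (smodD sP); apply: (smodZ (V := regm A)).
Qed.

Lemma det_trick (V : lmodType A) (K : V -> Prop) n (u : 'I_n -> V) (B : 'M[A]_n) :
  smod K -> (forall i, K (\sum_j B i j *: u j)) -> forall j, K (\det B *: u j).
Proof.
move=> sK BK j.
have -> : \det B *: u j = \sum_i (\adj B) j i *: (\sum_l B i l *: u l).
  under eq_bigr => i _ do rewrite scaler_sumr.
  have E l : \sum_i (\adj B) j i *: (B i l *: u l) = ((\det B)%:M : 'M[A]_n) j l *: u l.
    rewrite -mul_adj_mx mxE scaler_suml; apply: eq_bigr => i _.
    by rewrite scalerA.
  rewrite exchange_big /= (bigD1 j) //= E mxE eqxx mulr1n big1 ?addr0 // => l lj.
  by rewrite E mxE eq_sym (negbTE lj) mulr0n scale0r.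
by apply: smod_sum => // i _; apply: smodZ.
Qed.

Definition isprime (P : regm A -> Prop) :=
  [/\ smod P, ~ P 1 & forall a b : A, P (a * b) -> P a \/ P b].

Lemma prime_prod (P : regm A -> Prop) (I : Type) (r : seq I) (F : I -> A) :
  isprime P -> (forall i, ~ P (F i)) -> ~ P (\prod_(i <- r) F i).
Proof.
move=> [_ P1 PM] nF; apply: (big_ind (fun x => ~ P x)) => // x y nx ny.
by case/PM.
Qed.

Lemma prime_exp (P : regm A -> Prop) a n : isprime P -> P (a ^+ n) -> P a.
Proof.
by case=> sP P1 PM; elim: n => [/P1 //|n IHn]; rewrite exprS => /PM[].
Qed.

(* Nakayama's lemma at a prime P, with closedness in place of localization. *)
Lemma local_nakayama (P : regm A -> Prop) (V : lmodType A) (K : V -> Prop) n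
    (u : 'I_n -> V) :
  isprime P -> smod K -> (forall (s : A) v, ~ P s -> K (s *: v) -> K v) ->
  (forall i, exists2 s : A, ~ P s & exists2 c : 'I_n -> A, (forall j, P (c j)) &
     K (s *: u i - \sum_j c j *: u j)) ->
  forall i, K (u i).
Proof.
move=> pP sK clK H i.
have [s [c [ns cP Ku]]] : exists (s : 'I_n -> A) (c : 'I_n -> 'I_n -> A),
  [/\ forall i, ~ P (s i), forall i j, P (c i j) &
      forall i, K (s i *: u i - \sum_j c i j *: u j)].
  have /choice[f fE] k : exists p : A * ('I_n -> A),
      [/\ ~ P p.1, forall j, P (p.2 j) & K (p.1 *: u k - \sum_j p.2 j *: u j)].
    by have [s ns [c cP Kc]] := H k; exists (s, c).
  by exists (fun k => (f k).1), (fun k => (f k).2); split=> k; have [] := fE k.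
pose B := (\matrix_(i, j) ((s i) *+ (i == j) - c i j) : 'M[A]_n).
have BK k : K (\sum_j B k j *: u j).
  have -> : \sum_j B k j *: u j = s k *: u k - \sum_j c k j *: u j; last exact: Ku.
  under eq_bigr => j _ do rewrite mxE scalerBl.
  rewrite sumrB (bigD1 k) //= eqxx mulr1n big1 ?addr0 // => j.
  by rewrite eq_sym => /negbTE ->; rewrite mulr0n scale0r.
apply: clK (det_trick sK BK i) => PB.
have [sP _ _] := pP.
apply: (prime_prod (r := index_enum 'I_n) (F := s) pP ns).
rewrite -[\prod_(_ <- _) _](subKr (\det B)); apply: (smodB sP) => //.
have -> : \prod_(i <- index_enum 'I_n) s i = \det (diag_mx (\row_j s j)).
  by rewrite det_diag; apply: eq_bigr => j _; rewrite mxE.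
apply: det_congruent => // k j; rewrite !mxE addrAC subrr sub0r.
exact: (smodN sP).
Qed.

End Determinants.

(** * Noetherian local rings and torsion *)

Section PrimeIdeals.
Variable A : comNzRingType.
Hypothesis Anoeth : noetherian A.

Lemma prime_avoiding (I : regm A -> Prop) (S : A -> Prop) :
  smod I -> S 1 -> (forall a b, S a -> S b -> S (a * b)) ->
  (forall a, I a -> ~ S a) ->
  exists P, [/\ isprime P, forall a, I a -> P a & forall a, P a -> ~ S a].
Proof.
move=> sI S1 SM IS.
pose F (P : regm A -> Prop) := [/\ smod P, forall a, I a -> P a & forall a, P a -> ~ S a].
have [||P [sP IP PS] Pmax] := @noeth_max A (regm A) F (noethm_ring Anoeth).
- by exists I.
- by move=> D [].
exists P; split=> //; split=> // [/PS //|a b Pab].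
have step (c : A) : ~ P c -> exists2 s, S s & saddp P (fun u : regm A => exists a : A, u = a *: (c : regm A)) s.
  move=> nc; apply: contrapT => H; apply: nc.
  pose D := saddp P (fun u : regm A => exists a : A, u = a *: (c : regm A)).
  have PD x : P x -> D x by move=> Px; exists x => //; exists 0; rewrite subrr scale0r.
  apply: (Pmax D) => //.
    split; first by apply: smod_add => //; apply: smod_line.
      by move=> x /IP/PD.
    by move=> x Dx Sx; apply: H; exists x.
  by exists 0; [exact: smod0|exists 1; rewrite subr0 scale1r].
apply: contrapT => /not_orP[/step[s Ss [p Pp [c pc]]] /step[t St [q Pq [d qd]]]].
apply: (PS (s * t)); last exact: SM.
have -> : s * t = t * p + (s - p) * q + (s - p) * (t - q).
  by rewrite -addrA -mulrDr subrKC mulrBl addrC [t * p]mulrC subrK.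
rewrite pc qd !regmE; apply: (smodD sP).
  by apply: (smodD sP); apply: (smodZ (V := regm A)).
have -> : c * a * (d * b) = (c * d) * (a * b) by rewrite mulrACA.
exact: (smodZ (V := regm A)).
Qed.

Lemma idealr_of (P : regm A -> Prop) : smod P -> ~ P 1 ->
  exists I : idealr A, forall a, a \in I <-> P a.
Proof.
move=> sP P1; pose S : {pred A} := [pred a | `[<P a>]].
have cS : idealr_closed S.
  split=> [||a u v]; rewrite ?inE.
  - by apply/asboolP/(smod0 sP).
  - by apply/asboolP.
  by move=> /asboolP Pu /asboolP Pv; apply/asboolP/(sP.2 a).
pose I : idealr A := HB.pack (S : A -> bool) (isIdealr.Build A S cS).
by exists I => a; rewrite -[a \in I]/(`[<P a>]); split=> [/asboolP|Pa] //; apply/asboolP.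
Qed.

Lemma prime_idealr_of (P : regm A -> Prop) : isprime P ->
  exists I : prime_idealr A, forall a, a \in I <-> P a.
Proof.
move=> [sP P1 PM]; pose S : {pred A} := [pred a | `[<P a>]].
have cS : idealr_closed S.
  split=> [||a u v]; rewrite ?inE.
  - by apply/asboolP/(smod0 sP).
  - by apply/asboolP.
  by move=> /asboolP Pu /asboolP Pv; apply/asboolP/(sP.2 a).
have pS : prime_idealr_closed S.
  move=> u v /asboolP/PM[Pu|Pv]; apply/orP; [left|right]; exact/asboolP.
pose I : prime_idealr A := HB.pack (S : A -> bool) (isIdealr.Build A S cS)
  (isPrimeIdealrClosed.Build A S pS).
by exists I => a; rewrite -[a \in I]/(`[<P a>]); split=> [/asboolP|Pa] //; apply/asboolP.
Qed.

Lemma smod_idealr (I : idealr A) : smod (fun a : regm A => (a : A) \in I).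
Proof.
by split=> [|a u v uI vI]; [exact: rpred0|apply: rpredD => //; apply: idealMr].
Qed.

Lemma isprime_idealr (I : prime_idealr A) : isprime (fun a : regm A => (a : A) \in I).
Proof.
split; [exact: smod_idealr|by rewrite idealr1|].
by move=> a b; rewrite prime_idealrM => /orP.
Qed.

End PrimeIdeals.

Section LocalRing.
Variables (A : comNzRingType) (m : idealr A).
Hypothesis Anoeth : noetherian A.
Hypothesis Aloc : local_ring m.
Implicit Types U V W E : lmodType A.

Lemma local_unit a : a \notin m -> exists b, a * b = 1.
Proof.
move=> am; apply: contrapT => nu.
pose F (P : regm A -> Prop) := [/\ smod P, ~ P 1 & P a].
have [||P [sP P1 Pa] Pmax] := @noeth_max A (regm A) F (noethm_ring Anoeth).
- exists (fun u : regm A => exists c : A, u = c *: (a : regm A)).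
  split; [exact: smod_line| |by exists 1; rewrite scale1r].
  by move=> [c]; rewrite regmE mulrC => cE; apply: nu; exists c.
- by move=> D [].
have [I IE] := idealr_of sP P1.
have Imax : maximal_ideal I.
  move=> I' II' x; apply/idP/idP => [xI'|/II' //]; apply/IE.
  apply: (Pmax (fun x => x \in I')) => // [|y /IE/II' //].
  by split; [exact: smod_idealr|rewrite idealr1|apply: II'; apply/IE].
by move: am; rewrite -(Aloc.2 I Imax); case/negP; apply/IE.
Qed.

Lemma local_unitP a : a \in m -> exists b, (1 - a) * b = 1.
Proof.
move=> am; apply: local_unit; apply/negP => am'.
have : 1 - a + a \in m by apply: rpredD.
by rewrite subrK idealr1.
Qed.

Lemma m_prime : isprime (fun a : regm A => (a : A) \in m).
Proof.
split; [exact: smod_idealr|by rewrite idealr1|].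
move=> a b abm; have [|/local_unit[c ac]] := boolP (a \in m); first by left.
by right; rewrite -[b]mul1r -ac mulrAC; rewrite mulrC; apply: idealMr.
Qed.

Lemma proper_sub_m (P : regm A -> Prop) a : smod P -> ~ P 1 -> P a -> a \in m.
Proof.
move=> sP P1 Pa; apply: contrapT => /negP/local_unit[b ab]; apply: P1.
by rewrite -ab mulrC; apply: (smodZ (V := regm A)).
Qed.

Lemma m_gens : exists s : seq (regm A), (forall y, y \in s -> (y : A) \in m) /\
  forall y : A, y \in m -> lspan s y.
Proof. by have [s sm sE] := noethm_ring Anoeth (smod_idealr m); exists s. Qed.

Lemma nakayama V (K : V -> Prop) (s : seq V) : smod K ->
  (forall i : 'I_(size s), exists2 c : 'I_(size s) -> A,
     (forall j, c j \in m) & K (s`_i - \sum_j c j *: s`_j)) ->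
  forall v, lspan s v -> K v.
Proof.
move=> sK H v /span_ord[c ->]; apply: smod_sum => // i _; apply: smodZ => //.
apply: (local_nakayama (u := fun i : 'I_(size s) => s`_i) m_prime sK) => [a w am|j].
  have [b ab] := local_unit (introN idP am); move=> /(smodZ b sK).
  by rewrite scalerA mulrC ab scale1r.
exists 1; first by case: m_prime.
by have [d dm Kd] := H j; exists d => //; rewrite scale1r.
Qed.

(* Torsion modulo K: the m-power torsion of V/K. *)
Definition torm V (K : V -> Prop) v := forall y : A, y \in m -> exists k, K (y ^+ k *: v).
Definition tors V := @torm V (fun v => v = 0).

Lemma smod_expZ V (K : V -> Prop) (y : A) k l v :
  smod K -> (k <= l)%N -> K (y ^+ k *: v) -> K (y ^+ l *: v).
Proof. by move=> sK kl Kv; rewrite -(subnK kl) exprD -scalerA; apply: smodZ. Qed.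

Lemma smod_torm V (K : V -> Prop) : smod K -> smod (torm K).
Proof.
move=> sK; split=> [y _|a u v Ku Kv y ym]; first by exists 0%N; rewrite scaler0; apply: smod0.
have [k Kk] := Ku y ym; have [l Kl] := Kv y ym; exists (k + l)%N.
rewrite scalerDr scalerA [_ * a]mulrC -scalerA; apply: smodD => //.
  by apply: smodZ => //; apply: smod_expZ Kk; rewrite ?leq_addr.
by apply: smod_expZ Kl; rewrite ?leq_addl.
Qed.

Lemma smod_tors V : smod (@tors V).
Proof. exact/smod_torm/smod_eq0. Qed.

Lemma sub_torm V (K : V -> Prop) v : smod K -> K v -> torm K v.
Proof. by move=> sK Kv y _; exists 0%N; rewrite expr0 scale1r. Qed.

Lemma tors_lin U V (f : {linear U -> V}) u : tors u -> tors (f u).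
Proof. by move=> tu y /tu[k k0]; exists k; rewrite -linearZ_LR k0 linear0. Qed.

Lemma torm_bounded V (K : V -> Prop) (y : A) :
  smod K -> noethm V -> exists N, forall v, (exists k, K (y ^+ k *: v)) -> K (y ^+ N *: v).
Proof.
move=> sK nV.
have [n|n v|N NE] := noeth_stable (P := fun n v => K (y ^+ n *: v)) nV.
- split=> [|a u v Ku Kv]; first by rewrite scaler0; apply: smod0.
  by rewrite scalerDr scalerA [_ * a]mulrC -scalerA; apply: sK.2.
- by move=> Kv; apply: smod_expZ Kv.
by exists N => v [k Kk]; apply: NE Kk.
Qed.

Lemma torm_torm V (K : V -> Prop) v :
  smod K -> (forall y, y \in m -> torm K (y *: v)) -> torm K v.
Proof.
move=> sK H y ym; have [k Kk] := H y ym y ym; exists k.+1.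
by rewrite exprSr -scalerA.
Qed.

Lemma torm_idem V (K : V -> Prop) v : torm (torm K) v -> torm K v.
Proof.
move=> H y ym; have [k Kk] := H y ym; have [l Kl] := Kk y ym; exists (l + k)%N.
by rewrite exprD -scalerA.
Qed.

(* The weak form of the Artin-Rees lemma. *)
Lemma essential_torsion V (K K0 : V -> Prop) :
  noethm V -> smod K -> smod K0 -> (forall v, K0 v -> K v) ->
  (forall v, K v -> torm K0 v) ->
  exists L, [/\ smod L, forall v, K0 v -> L v, forall v, L v -> K v -> K0 v &
    forall v, torm L v].
Proof.
move=> nV sK sK0 K0K tK.
pose F (L : V -> Prop) := [/\ smod L, forall v, K0 v -> L v & forall v, L v -> K v -> K0 v].
have [||L [sL K0L LK] Lmax] := @noeth_max A V F nV.
- by exists K0.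
- by move=> D [].
exists L; split=> // v y ym.
have [N NE] := torm_bounded y sL nV.
pose L' := saddp L (fun w => exists v, y ^+ N *: v = w).
have scale_l : linear (fun v : V => y ^+ N *: v).
  by move=> a u w; rewrite scalerDr !scalerA [_ * a]mulrC.
have sL' : smod L'.
  apply: smod_add => //; have [i0 iL] := smod_im (Lin scale_l).
  split=> [|a u w [u' uE] [w' wE]]; first by exists 0; rewrite scaler0.
  have [||z zE] := iL a u w; [by exists u'; rewrite LinE|by exists w'; rewrite LinE|].
  by exists z; rewrite -zE LinE.
have LL' x : L x -> L' x by move=> Lx; exists x => //; exists 0; rewrite scaler0 subrr.
exists N; apply: (Lmax L') => //; last first.
  by exists 0; [exact: smod0|exists v; rewrite subr0].
split=> // [x /K0L/LL' //|x [l Ll [w wE]] Kx]; apply: LK => //.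
rewrite -[x](subrK l); apply: smodD => //; rewrite -wE; apply: NE.
have [k k0] := tK x Kx y ym; exists (k + N)%N.
rewrite exprD -scalerA wE scalerBr; apply: smodB => //; first exact: K0L.
exact: smodZ.
Qed.

Lemma krull_separation (P : regm A -> Prop) (a : A) : smod P -> ~ P a ->
  exists L, [/\ smod L, forall v, P v -> L v, forall v, torm L v & ~ L a].
Proof.
move=> sP Pa.
pose line := fun u : regm A => exists c : A, u = c *: (a : regm A).
pose mline := fun u : regm A => exists2 c : A, c \in m & u = c *: (a : regm A).
have smline : smod mline.
  split=> [|c _ _ [d dm ->] [e em ->]]; first by exists 0; rewrite ?rpred0 ?scale0r.
  exists (c * d + e); last by rewrite scalerDl scalerA.
  by apply: rpredD => //; apply: idealMr.
have sline : smod line by exact: smod_line.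
have nK0 : ~ saddp P mline a.
  move=> [p Pp [c cm cE]]; apply: Pa; have [b bE] := local_unitP cm.
  have -> : a = b * p.
    have -> : p = a - (a - p) by rewrite subKr.
    rewrite cE regmE -[a in a - _]mul1r -mulrBl mulrA [b * _]mulrC bE.
    by rewrite mul1r.
  exact: (smodZ (V := regm A)).
have [||v [p Pp [c cm cE]]|v [p Pp [c cE]]|L [sL KL LK tL]] :=
    @essential_torsion (regm A) (saddp P line) (saddp P mline) (noethm_ring Anoeth).
- exact: smod_add.
- exact: smod_add.
- by exists p => //; exists c.
- move=> y ym; exists 1%N; rewrite expr1; exists (y *: p); first exact: smodZ.
  by exists (y * c); [rewrite mulrC; apply: idealMr|rewrite -scalerBr cE scalerA].
exists L; split=> // [v Pv|La].
  by apply: KL; exists v => //; exists 0; rewrite ?rpred0 ?subrr ?scale0r.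
apply: nK0; apply: LK => //; exists 0; first exact: smod0.
by exists 1; rewrite subr0 scale1r.
Qed.

Lemma torsion_socle V (v : V) : tors v -> v != 0 ->
  exists a : A, a *: v != 0 /\ forall y, y \in m -> y *: (a *: v) = 0.
Proof.
move=> tv v0; have [s [sm sE]] := m_gens.
have [a [av0 aE]] : exists a : A, a *: v != 0 /\ forall y, y \in s -> y *: (a *: v) = 0.
  elim: s sm {sE} => [|y s IHs] sm; first by exists 1; rewrite scale1r.
  have [x xs|a [av0 aE]] := IHs; first by apply: sm; rewrite inE xs orbT.
  have tav : tors (a *: v) by exact: (smodZ a (@smod_tors V) tv).
  have ex : exists k, (y : A) ^+ k *: (a *: v) == 0.
    by have [|k /eqP k0] := tav y; [apply: sm; rewrite mem_head|exists k].
  case: (ex_minnP ex) => -[|k] /eqP k0 kmin.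
    by case/eqP: av0; rewrite -[LHS]scale1r.
  exists ((y : A) ^+ k * a); split.
    by rewrite -scalerA; apply/negP => /kmin; rewrite ltnn.
  move=> x; rewrite inE => /orP[/eqP ->|/aE x0].
    by rewrite scalerA mulrA -exprS -scalerA.
  by rewrite scalerA mulrCA -scalerA -scalerA x0 scaler0.
exists a; split=> // y ym.
have sP : smod (fun y : regm A => (y : A) *: (a *: v) = 0).
  split=> [|b c d c0 d0]; first by rewrite scale0r.
  by rewrite scalerDl -scalerA c0 d0 scaler0 addr0.
exact: (span_sub sP aE (sE y ym)).
Qed.

Lemma torsion_injective E : injective_module E -> injective_module (psub (@smod_tors E)).
Proof.
move=> Einj; apply: baer => P sP f.
pose K0 (a : regm A) := exists2 x, f x = 0 & pval sP x = a.
have sK0 : smod K0 by apply: smod_img; apply: smod_ker.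
have [|a Pa y ym|L [sL K0L LP tL]] := essential_torsion (noethm_ring Anoeth) sP sK0.
- by move=> a [x _ <-]; apply: pvalP.
- have [x xE] := pval_ex sP Pa; have [k k0] := pvalP (f x) y ym.
  exists k; exists (y ^+ k *: x); last by rewrite linearZ_LR xE.
  by apply: (pval_inj (@smod_tors E)); rewrite !linearZ_LR k0 linear0.
have ul : linear (fun p : psub sP * psub sL => pval sP p.1 + pval sL p.2).
  by move=> a p q /=; rewrite !linearP scalerDr addrACA.
have gl : linear (fun p : psub sP * psub sL => pval (@smod_tors E) (f p.1)).
  by move=> a p q /=; rewrite !linearP.
have [[x l]|h hE] := inj_extend (f := Lin ul) (g := Lin gl) Einj.
  rewrite !LinE /= => /eqP; rewrite addr_eq0 => /eqP xl.
  have [||x' x'0 /(pval_inj sP) <-] := LP (pval sP x); last by rewrite x'0 linear0.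
    by rewrite xl; apply: smodN => //; apply: pvalP.
  exact: pvalP.
have te : tors (h (1 : A)).
  move=> y ym; have [k Lk] := tL (1 : A) y ym; exists k.
  have [l lE] := pval_ex sL Lk; rewrite -linearZ_LR -lE.
  by have := hE (0, l); rewrite !LinE /= !linear0 add0r => ->.
have [e eE] := pval_ex (@smod_tors E) te.
exists e => x; apply: (pval_inj (@smod_tors E)); rewrite linearZ_LR eE -linearZ_LR.
have := hE (x, 0); rewrite !LinE /= linear0 addr0 => <-.
by rewrite regmE mulr1.
Qed.

Lemma torsion_quotient_injective E :
  injective_module E -> injective_module (pquo (@smod_tors E)).
Proof.
move=> Einj; have tinj := torsion_injective Einj.
have [r rE] := inj_split tinj (pval_inj (@smod_tors E)).
have [v|s sE] := lin_factor_surj (d := pproj (@smod_tors E))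
    (g := idfun \- (pval (@smod_tors E) \o r)) (pproj_surj (sP := _)).
  move=> /pproj_eq0 tv; have [u <-] := pval_ex (@smod_tors E) tv.
  by rewrite /= rE subrr.
apply: (inj_retract (i := s) (r := pproj (@smod_tors E)) Einj) => x.
have [v <-] := pproj_surj x; rewrite sE /= linearB.
have -> : pproj (@smod_tors E) (pval (@smod_tors E) (r v)) = 0.
  by apply/pproj_eq0; apply: pvalP.
by rewrite subr0.
Qed.

Lemma torsion_quotient_torsionfree E (x : pquo (@smod_tors E)) : tors x -> x = 0.
Proof.
have [v <-] := pproj_surj x => tv; apply/pproj_eq0; apply: torm_idem => y /tv[k].
by rewrite -linearZ_LR => /pproj_eq0 k0; exists k.
Qed.

Definition maximal_annihilator V (T : V -> Prop) (P : regm A -> Prop) :=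
  (exists2 v, ~ T v & P = fun a : regm A => T ((a : A) *: v)) /\
  forall v, ~ T v -> (forall a, P a -> T ((a : A) *: v)) -> forall a : A, T (a *: v) -> P a.

Lemma smod_ann V (T : V -> Prop) v : smod T -> smod (fun a : regm A => T ((a : A) *: v)).
Proof.
move=> sT; split=> [|a b c Tb Tc]; first by rewrite scale0r; apply: smod0.
by rewrite scalerDl -scalerA; apply: sT.2.
Qed.

Lemma maximal_annihilator_prime V (T : V -> Prop) P :
  smod T -> maximal_annihilator T P -> isprime P.
Proof.
move=> sT [[v nTv PE] Pmax]; split; rewrite ?PE.
- exact: smod_ann.
- by rewrite scale1r.
move=> a b Tab; have [Tb|nTb] := EM (T (b *: v)); [by right|left].
have := Pmax (b *: v) nTb; rewrite PE => H; apply: H => [c Tc|].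
  by rewrite scalerA mulrC -scalerA; apply: smodZ.
by rewrite scalerA.
Qed.

Lemma maximal_annihilator_exists V (T : V -> Prop) (v : V) :
  smod T -> ~ T v -> exists2 P, maximal_annihilator T P & forall a : A, T (a *: v) -> P a.
Proof.
move=> sT nTv.
pose F (P : regm A -> Prop) := (exists2 w, ~ T w & P = fun a : regm A => T ((a : A) *: w))
  /\ forall a : A, T (a *: v) -> P a.
have [||P [[w nTw PE] Pv] Pmax] := @noeth_max A (regm A) F (noethm_ring Anoeth).
- by exists (fun a : regm A => T ((a : A) *: v)); split=> //; exists v.
- by move=> D [[w _ ->] _]; apply: smod_ann.
exists P => //; split; first by exists w.
move=> u nTu Pu a Ta; apply: (Pmax (fun a : regm A => T ((a : A) *: u))) => //.
by split; [exists u|move=> b /Pv/Pu].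
Qed.

Fixpoint inlist (X : Type) (x : X) (s : seq X) : Prop :=
  if s is y :: s' then x = y \/ inlist x s' else False.

Lemma prod_not_prime (P : regm A -> Prop) (s : seq (regm A -> Prop)) :
  isprime P -> (forall Q, inlist Q s -> smod Q /\ exists2 a, Q a & ~ P a) ->
  exists2 z : A, ~ P z & forall Q, inlist Q s -> Q z.
Proof.
move=> [sP P1 PM]; elim: s => [|Q s IHs] sQ; first by exists 1.
have [Q' Q's|z nPz zE] := IHs; first by apply: sQ; right.
have [sQ' [a Qa nPa]] := sQ Q (or_introl erefl).
exists (a * z); first by case/PM.
move=> Q' [->|Q's]; first by rewrite mulrC; apply: (smodZ (V := regm A)).
have [sQ'' _] := sQ Q' (or_intror Q's).
by apply: (smodZ (V := regm A)) => //; apply: zE.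
Qed.

Lemma maximal_annihilators_finite V (T : V -> Prop) : noethm V -> smod T ->
  exists s, forall P, maximal_annihilator T P -> inlist P s.
Proof.
move=> nV sT.
pose F (D : V -> Prop) := smod D /\ exists s, (forall P, inlist P s -> maximal_annihilator T P) /\
  forall a : A, (forall P, inlist P s -> P a) -> forall v, D v -> T (a *: v).
have [||D [sD [s [sE DE]]] Dmax] := @noeth_max A V F nV.
- by exists T; split=> //; exists [::]; split=> // a _ v Tv; apply: smodZ.
- by move=> D [].
exists s => P Pmax; have pP := maximal_annihilator_prime sT Pmax.
have [[v nTv PE] Pm] := Pmax.
have Dv : D v.
  pose D' := saddp D (fun u => exists a : A, u = a *: v).
  apply: (Dmax D'); last by exists 0; [exact: smod0|exists 1; rewrite subr0 scale1r].
    split; first by apply: smod_add => //; apply: smod_line.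
    exists (P :: s); split=> [Q [->//|/sE//]|a aE w [d Dd [b bE]]].
    rewrite -[w](subrK d) bE addrC scalerDr; apply: smodD => //.
      by apply: DE => // Q Qs; apply: aE; right.
    rewrite scalerA mulrC -scalerA; apply: smodZ => //.
    by have := aE P (or_introl erefl); rewrite PE.
  by move=> x Dx; exists x => //; exists 0; rewrite subrr scale0r.
apply: contrapT => nPs.
have [Q Qs|z nPz zE] := prod_not_prime pP (s := s).
  have Qm := sE Q Qs; split; first by case: (maximal_annihilator_prime sT Qm).
  apply: contrapT => QP; apply: nPs; suff -> : P = Q by [].
  have QsubP a : Q a -> P a by move=> Qa; apply: contrapT => nPa; apply: QP; exists a.
  apply/funext => a; apply/propext; split=> [|/QsubP //].
  have [[w nTw QE] Qmax] := Qm; rewrite {1}PE; apply: Qmax => // b /QsubP.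
  by rewrite PE.
by apply: nPz; rewrite PE; apply: DE.
Qed.

Lemma prime_avoidance (s : seq (regm A -> Prop)) :
  (forall P, inlist P s -> isprime P /\ exists2 y, y \in m & ~ P y) ->
  (forall P Q, inlist P s -> inlist Q s -> (forall a, P a -> Q a) -> P = Q) ->
  exists2 x, x \in m & forall P, inlist P s -> ~ P x.
Proof.
elim: s => [|P s IHs] sP inc; first by exists 0; rewrite ?rpred0.
have [Q Qs|Q Q' Qs Q's|x xm xE] := IHs; first by apply: sP; right.
  by apply: inc; right.
have [Px|nPx] := EM (P x); last by exists x => // Q [->|/xE].
have [pP [y ym nPy]] := sP P (or_introl erefl).
have [Q|z nPz zE] := prod_not_prime pP (s := (fun a : regm A => is_true ((a : A) \in m)) :: s).
  move=> [->|Qs]; first by split; [exact: smod_idealr|exists y].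
  have [[sQ _ _] _] := sP Q (or_intror Qs); split=> //.
  apply: contrapT => QP; have QE : Q = P.
    apply: inc; [by right|by left|].
    by move=> a Qa; apply: contrapT => nPa; apply: QP; exists a.
  by apply: (xE Q Qs); rewrite QE.
exists (x + z); first by apply: rpredD => //; exact: (zE _ (or_introl erefl)).
move=> Q [->|Qs].
  by move=> Pxz; apply: nPz; have [sP' _ _] := pP; apply: (smodDr (V := regm A) sP' Px Pxz).
have [[sQ _ _] _] := sP Q (or_intror Qs) => Qxz; apply: (xE Q Qs).
have Qz : Q z := zE _ (or_intror Qs).
by rewrite addrC in Qxz; apply: (smodDr (V := regm A) sQ Qz Qxz).
Qed.

Lemma regular_element V (T : V -> Prop) : noethm V -> smod T ->
  (forall v, (forall y, y \in m -> T (y *: v)) -> T v) ->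
  exists2 x, x \in m & forall v, T (x *: v) -> T v.
Proof.
move=> nV sT Tm; have [s sE] := maximal_annihilators_finite nV sT.
pose M P := maximal_annihilator T P.
have [s' s'E] : exists s', forall P, inlist P s' <-> (inlist P s /\ M P).
  elim: s {sE} => [|P s [s' s'E]]; first by exists [::] => P; split=> // -[].
  have [MP|nMP] := EM (M P).
    exists (P :: s') => Q /=; rewrite s'E; split=> [[->|[]]|[[->|]]]; by [left|right|split; [left|]|split;[right|]| move=> *; right].
  exists s' => Q; rewrite s'E /=; split=> [[]|[[->|]]]; by [split; [right|]|].
have [P /s'E[_ MP]|P Q /s'E[_ MP] /s'E[_ MQ] PQ|x xm xE] := @prime_avoidance s'.
- split; first exact: maximal_annihilator_prime MP.
  have [[v nTv PE] _] := MP; apply: contrapT => H; apply: nTv; apply: Tm => y ym.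
  by apply: contrapT => nT; apply: H; exists y => //; rewrite PE.
- apply/funext => a; apply/propext; split=> [/PQ //|].
  have [[w nTw QE] _] := MQ; have [_ Pmax] := MP.
  by rewrite QE; apply: Pmax => // b /PQ; rewrite QE.
exists x => // v Tx; apply: contrapT => nTv.
have [P MP Pv] := maximal_annihilator_exists sT nTv.
by apply: (xE P); [apply/s'E; split=> //; apply: sE|apply: Pv].
Qed.

End LocalRing.

(** * Complexes and Koszul cones *)

Section Complexes.
Variable A : comNzRingType.

Definition zeroM : lmodType A := psub (smod_eq0 (regm A)).
Lemma zeroM0 (v : zeroM) : v = 0.
Proof. by apply: (pval_inj (smod_eq0 (regm A))); rewrite (pvalP v) linear0. Qed.

Record cpx := Cpx {
  ob :> nat -> lmodType A;
  df : forall i, {linear ob i -> ob i.+1};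
  df2 : forall i u, df i.+1 (df i u) = 0 }.
Arguments df {c i}.

Definition pre (C : cpx) n : lmodType A := if n is k.+1 then ob C k else zeroM.
Definition dpre (C : cpx) n : {linear pre C n -> ob C n} :=
  if n is k.+1 return {linear pre C n -> ob C n} then @df C k else \0.
Arguments dpre {C n}.

Lemma df_dpre (C : cpx) n (w : pre C n) : df (dpre w) = 0.
Proof. by case: n w => [|n] w; [rewrite [dpre w]/= linear0|exact: df2]. Qed.

Definition bd (C : cpx) n (u : ob C n) := exists w : pre C n, dpre w = u.
Definition pbd (C : cpx) n : pre C n -> Prop :=
  if n is k.+1 return pre C n -> Prop then @bd C k else fun=> True.

Lemma smod_bd C n : smod (@bd C n). Proof. exact: smod_im. Qed.
Lemma smod_pbd C n : smod (@pbd C n).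
Proof. by case: n => [|n]; [exact: smodT|exact: smod_bd]. Qed.
Definition exact_at (C : cpx) n := forall u : ob C n, df u = 0 -> bd u.
Definition pexact_at (C : cpx) n := forall v : pre C n, dpre v = 0 -> pbd v.

Fact cone_df_linear (x : A) (C : cpx) n :
  linear (fun p : ob C n * pre C n => (df p.1, x *: p.1 - dpre p.2)).
Proof.
move=> a [u v] [u' v'] /=; rewrite (linearP (@df C n)) (linearP (@dpre C n)).
congr pair => /=.
by rewrite scalerDr !scalerA [x * a]mulrC -scalerA opprD addrACA scalerBr.
Qed.

Fact cone_df2 (x : A) (C : cpx) n (p : ob C n * pre C n) :
  Lin (@cone_df_linear x C n.+1) (Lin (@cone_df_linear x C n) p) = 0.
Proof.
rewrite !LinE /= df2 linearB linearZ_LR df_dpre subr0 subrr.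
by congr pair.
Qed.

(* The Koszul cone: the mapping fibre of x on C, placed in degrees n, n - 1. *)
Definition cone (x : A) (C : cpx) : cpx :=
  @Cpx (fun n => (ob C n * pre C n)%type) (fun n => Lin (@cone_df_linear x C n))
    (@cone_df2 x C).

Arguments cone : simpl never.

Lemma cone_dfE x C n (p : ob (cone x C) n) :
  df p = ((df p.1, x *: p.1 - dpre p.2) : ob (cone x C) n.+1).
Proof. exact: LinE. Qed.

Lemma cy_cone x C n (p : ob (cone x C) n) :
  df p = 0 <-> df p.1 = 0 /\ x *: p.1 = dpre p.2.
Proof.
rewrite cone_dfE; split=> [[-> /eqP]|[-> ->]]; last by rewrite subrr.
by rewrite subr_eq0 => /eqP.
Qed.

Lemma bd_cone x C n (p : ob (cone x C) n) :
  bd p <-> exists2 w : pre C n, dpre w = p.1 & pbd (p.2 - x *: w).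
Proof.
case: n p => [|n] [u v]; split => /=.
- by move=> [w] [<- _]; exists 0; rewrite ?linear0.
- by move=> [w <- _]; exists 0; rewrite linear0; congr pair; rewrite [RHS]zeroM0.
- move=> [[w t]]; rewrite [dpre _]cone_dfE => -[<- <-]; exists w => //.
  by exists (- t); rewrite addrAC subrr sub0r linearN.
move=> [w wu [t tE]]; exists ((w, - t) : ob (cone x C) n).
by rewrite [dpre _]cone_dfE /=; congr pair => //; rewrite linearN opprK tE subrKC.
Qed.

Fixpoint kos (s : seq A) (C : cpx) : cpx := if s is x :: s' then cone x (kos s' C) else C.

Lemma kos_cat s t C : kos (s ++ t) C = kos s (kos t C).
Proof. by elim: s => //= x s ->. Qed.

Lemma exact_cone x C n : exact_at C n -> pexact_at C n -> exact_at (cone x C) n.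
Proof.
move=> exn pexn [u v] /cy_cone[/= u0 xu]; have [w wu] := exn u u0.
apply/bd_cone; exists w => //=; apply: pexn.
by rewrite linearB linearZ_LR wu xu subrr.
Qed.

Definition vanish d (C : cpx) := forall n, (d < n)%N -> exact_at C n.

Lemma vanish_cone x d C : vanish d C -> vanish d.+1 (cone x C).
Proof.
move=> vC n dn; apply: exact_cone; first by apply: vC; apply: ltnW.
by case: n dn => // n dn; apply: vC.
Qed.

Lemma vanish_kos s d C : vanish d C -> vanish (size s + d) (kos s C).
Proof. by move=> vC; elim: s => //= x s; apply: vanish_cone. Qed.

Lemma vanish_strip x d C :
  (forall n (u : ob C n), exists k, x ^+ k *: u = 0) ->
  vanish d (cone x C) -> vanish d C.
Proof.
move=> nilx vx n dn u u0; have [k k0] := nilx n u.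
have step (z : ob C n) : df z = 0 -> bd (x *: z) -> bd z.
  move=> z0 [w wz]; have /vx : df ((z, w) : ob (cone x C) n) = 0 by apply/cy_cone.
  by move=> /(_ dn)/bd_cone[w' w'z _]; exists w'.
have : bd (x ^+ k *: u) by rewrite k0; apply: smod0 (smod_bd _ _).
elim: k {k0} => [|k IHk]; first by rewrite expr0 scale1r.
rewrite exprS -scalerA => /step H; apply/IHk/H.
by rewrite linearZ_LR u0 scaler0.
Qed.

Definition kill (C : cpx) n (r : A) := forall u : ob C n, df u = 0 -> bd (r *: u).
Definition pkill (C : cpx) n (r : A) := forall v : pre C n, dpre v = 0 -> pbd (r *: v).
Lemma kill_pkill C r : (forall n, kill C n r) -> forall n, pkill C n r.
Proof. by move=> kr [|n] v //; apply: kr. Qed.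

Lemma smod_kill C n : smod (fun r : regm A => kill C n r).
Proof.
split=> [u _|a r r' kr kr' u u0]; first by rewrite scale0r; apply: smod0 (smod_bd _ _).
by rewrite scalerDl -scalerA; apply: (smod_bd _ _).2; [apply: kr|apply: kr'].
Qed.

Lemma kill_cone_self x C n : kill (cone x C) n x.
Proof.
move=> p /cy_cone[_ xp]; apply/bd_cone; exists p.2 => //=.
by rewrite subrr; apply: smod0 (smod_pbd _ _).
Qed.

Lemma kill_cone x C r : (forall n, kill C n r) -> forall n, kill (cone x C) n (r * r).
Proof.
move=> kr n [u v] /cy_cone[/= u0 xu]; have [w wu] := kr n u u0.
apply/bd_cone; exists (r *: w) => /=; first by rewrite linearZ_LR wu scalerA.
have -> : (r * r) *: v - x *: (r *: w) = r *: (r *: v - x *: w).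
  by rewrite scalerBr !scalerA [x * r]mulrC.
apply: kill_pkill => //.
by rewrite linearB !(linearZ_LR dpre) wu -xu !scalerA mulrC subrr.
Qed.

Lemma kill_kos s C r : (forall n, kill C n r) ->
  forall n, kill (kos s C) n (r ^+ (2 ^ size s)).
Proof.
move=> kr; elim: s => [|x s IHs] n //=.
by rewrite expnS mul2n -addnn exprD; apply: kill_cone.
Qed.

Lemma vanish_congr b b' d C : (forall n, kill C n (b - b')) ->
  vanish d (cone b C) -> vanish d (cone b' C).
Proof.
move=> kb vb n dn [u v] /cy_cone[/= u0 b'u].
have [w wu] := kb n u u0.
have bu : b *: u = dpre (v + w) by rewrite linearD -b'u wu -scalerDl addrC subrK.
have /vb : df ((u, v + w) : ob (cone b C) n) = 0 by apply/cy_cone.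
move=> /(_ dn)/bd_cone[w1 /= w1u w1E].
pose c := (b - b') *: w1 - w.
have c0 : dpre c = 0 by rewrite linearB linearZ_LR w1u wu subrr.
have /vb : df ((0, c) : ob (cone b C) n) = 0.
  by apply/cy_cone; rewrite /= linear0 scaler0 c0.
move=> /(_ dn)/bd_cone[w2 /= w20 w2E].
apply/bd_cone; exists (w1 + w2) => /=; first by rewrite linearD w1u w20 addr0.
have := kill_pkill kb w20 => w2k.
have -> : v - b' *: (w1 + w2) =
    (v + w - b *: w1) + (c - b *: w2) + (b - b') *: w2.
  rewrite /c !scalerBl scalerDr opprD.
  by rewrite [RHS](AC ((3*4)*2) (1*(5*9)*(2*6)*(4*3)*(8*7))) /= !subrr !addr0.
by apply: (smodD (smod_pbd _ _)) => //; apply: (smodD (smod_pbd _ _)).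
Qed.

Record chmap (C D : cpx) := Chmap {
  hm :> forall i, {linear ob C i -> ob D i};
  hmE : forall i u, hm i.+1 (df u) = df (hm i u) }.

Definition phm C D (f : chmap C D) n : {linear pre C n -> pre D n} :=
  if n is k.+1 return {linear pre C n -> pre D n} then f k else idfun.

Lemma phmE C D (f : chmap C D) n (w : pre C n) : f n (dpre w) = dpre (phm f n w).
Proof. by case: n w => [|n] w /=; rewrite ?linear0 // hmE. Qed.

Lemma hom_bd C D (f : chmap C D) n (u : ob C n) : bd u -> bd (f n u).
Proof. by move=> [w <-]; exists (phm f n w); rewrite phmE. Qed.

Fact cone_hom_linear C D (f : chmap C D) n :
  linear (fun p : ob C n * pre C n => (f n p.1, phm f n p.2)).
Proof. by move=> a p q /=; rewrite (linearP (f n)) (linearP (phm f n)). Qed.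

Fact cone_hom_comm x C D (f : chmap C D) n (p : ob (cone x C) n) :
  Lin (@cone_hom_linear C D f n.+1) (df p) =
  @df (cone x D) n (Lin (@cone_hom_linear C D f n) p).
Proof.
rewrite LinE cone_dfE /= LinE [RHS]cone_dfE /= hmE; congr pair.
by rewrite linearB linearZ_LR phmE.
Qed.

Definition cone_hom x C D (f : chmap C D) : chmap (cone x C) (cone x D) :=
  @Chmap (cone x C) (cone x D) (fun n => Lin (@cone_hom_linear C D f n))
    (@cone_hom_comm x C D f).

Lemma cone_homE x C D (f : chmap C D) n (p : ob (cone x C) n) :
  cone_hom x f n p = (f n p.1, phm f n p.2).
Proof. exact: LinE. Qed.

Fixpoint kos_hom s C D (f : chmap C D) : chmap (kos s C) (kos s D) :=
  if s is x :: s' return chmap (kos s C) (kos s D) then cone_hom x (kos_hom s' f) else f.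

Definition chiso C D (f : chmap C D) := forall n,
  (forall u, f n u = 0 -> u = 0) /\ forall v, exists u, f n u = v.
Definition chisoc C D := exists f : chmap C D, chiso f.

Lemma iso_pre C D (f : chmap C D) n : chiso f ->
  (forall u, phm f n u = 0 -> u = 0) /\ forall v, exists u, phm f n u = v.
Proof. by case: n => [|n] If; [split=> // v; exists v|exact: If]. Qed.

Lemma iso_cone x C D (f : chmap C D) : chiso f -> chiso (cone_hom x f).
Proof.
move=> If n; have [i1 s1] := If n; have [i2 s2] := iso_pre n If; split.
  by move=> [u v]; rewrite cone_homE /= => -[/i1 -> /i2 ->].
move=> [u v]; have [u' <-] := s1 u; have [v' <-] := s2 v.
by exists (u', v'); rewrite cone_homE.
Qed.

Lemma chisoc_cone x C D : chisoc C D -> chisoc (cone x C) (cone x D).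
Proof. by move=> [f If]; exists (cone_hom x f); apply: iso_cone. Qed.

Lemma iso_bd C D (f : chmap C D) n (u : ob C n) : chiso f -> bd (f n u) -> bd u.
Proof.
move=> If [w wE]; have [_ s2] := iso_pre n If; have [w' w'E] := s2 w.
exists w'; apply/eqP; rewrite -subr_eq0; apply/eqP; apply: (If n).1.
by rewrite linearB phmE w'E wE subrr.
Qed.

Lemma chisoc_exact C D n : chisoc C D -> exact_at D n -> exact_at C n.
Proof.
move=> [f If] exD u u0; apply: (iso_bd If); apply: exD.
by rewrite -hmE u0 linear0.
Qed.

Lemma chisoc_kill C D n r : chisoc C D -> kill D n r -> kill C n r.
Proof.
move=> [f If] kD u u0; apply: (iso_bd If); rewrite linearZ_LR; apply: kD.
by rewrite -hmE u0 linear0.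
Qed.

Lemma chisoc_vanish d C D : chisoc C D -> vanish d D -> vanish d C.
Proof. by move=> CD vD n dn; apply: chisoc_exact CD (vD n dn). Qed.

Section Swap.
Variables (a b : A) (C : cpx).

Definition swap_fun n : ob (cone a (cone b C)) n -> ob (cone b (cone a C)) n :=
  match n return ob (cone a (cone b C)) n -> ob (cone b (cone a C)) n with
  | 0 => fun p => ((p.1.1, p.2), p.1.2)
  | k.+1 => fun p => ((p.1.1, p.2.1), (p.1.2, - p.2.2))
  end.

Fact swap_linear n : linear (@swap_fun n).
Proof.
move=> c; case: n => [|n] [[u v] w] [[u' v'] w'] //=.
by case: w w' => w t [w' t'] /=; rewrite opprD -scalerN.
Qed.

Fact swap_comm n (p : ob (cone a (cone b C)) n) :
  Lin (@swap_linear n.+1) (df p) =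
  @df (cone b (cone a C)) n (Lin (@swap_linear n) p).
Proof.
rewrite (LinE (@swap_linear n.+1)) (LinE (@swap_linear n)) cone_dfE [RHS]cone_dfE; case: n p => [|n] [[u v] w].
  rewrite /= !LinE /=; congr (_, _).
  rewrite [RHS]surjective_pairing /= subr0; congr (_, _).
  by rewrite [v]zeroM0 [w]zeroM0 !scaler0 subr0 oppr0.
case: w => w t; rewrite /= !LinE /=; congr (_, _).
rewrite [RHS]surjective_pairing /=; congr (_, _).
by rewrite linearN opprK opprB opprD addrA addrAC.
Qed.

Lemma cone_swap : chisoc (cone a (cone b C)) (cone b (cone a C)).
Proof.
exists (@Chmap _ _ (fun n => Lin (@swap_linear n)) swap_comm) => n; split.
  move=> p; rewrite /= LinE; case: n p => [|n] [[u v] w] /=.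
    by move=> -[-> -> ->].
  by case: w => w t /= -[-> -> ->] /eqP; rewrite oppr_eq0 => /eqP ->.
move=> q; case: n q => [|n] [[u v] w].
  by exists ((u, w), v); rewrite /= LinE.
case: w => w t; exists ((u, w), (v, - t)); by rewrite /= LinE /= opprK.
Qed.
End Swap.

Lemma chisoc_trans C D E : chisoc C D -> chisoc D E -> chisoc C E.
Proof.
move=> [f If] [g Ig].
have gf i u : (g i.+1 \o f i.+1) (df u) = df ((g i \o f i) u).
  by rewrite /= !hmE.
exists (@Chmap C E (fun i => g i \o f i) gf) => n; split=> [u /= /(Ig n).1/(If n).1 //|v].
by have [w <-] := (Ig n).2 v; have [u <-] := (If n).2 w; exists u.
Qed.

Lemma chisoc_refl C : chisoc C C.
Proof. by exists (@Chmap C C (fun=> idfun) (fun i u => erefl)) => n; split=> // v; exists v. Qed.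

Lemma kos_move s x C : chisoc (kos s (cone x C)) (kos (x :: s) C).
Proof.
elim: s => [|y s IHs] /=; first exact: chisoc_refl.
by apply: chisoc_trans (chisoc_cone y IHs) _; apply: cone_swap.
Qed.
Lemma kos_move' s x C : chisoc (kos (x :: s) C) (kos s (cone x C)).
Proof.
elim: s => [|y s IHs] /=; first exact: chisoc_refl.
by apply: chisoc_trans (cone_swap _ _ _) (chisoc_cone y IHs).
Qed.

Lemma kill_kos_mem s x C n : x \in s -> kill (kos s C) n x.
Proof.
elim: s n => //= y s IHs n; rewrite inE => /orP[/eqP ->|xs]; first exact: kill_cone_self.
have [s1 [s2 sE]] : exists s1 s2, s = s1 ++ x :: s2.
  by case/splitPr: xs => s1 s2; exists s1, s2.
rewrite -[cone y _]/(kos (y :: s) C) sE -cat_cons kos_cat.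
by apply: (chisoc_kill (kos_move _ _ _)); apply: kill_cone_self.
Qed.

End Complexes.
Arguments df {A c i}.
Arguments dpre {A C n}.

Section QuasiIsomorphisms.
Variable A : comNzRingType.
Implicit Types C D J I : cpx A.

Definition qis C D (f : chmap C D) :=
  (forall n (u : ob C n), df u = 0 -> bd (f n u) -> bd u) /\
  forall n (v : ob D n), df v = 0 -> exists u, df u = 0 /\ bd (v - f n u).

Lemma qis_pre C D (f : chmap C D) : qis f ->
  (forall n (u : pre C n), dpre u = 0 -> pbd (phm f n u) -> pbd u) /\
  forall n (v : pre D n), dpre v = 0 -> exists u, dpre u = 0 /\ pbd (v - phm f n u).
Proof.
move=> [f1 f2]; split=> -[|n] v //=; first exact: f1.
exact: f2.
Qed.

Lemma qis_cone x C D (f : chmap C D) : qis f -> qis (cone_hom x f).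
Proof.
move=> qf; have [p1 p2] := qis_pre qf; have [f1 f2] := qf; split=> n [u v] /cy_cone[/= u0 xu].
  rewrite cone_homE => /bd_cone[w /= wE wb].
  have [|w0 w0E] := f1 n u u0; first by exists w.
  have [|c [c0 cb]] := p2 n (w - phm f n w0).
    by rewrite linearB -phmE w0E wE subrr.
  apply/bd_cone; exists (w0 + c) => /=; first by rewrite linearD c0 addr0.
  apply: p1; first by rewrite linearB linearZ_LR linearD w0E c0 addr0 xu subrr.
  have -> : phm f n (v - x *: (w0 + c)) =
      (phm f n v - x *: w) + x *: (w - phm f n w0 - phm f n c).
    by rewrite linearB linearZ_LR linearD; lincomb.
  by apply: (smodD (smod_pbd _ _)) => //; apply: (smodZ _ (smod_pbd _ _)).
have [u' [u'0 [w wE]]] := f2 n u u0.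
have [||v0 v0E] := f1 n (x *: u').
- by rewrite linearZ_LR u'0 scaler0.
- exists (v - x *: w); rewrite linearB !linearZ_LR wE -xu; lincomb.
have [|c [c0 cb]] := p2 n (v - x *: w - phm f n v0).
  rewrite !(linearB dpre) (linearZ_LR dpre) wE -phmE v0E (linearZ_LR (f n)) -xu; lincomb.
exists (u', v0 + c); split; first by apply/cy_cone; rewrite /= linearD c0 addr0 v0E.
have H : bd ((u - f n u', v - phm f n (v0 + c)) : ob (cone x D) n).
  apply/bd_cone; exists w => //=.
  by have -> : v - phm f n (v0 + c) - x *: w = v - x *: w - phm f n v0 - phm f n c
  by rewrite linearD; lincomb.
by rewrite (@cone_homE _ x); exact: H.
Qed.

Lemma qis_kos s C D (f : chmap C D) : qis f -> qis (kos_hom s f).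
Proof. by move=> qf; elim: s => //= x s; apply: qis_cone. Qed.

Definition ses J I (I' : cpx A) (i : chmap J I) (p : chmap I I') := forall n,
  [/\ forall u, i n u = 0 -> u = 0, forall v, exists u, p n u = v &
      forall u, p n u = 0 <-> exists w, i n w = u].

Lemma ses_pre J I (I' : cpx A) (i : chmap J I) (p : chmap I I') : ses i p -> forall n,
  [/\ forall u, phm i n u = 0 -> u = 0, forall v, exists u, phm p n u = v &
      forall u, phm p n u = 0 <-> exists w, phm i n w = u].
Proof.
move=> S [|n]; last exact: S; split=> [u //|v|u]; first by exists v.
by split=> _; [exists u|rewrite /= [u]zeroM0].
Qed.

Lemma ses_cone x J I (I' : cpx A) (i : chmap J I) (p : chmap I I') :
  ses i p -> ses (cone_hom x i) (cone_hom x p).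
Proof.
move=> S n; have [i0 ps ip] := S n; have [i0' ps' ip'] := ses_pre S n; split.
- by move=> [u v]; rewrite cone_homE /= => -[/i0 -> /i0' ->].
- move=> [u v]; have [u' <-] := ps u; have [v' <-] := ps' v.
  by exists (u', v'); rewrite cone_homE.
move=> [u v]; rewrite cone_homE; split=> [[/ip[w <-] /ip'[w' <-]]|[[w w']]].
  by exists (w, w'); rewrite cone_homE.
rewrite cone_homE => -[<- <-] /=; congr (_, _); first by apply/ip; exists w.
by apply/ip'; exists w'.
Qed.

Lemma ses_kos s J I (I' : cpx A) (i : chmap J I) (p : chmap I I') :
  ses i p -> ses (kos_hom s i) (kos_hom s p).
Proof. by move=> S; elim: s => //= x s; apply: ses_cone. Qed.

Definition obj_closed (Phi : lmodType A -> Prop) :=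
  Phi (zeroM A) /\ forall U V, Phi U -> Phi V -> Phi (U * V)%type.

Lemma kos_obj Phi s C : obj_closed Phi ->
  (forall n, Phi (ob C n)) -> forall n, Phi (ob (kos s C) n).
Proof.
move=> [P0 PP] PC; elim: s => //= x s IHs n; apply: PP => //.
by case: n => [|n]; [exact: P0|exact: IHs].
Qed.

Lemma zeroM_injective : injective_module (zeroM A).
Proof. by move=> U V j _ f; exists \0 => u; rewrite /= [RHS]zeroM0. Qed.

Lemma injective_obj_closed : obj_closed (@injective_module A).
Proof. by split; [exact: zeroM_injective|exact: inj_pair]. Qed.

Lemma homotopy C c q : (forall n, injective_module (ob C n)) ->
  (forall n, (n <= q)%N -> kill C n c) ->
  exists (S : {linear ob C q -> pre C q}) (T : {linear ob C q.+1 -> ob C q}),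
    forall u, c ^+ q.+1 *: u = dpre (S u) + T (df u).
Proof.
move=> Cinj; have scl (V : lmodType A) (a : A) : linear (fun v : V => a *: v).
  by move=> b u v; rewrite scalerDr !scalerA mulrC.
elim: q => [|q IHq] kC.
  have [u u0|T TE] := inj_extend (f := @df A C 0) (g := Lin (scl (ob C 0%N) c)) (Cinj 0%N).
    have [w wE] := kC 0%N (leqnn 0) u u0; rewrite LinE -wE.
    by rewrite [w]zeroM0 linear0.
  by exists \0, T => u; rewrite TE LinE expr1 /= add0r.
have [|S [T STE]] := IHq; first by move=> n nq; apply: kC; apply: leqW.
pose g : {linear ob C q.+1 -> ob C q.+1} :=
  Lin (scl (ob C q.+1) (c ^+ q.+1)) \- (df \o T).
have gd u : g (df u) = 0.
  rewrite [g _]/= LinE; have -> : T (df u) = c ^+ q.+1 *: u - dpre (S u).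
    by rewrite STE addrC addKr.
  by rewrite linearB linearZ_LR df_dpre subr0 subrr.
have [u u0|T' T'E] := inj_extend (f := @df A C q.+1)
    (g := g \o Lin (scl (ob C q.+1) c)) (Cinj q.+1).
  have [w wE] := kC q.+1 (leqnn _) u u0.
  by change (g (Lin (scl (ob C q.+1) c) u) = 0); rewrite LinE -wE; apply: gd.
pose S' : {linear ob C q.+1 -> pre C q.+1} := T \o Lin (scl (ob C q.+1) c).
exists S', T' => u.
have -> : T' (df u) = c ^+ q.+1 *: (c *: u) - df (T (c *: u)).
  rewrite T'E; change (g (Lin (scl (ob C q.+1) c) u) = c ^+ q.+1 *: (c *: u) - df (T (c *: u))).
  by rewrite LinE [g _]/= LinE.
have -> : dpre (S' u) = df (T (c *: u)) by rewrite [S' u]/= LinE.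
rewrite exprS; lincomb.
Qed.

End QuasiIsomorphisms.

(** * Torsion in Koszul cohomology *)

Section TorsionCohomology.
Variables (A : comNzRingType) (m : idealr A).
Implicit Types C D J I : cpx A.

Definition tors_at C n := forall u : ob C n, df u = 0 -> torm m (@bd A C n) u.
Definition torsion_objects C := forall n (u : ob C n), tors m u.
Definition torsionfree_objects C := forall n (u : ob C n), tors m u -> u = 0.

Lemma torsionfree_cohomology C n : (forall k, injective_module (ob C k)) ->
  torsionfree_objects C -> (forall k, (k < n)%N -> exact_at C k) ->
  forall u : ob C n, torm m (@bd A C n) u -> bd u.
Proof.
move=> Cinj tfC; case: n => [|q] exC u tu.
  suff -> : u = 0 by apply: smod0 (smod_bd _ _).
  apply: tfC => y /tu[k [w wE]]; exists k; rewrite -wE.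
  by rewrite [w]zeroM0 linear0.
have [|S [T STE]] := homotopy (C := C) (c := 1) (q := q) Cinj.
  by move=> k kq v v0; rewrite scale1r; apply: exC.
have dT w : df (T (df w)) = df w.
  have -> : T (df w) = w - dpre (S w).
    by have := STE w; rewrite expr1n scale1r => {2}->; rewrite addrC addKr.
  by rewrite linearB df_dpre subr0.
suff E : u - df (T u) = 0 by exists (T u); apply/esym/eqP; rewrite -subr_eq0 E.
apply: tfC => y /tu[k [w wE]]; exists k.
by rewrite scalerBr -!linearZ_LR -wE [dpre w]/= dT subrr.
Qed.

Section Sequence.
Variables (J I I' : cpx A) (i : chmap J I) (p : chmap I I').
Hypotheses (S : ses i p) (Jt : torsion_objects J) (I'tf : torsionfree_objects I')
  (I'inj : forall n, injective_module (ob I' n)).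

Lemma quotient_exact q : (forall n, (n < q)%N -> tors_at I n) ->
  forall n, (n < q)%N -> exact_at I' n.
Proof.
move=> tI n; elim/ltn_ind: n => n IHn nq u' u'0.
apply: (torsionfree_cohomology I'inj I'tf).
  by move=> k kn; apply: IHn => //; apply: ltn_trans nq.
have [_ ps ip] := S n; have [_ _ ip'] := S n.+1.
have [u uE] := ps u'; have [|w wE] := (ip' (df u)).1; first by rewrite hmE uE.
move=> y ym; have [k k0] := Jt w ym.
have du : df (y ^+ k *: u) = 0 by rewrite linearZ_LR -wE -linearZ_LR k0 linear0.
have [l lb] := tI n nq _ du y ym; exists (l + k)%N.
by rewrite exprD -scalerA -uE -2!(linearZ_LR (p n)); apply: hom_bd.
Qed.

Lemma torsion_class_lift n (u : ob I n) : (forall k, (k < n)%N -> exact_at I' k) ->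
  df u = 0 -> torm m (@bd A I n) u -> exists2 w, df w = 0 & bd (u - i n w).
Proof.
move=> exI' u0 tu.
have : bd (p n u).
  apply: (torsionfree_cohomology I'inj I'tf exI') => y /tu[k kb]; exists k.
  by rewrite -linearZ_LR; apply: hom_bd.
move=> [w' w'E]; have [_ psp ipp] := ses_pre S n; have [_ _ ip] := S n.
have [w wE] := psp w'.
have [|v vE] := (ip (u - dpre w)).1.
  by rewrite linearB phmE wE w'E subrr.
exists v; last by exists w; rewrite vE subKr.
have [i0 _ _] := S n.+1; apply: i0.
by rewrite hmE vE linearB u0 df_dpre subr0.
Qed.

Lemma torsion_class_reflect n (w : ob J n) : pexact_at I' n ->
  bd (i n w) -> bd w.
Proof.
move=> exI' [v vE]; have [_ _ ip] := S n; have [_ psp ipp] := ses_pre S n.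
have [i0 _ _] := S n.
have : dpre (phm p n v) = 0 by rewrite -phmE vE; apply/ip; exists w.
move=> /exI'; case: n w v vE ip psp ipp i0 {exI'} => [|n] w v vE ip psp ipp i0.
  move=> _; exists 0; apply/esym/eqP; rewrite linear0; apply/eqP/i0.
  by rewrite -vE [v]zeroM0 linear0.
move=> [t' t'E]; have [_ pst _] := ses_pre S n; have [t tE] := pst t'.
have [|j jE] := (ipp (v - dpre t)).1.
  rewrite linearB; apply/eqP; rewrite subr_eq0; apply/eqP.
  by rewrite [phm p n.+1 (dpre t)]phmE tE t'E.
exists j; apply/eqP; rewrite -subr_eq0; apply/eqP/i0.
rewrite linearB; apply/eqP; rewrite subr_eq0; apply/eqP.
have := @hmE _ _ _ i n j; rewrite [dpre j]/= => ->.
by have := jE; rewrite /= => ->; rewrite linearB df_dpre subr0 -vE.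
Qed.

Lemma torsion_vanish d : (forall n, exact_at I' n) -> vanish d I -> vanish d J.
Proof.
move=> exI' vI n dn w w0; apply: torsion_class_reflect.
  by case: n {dn w w0} => [|n] //; apply: exI'.
by apply: vI => //; rewrite -hmE w0 linear0.
Qed.
End Sequence.

Lemma chisoc_tors C D n : chisoc C D -> tors_at D n -> tors_at C n.
Proof.
move=> [f If] tD u u0 y ym; have [|k kb] := tD (f n u) _ y ym.
  by rewrite -hmE u0 linear0.
by exists k; apply: (iso_bd If); rewrite linearZ_LR.
Qed.

Lemma tors_cone_mul x y C n :
  tors_at (cone x C) n -> tors_at (cone y C) n -> tors_at (cone (x * y) C) n.
Proof.
move=> tx ty [u v] /cy_cone[/= u0 xyu] z zm.
have [|k /bd_cone[w1 /= w1E w1b]] := tx ((y *: u, v) : ob (cone x C) n) _ z zm.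
  by apply/cy_cone; rewrite /= linearZ_LR u0 scaler0 scalerA.
have [|l /bd_cone[w3 /= w3E w3b]] := ty ((z ^+ k *: u, w1) : ob (cone y C) n) _ z zm.
  by apply/cy_cone; rewrite /= linearZ_LR u0 scaler0 w1E !scalerA mulrC.
exists (l + k)%N; rewrite exprD -scalerA.
apply/bd_cone; exists w3 => //=.
have -> : z ^+ l *: (z ^+ k *: v) - (x * y) *: w3 =
    z ^+ l *: (z ^+ k *: v - x *: w1) + x *: (z ^+ l *: w1 - y *: w3) by lincomb.
by apply: (smodD (smod_pbd _ _)); apply: (smodZ _ (smod_pbd _ _)).
Qed.

Lemma tors_cone_exp x a C n :
  tors_at (cone x C) n -> tors_at (cone (x ^+ a) C) n.
Proof.
move=> tx; elim: a => [|a IHa]; last by rewrite exprS; apply: tors_cone_mul.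
move=> [u v] /cy_cone[_ /= uv] y ym; exists 0%N; rewrite scale1r.
apply/bd_cone; exists v; first by rewrite -uv expr0 scale1r.
by rewrite /= expr0 scale1r subrr; apply: smod0 (smod_pbd _ _).
Qed.

Fixpoint powers (s s' : seq A) : Prop :=
  match s, s' with
  | x :: s, x' :: s' => (exists a, x' = x ^+ a) /\ powers s s'
  | [::], [::] => True
  | _, _ => False
  end.

Lemma powers_refl s : powers s s.
Proof. by elim: s => //= x s IHs; split=> //; exists 1%N; rewrite expr1. Qed.

Lemma tors_kos_powers s s' C n :
  powers s s' -> tors_at (kos s C) n -> tors_at (kos s' C) n.
Proof.
elim: s s' C => [|x s IHs] [|x' s'] C //= [[a ->] ss'] tx.
apply: chisoc_tors (kos_move' _ _ _) _; apply: IHs ss' _.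
apply: chisoc_tors (kos_move _ _ _) _.
exact: tors_cone_exp.
Qed.

End TorsionCohomology.

Section KoszulProjection.
Variable A : comNzRingType.
Implicit Types C D : cpx A.

Fact cone_pr_comm x C n (p : ob (cone x C) n) : (df p).1 = df p.1.
Proof. by rewrite cone_dfE. Qed.
Definition cone_pr x C : chmap (cone x C) C :=
  @Chmap A (cone x C) C (fun n => fst : ob C n * pre C n -> ob C n) (@cone_pr_comm x C).

Definition chid C : chmap C C := @Chmap A C C (fun=> idfun) (fun i u => erefl).

Fact chcomp_comm C D (E : cpx A) (f : chmap C D) (g : chmap D E) i u :
  (g i.+1 \o f i.+1) (df u) = df ((g i \o f i) u).
Proof. by rewrite /= !hmE. Qed.
Definition chcomp C D (E : cpx A) (f : chmap C D) (g : chmap D E) : chmap C E :=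
  @Chmap A C E (fun i => g i \o f i) (@chcomp_comm C D E f g).

Fixpoint kproj s C : chmap (kos s C) C :=
  if s is x :: s' return chmap (kos s C) C then chcomp (cone_pr x (kos s' C)) (kproj s' C)
  else chid C.

Lemma inl_linear (U V : lmodType A) : linear (fun u : U => (u, 0) : U * V).
Proof. by move=> a u v; congr (_, _); rewrite /= scaler0 addr0. Qed.
Lemma inr_linear (U V : lmodType A) : linear (fun v : V => (0, v) : U * V).
Proof. by move=> a u v; congr (_, _); rewrite /= scaler0 addr0. Qed.

Fixpoint kin s C n : {linear ob C n -> ob (kos s C) n} :=
  if s is x :: s' return {linear ob C n -> ob (kos s C) n}
  then Lin (@inl_linear (ob (kos s' C) n) (pre (kos s' C) n)) \o kin s' C n
  else idfun.

Lemma kinS x s C n (u : ob C n) :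
  kin (x :: s) C n u = ((kin s C n u, 0) : ob (cone x (kos s C)) n).
Proof. by rewrite /= LinE. Qed.

Lemma kproj_in s C n (u : ob C n) : kproj s C n (kin s C n u) = u.
Proof. by elim: s => //= x s IHs; rewrite LinE. Qed.

Lemma kin_df s C n : exists X : 'I_(size s) -> {linear ob C n -> ob (kos s C) n.+1},
  forall u, df (kin s C n u) = kin s C n.+1 (df u) + \sum_(l < size s) s`_l *: X l u.
Proof.
elim: s => [|x s [X XE]].
  by exists (fun=> \0) => u; rewrite big_ord0 addr0.
pose i1 := Lin (@inl_linear (ob (kos s C) n.+1) (ob (kos s C) n)).
pose i2 := Lin (@inr_linear (ob (kos s C) n.+1) (ob (kos s C) n)).
pose T := {linear ob C n -> ob (kos (x :: s) C) n.+1}.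
exists (fun l : 'I_(size s).+1 => if unlift ord0 l is Some j then (i1 \o X j : T) else (i2 \o kin s C n : T)) => u.
rewrite !kinS cone_dfE /= big_ord_recl unlift_none /=.
under eq_bigr => l _ do rewrite liftK /= LinE.
rewrite LinE linear0 subr0 XE.
have -> : \sum_(l < size s) s`_l *: (X l u, 0 : ob (kos s C) n) =
    (\sum_(l < size s) s`_l *: X l u, 0 : ob (kos s C) n).
  apply: (big_rec2 (fun a b => a = (b, 0))) => // l a b _ ->.
  by congr (_, _); rewrite /= scaler0 addr0.
by congr (_, _) => /=; rewrite ?scaler0 ?add0r ?addr0 // addrC.
Qed.

Lemma kos_homotopy s C q c : (forall n, injective_module (ob C n)) ->
  (forall n, (n <= q)%N -> kill (kos s C) n c) ->
  exists (S : {linear ob C q -> pre C q}) (T : {linear ob C q.+1 -> ob C q})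
    (X : 'I_(size s) -> {linear ob C q -> ob C q}),
    forall u, c ^+ q.+1 *: u = dpre (S u) + T (df u) + \sum_(l < size s) s`_l *: X l u.
Proof.
move=> Cinj kc.
have [S [T STE]] := homotopy (kos_obj s (@injective_obj_closed A) Cinj) kc.
have [X XE] := kin_df s C q.
exists (phm (kproj s C) q \o S \o kin s C q), (kproj s C q \o T \o kin s C q.+1),
  (fun l => kproj s C q \o T \o X l) => u.
rewrite /= -phmE -[in LHS](kproj_in s u) -linearZ_LR STE XE !linearD addrA.
congr (_ + _); rewrite !linear_sum; apply: eq_bigr => l _.
by rewrite linearZ_LR linearZ_LR.
Qed.

Lemma kproj_cocycle s C n (u : ob (kos s C) n) : df u = 0 ->
  df (kproj s C n u) = 0 /\ forall x, x \in s -> bd (x *: kproj s C n u).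
Proof.
elim: s u => //= x s IHs [u v] /cy_cone[/= /IHs[u0 ub] xu]; split=> // y.
rewrite inE => /orP[/eqP ->|/ub //]; rewrite -linearZ_LR xu phmE.
by exists (phm (kproj s C) n v).
Qed.

Lemma kin_cocycle s C n (u : ob C n) : df u = 0 ->
  (forall x, x \in s -> x *: u = 0) -> df (kin s C n u) = 0.
Proof.
move=> u0; elim: s => //= x s IHs xu; apply/cy_cone; rewrite LinE /=; split.
  by apply: IHs => y ys; apply: xu; rewrite inE ys orbT.
by rewrite linear0 -linearZ_LR xu ?linear0 // mem_head.
Qed.

End KoszulProjection.

Section ModuleComplexes.
Variables (A : comNzRingType) (m : idealr A) (M : lmodType A).
Hypotheses (Anoeth : noetherian A) (Mfg : fgm M).

Definition cpxI : cpx A := @Cpx A (mres M) (mdif M) (@mdif2 A M).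

Definition obM n : lmodType A := if n is 0 then M else zeroM A.
Fact cpxM_df2 i (u : obM i) : (\0 : {linear obM i.+1 -> obM i.+2}) ((\0 : {linear obM i -> obM i.+1}) u) = 0.
Proof. by []. Qed.
Definition cpxM : cpx A := @Cpx A obM (fun i => \0) cpxM_df2.

Definition aug_fun n : {linear ob cpxM n -> ob cpxI n} :=
  if n is 0 return {linear ob cpxM n -> ob cpxI n} then min_in M 0 else \0.
Fact aug_comm n u : aug_fun n.+1 (df u) = df (aug_fun n u).
Proof.
case: n u => [|n] u /=; rewrite ?linear0 //.
by apply/esym/mdif_eq0; exists u.
Qed.
Definition aug : chmap cpxM cpxI := @Chmap A cpxM cpxI aug_fun aug_comm.

Lemma aug_qis : qis aug.
Proof.
split=> -[|n].
- move=> u _ [w]; rewrite [w]zeroM0 linear0 => /esym u0; exists 0.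
  rewrite linear0; apply/esym/(@min_in_inj A M 0).
  by rewrite linear0; apply: u0.
- by move=> u _ _; exists 0; rewrite linear0 [RHS]zeroM0.
- move=> v /mdif_eq0[y yv]; exists y; split=> //.
  by rewrite /= yv subrr; apply: smod0 (smod_bd _ _).
move=> v /mdifS_eq0[y yv]; exists 0; split=> //.
by rewrite linear0 subr0; exists y.
Qed.

Fixpoint smul (s : seq A) (v : M) : Prop :=
  if s is x :: s' then exists w, smul s' (v - x *: w) else v = 0.

Lemma smod_smul s : smod (smul s).
Proof.
elim: s => [|x s IHs]; first exact: smod_eq0.
split=> [|a u v [u' uE] [v' vE]]; first by exists 0; rewrite scaler0 subrr; apply: smod0.
exists (a *: u' + v').
have -> : a *: u + v - x *: (a *: u' + v') = a *: (u - x *: u') + (v - x *: v') by lincomb.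
exact: IHs.2.
Qed.

Lemma smul_mem s x v : x \in s -> smul s (x *: v).
Proof.
elim: s => //= y s IHs; rewrite inE => /orP[/eqP ->|/IHs xs].
  by exists v; rewrite subrr; apply: smod0 (smod_smul s).
by exists 0; rewrite scaler0 subr0.
Qed.

Lemma kosM_zero s n (u : ob (kos s cpxM) n) : (size s < n)%N -> u = 0.
Proof.
elim: s n u => [|x s IHs] [|n] u //= sn; first exact: zeroM0.
case: u => u v; congr (_, _); apply: IHs => //; exact: ltnW.
Qed.

Lemma kosM_top s : exists t : {linear M -> ob (kos s cpxM) (size s)},
  (forall u, exists v, t v = u) /\ forall v, bd (t v) <-> smul s v.
Proof.
elim: s => [|x s [t [ts tE]]].
  exists idfun; split=> [u|v]; first by exists u.
  split=> [[w]|/= ->]; last by exists 0; rewrite linear0.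
  by rewrite [w]zeroM0 linear0 => /esym.
pose t' : {linear M -> ob (kos (x :: s) cpxM) (size s).+1} :=
  Lin (@inr_linear A (ob (kos s cpxM) (size s).+1) (ob (kos s cpxM) (size s))) \o t.
have t'E v : t' v = ((0, t v) : ob (cone x (kos s cpxM)) (size s).+1) by rewrite /t' /= LinE.
exists t'; split=> [[u v]|v].
  have [w <-] := ts v; exists w; rewrite t'E; congr (_, _).
  by apply/esym/kosM_zero.
rewrite t'E.
split=> [/bd_cone[w _ /=]|[w wE]].
  by have [w' <-] := ts w; rewrite -linearZ_LR -linearB => /tE; exists w'.
apply/bd_cone; exists (t w); first by apply: kosM_zero.
by rewrite /= -linearZ_LR -linearB; apply/tE.
Qed.

Lemma kosM_noeth s n : noethm (ob (kos s cpxM) n).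
Proof.
apply: noethm_fg => //; apply: (kos_obj (Phi := @fgm A)).
  split; last exact: fgm_pair.
  by exists [::] => v; apply: zeroM0.
by case=> // k; exists [::] => v; apply: zeroM0.
Qed.

Lemma kosI_vanish s : vanish (size s) (kos s cpxI).
Proof.
rewrite -[size s]addn0; apply: vanish_kos => -[|n] // _ u.
by move/mdifS_eq0.
Qed.

Lemma kosI_bounded s n y : exists N, forall u : ob (kos s cpxI) n, df u = 0 ->
  (exists k, bd (y ^+ k *: u)) -> bd (y ^+ N *: u).
Proof.
have [q1 q2] := qis_kos s aug_qis.
have [N NE] := torm_bounded y (smod_bd (kos s cpxM) n) (@kosM_noeth s n).
exists N => v v0 [k kb]; have [u [u0 uv]] := q2 n v v0.
have kb' : bd (kos_hom s aug n (y ^+ k *: u)).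
  rewrite linearZ_LR; have -> : y ^+ k *: kos_hom s aug n u =
    y ^+ k *: v - y ^+ k *: (v - kos_hom s aug n u) by lincomb.
  by apply: (smodB (smod_bd _ _)) => //; apply: (smodZ _ (smod_bd _ _)).
have /q1 ub : df (y ^+ k *: u) = 0 by rewrite linearZ_LR u0 scaler0.
have /(hom_bd (kos_hom s aug)) := NE u (ex_intro _ k (ub kb')).
rewrite linearZ_LR => Nb.
have -> : y ^+ N *: v = y ^+ N *: (v - kos_hom s aug n u) + y ^+ N *: kos_hom s aug n u
  by lincomb.
by apply: (smodD (smod_bd _ _)) => //; apply: (smodZ _ (smod_bd _ _)).
Qed.

(* Top degree: H^(size s)(kos s I) = M / sM. *)
Lemma kosI_top s : exists t : {linear M -> ob (kos s cpxI) (size s)},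
  [/\ forall v, df (t v) = 0, forall v, bd (t v) <-> smul s v &
      forall u, df u = 0 -> exists v, bd (u - t v)].
Proof.
have [t [ts tE]] := kosM_top s; have [q1 q2] := qis_kos s aug_qis.
have dt v : df (t v) = 0 by apply: kosM_zero.
exists (kos_hom s aug (size s) \o t); split=> [v|v|u u0] /=.
- by rewrite -hmE dt linear0.
- rewrite -tE; split=> [|/hom_bd //]; exact: q1.
by have [u' [_ ub]] := q2 _ u u0; have [v vE] := ts u'; exists v; rewrite vE.
Qed.

Definition filter_regular s := forall n, (n < size s)%N -> tors_at m (kos s cpxI) n.

Lemma filter_regular_cons x s : filter_regular s ->
  (forall v, torm m (smul s) (x *: v) -> torm m (smul s) v) -> filter_regular (x :: s).
Proof.
move=> fs xreg n nx [u v] /cy_cone[/= u0 xu] y ym.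
have pfs : forall w : pre (kos s cpxI) n, dpre w = 0 -> exists k, pbd (y ^+ k *: w).
  case: n nx {u v u0 xu} => [|n] nx w w0; first by exists 0%N.
  by have [k kb] := fs n nx w w0 y ym; exists k.
have [k [w wE]] : exists k, bd (y ^+ k *: u).
  move: nx; rewrite /= ltnS leq_eqVlt => /orP[/eqP ns|ns]; last exact: fs ns u u0 y ym.
  subst n.
  have [t [t0 tE ts]] := kosI_top s; have [m' m'b] := ts u u0.
  have xm' : smul s (x *: m').
    apply/tE; rewrite linearZ_LR.
    have -> : x *: t m' = x *: u - x *: (u - t m') by lincomb.
    apply: (smodB (smod_bd _ _)); first by rewrite xu; exists v.
    exact: (smodZ _ (smod_bd _ _)).
  have [k kE] := xreg m' (sub_torm (m := m) (smod_smul s) xm') y ym; exists k.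
  have -> : y ^+ k *: u = y ^+ k *: (u - t m') + t (y ^+ k *: m').
    by rewrite linearZ_LR; lincomb.
  apply: (smodD (smod_bd _ _)); last exact/tE.
  exact: (smodZ _ (smod_bd _ _)).
have [|l lb] := pfs (y ^+ k *: v - x *: w).
  by rewrite linearB !(linearZ_LR dpre) wE -xu; lincomb.
exists (l + k)%N; rewrite exprD -scalerA.
apply/bd_cone; exists (y ^+ l *: w) => /=; first by rewrite (linearZ_LR dpre) wE.
by have -> : y ^+ l *: (y ^+ k *: v) - x *: (y ^+ l *: w) =
  y ^+ l *: (y ^+ k *: v - x *: w) by lincomb.
Qed.

Lemma filter_regular_powers s s' : powers s s' -> filter_regular s -> filter_regular s'.
Proof.
move=> ss' fs n ns; have : size s' = size s.
  by elim: s s' {fs ns} ss' => [|x s IHs] [|x' s'] //= [_ /IHs ->].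
by move=> sE; apply: tors_kos_powers ss' _; apply: fs; rewrite -sE.
Qed.

Lemma filter_regular_full s : filter_regular s -> (forall v, torm m (smul s) v) ->
  forall n, tors_at m (kos s cpxI) n.
Proof.
move=> fs ts n u u0; have [ns|ns|ns] := ltngtP n (size s); first exact: fs.
  by apply: sub_torm; [exact: smod_bd|apply: kosI_vanish].
subst n; have [t [t0 tE tsu]] := kosI_top s; have [v vb] := tsu u u0.
move=> y ym; have [k kE] := ts v y ym; exists k.
have -> : y ^+ k *: u = y ^+ k *: (u - t v) + t (y ^+ k *: v).
  by rewrite linearZ_LR; lincomb.
by apply: (smodD (smod_bd _ _)); [apply: (smodZ _ (smod_bd _ _))|apply/tE].
Qed.

End ModuleComplexes.

Section TorsionSubcomplex.
Variables (A : comNzRingType) (m : idealr A) (C : cpx A).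

Fact tor_df_sig n : {g : {linear psub (smod_tors m (ob C n)) -> psub (smod_tors m (ob C n.+1))} |
  forall u, pval (smod_tors m (ob C n.+1)) (g u) = df (pval (smod_tors m (ob C n)) u)}.
Proof.
apply: cid; apply: (lin_factor_inj (g := df \o pval (smod_tors m (ob C n)))).
  exact: pval_inj.
by move=> w; apply: pval_ex; apply: (tors_lin df (pvalP w)).
Qed.
Definition tor_df n := sval (tor_df_sig n).
Lemma tor_dfE n u : pval (smod_tors m (ob C n.+1)) (tor_df n u) = df (pval (smod_tors m (ob C n)) u).
Proof. exact: (svalP (tor_df_sig n)). Qed.
Fact tor_df2 n (u : psub (smod_tors m (ob C n))) : tor_df n.+1 (tor_df n u) = 0.
Proof. by apply: (pval_inj (smod_tors m (ob C n.+2))); rewrite !tor_dfE df2 linear0. Qed.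

Definition tcpx : cpx A := @Cpx A (fun n => psub (smod_tors m (ob C n))) tor_df tor_df2.
Definition tinc : chmap tcpx C := @Chmap A tcpx C (fun n => pval (smod_tors m (ob C n))) tor_dfE.

Fact quo_df_sig n : {g : {linear pquo (smod_tors m (ob C n)) -> pquo (smod_tors m (ob C n.+1))} |
  forall u, g (pproj (smod_tors m (ob C n)) u) = pproj (smod_tors m (ob C n.+1)) (df u)}.
Proof.
apply: cid; apply: (lin_factor_surj (g := pproj (smod_tors m (ob C n.+1)) \o df)).
  exact: pproj_surj.
by move=> u /pproj_eq0 tu; apply/pproj_eq0; apply: tors_lin.
Qed.
Definition quo_df n := sval (quo_df_sig n).
Lemma quo_dfE n u : quo_df n (pproj (smod_tors m (ob C n)) u) = pproj (smod_tors m (ob C n.+1)) (df u).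
Proof. exact: (svalP (quo_df_sig n)). Qed.
Fact quo_df2 n (u : pquo (smod_tors m (ob C n))) : quo_df n.+1 (quo_df n u) = 0.
Proof. by have [v <-] := pproj_surj u; rewrite !quo_dfE df2 linear0. Qed.

Definition qcpx : cpx A := @Cpx A (fun n => pquo (smod_tors m (ob C n))) quo_df quo_df2.
Fact qpr_comm i (u : ob C i) :
  pproj (smod_tors m (ob C i.+1)) (df u) = quo_df i (pproj (smod_tors m (ob C i)) u).
Proof. by rewrite quo_dfE. Qed.
Definition qpr : chmap C qcpx := @Chmap A C qcpx (fun n => pproj (smod_tors m (ob C n))) qpr_comm.

Lemma tq_ses : ses tinc qpr.
Proof.
move=> n; split=> [u /= u0|v|u /=]; last 1 first.
- split=> [/pproj_eq0|[w <-]]; first by apply: pval_ex.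
  by apply/pproj_eq0; apply: (pvalP w).
- by apply: (pval_inj (smod_tors m (ob C n))); rewrite linear0.
- exact: pproj_surj.
Qed.

Lemma tcpx_torsion : torsion_objects m tcpx.
Proof.
move=> n u y ym; have [k k0] := (pvalP u) y ym; exists k.
by apply: (pval_inj (smod_tors m (ob C n))); rewrite linearZ_LR k0 linear0.
Qed.
End TorsionSubcomplex.

Section LocalCohomology.
Variables (A : comNzRingType) (m : idealr A) (M : lmodType A).
Hypotheses (Anoeth : noetherian A) (Mfg : fgm M).

Definition cpxJ : cpx A := tcpx m (cpxI M).
Definition cpxQ : cpx A := qcpx m (cpxI M).

Lemma cpxJ_injective n : injective_module (ob cpxJ n).
Proof. by apply: torsion_injective => //; apply: hull_injective. Qed.
Lemma cpxQ_injective n : injective_module (ob cpxQ n).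
Proof. by apply: torsion_quotient_injective => //; apply: hull_injective. Qed.

Lemma kosJ_torsion s : torsion_objects m (kos s cpxJ).
Proof.
apply: (kos_obj (Phi := fun V => forall v : V, tors m v)) => [|n u]; last exact: tcpx_torsion.
split=> [v|U V tU tV [u v]]; first by rewrite [v]zeroM0; apply: smod0 (smod_tors _ _).
move=> y ym; have [k k0] := tU u y ym; have [l l0] := tV v y ym; exists (l + k)%N.
congr (_, _) => /=; first by rewrite exprD -scalerA k0 scaler0.
by rewrite addnC exprD -scalerA l0 scaler0.
Qed.
Lemma kosQ_torsionfree s : torsionfree_objects m (kos s cpxQ).
Proof.
apply: (kos_obj (Phi := fun V => forall v : V, tors m v -> v = 0)) => [|n u].
  split=> [v _|U V tU tV [u v] tuv]; first exact: zeroM0.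
  congr (_, _); [apply: tU|apply: tV] => y /tuv[k [k1 k2]]; by exists k.
exact: torsion_quotient_torsionfree.
Qed.
Lemma kosQ_injective s n : injective_module (ob (kos s cpxQ) n).
Proof. by apply: (kos_obj s (@injective_obj_closed A)) n; apply: cpxQ_injective. Qed.

Lemma kosQ_exact s : filter_regular m M s -> forall n, (n < size s)%N -> exact_at (kos s cpxQ) n.
Proof.
move=> fs n ns.
exact: (quotient_exact (ses_kos s (tq_ses m (cpxI M))) (@kosJ_torsion s)
 (@kosQ_torsionfree s) (@kosQ_injective s) fs ns).
Qed.

Lemma kosJ_kill s y : filter_regular m M s -> y \in m ->
  exists N, forall q, (q <= size s)%N -> kill (kos s cpxJ) q (y ^+ N).
Proof.
move=> fs ym; have Q q : (q <= size s)%N -> exists N, kill (kos s cpxJ) q (y ^+ N).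
  move=> qs; have [N NE] := kosI_bounded Anoeth Mfg s q y; exists N => w w0.
  apply: (torsion_class_reflect (ses_kos s (tq_ses m (cpxI M)))).
    by case: q qs {w w0 NE} => [|q] qs //; apply: (kosQ_exact fs).
  rewrite linearZ_LR; apply: NE; first by rewrite -hmE w0 linear0.
  have [k k0] := kosJ_torsion w ym; exists k.
  by rewrite -linearZ_LR k0 linear0; apply: smod0 (smod_bd _ _).
elim: {1 3}(size s) (leqnn (size s)) => [|n IHn] ns.
  by have [N NE] := Q 0%N ns; exists N => -[].
have [N NE] := IHn (ltnW ns); have [N' N'E] := Q n.+1 ns; exists (N + N')%N => q.
rewrite leq_eqVlt => /orP[/eqP ->|].
  rewrite exprD; exact: (smodZ (V := regm A) _ (smod_kill _ _)).
by rewrite ltnS addnC exprD => /NE; apply: (smodZ (V := regm A) _ (smod_kill _ _)).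
Qed.

Lemma cpxJ_homotopy s y q : filter_regular m M s -> y \in m -> (q <= size s)%N ->
  exists2 N, (0 < N)%N & exists (S : {linear ob cpxJ q -> pre cpxJ q}) (T : {linear ob cpxJ q.+1 -> ob cpxJ q})
    (X : 'I_(size s) -> {linear ob cpxJ q -> ob cpxJ q}),
    forall u, y ^+ N *: u = dpre (S u) + T (df u) + \sum_(l < size s) s`_l *: X l u.
Proof.
move=> fs ym qs; have [N NE] := kosJ_kill fs ym.
have [|S [T [X STE]]] := kos_homotopy (s := s) (q := q) (c := y ^+ N.+1) cpxJ_injective.
  move=> n nq; rewrite exprS; apply: (smodZ (V := regm A) _ (smod_kill _ _)).
  by apply: NE; apply: leq_trans qs.
by exists (N.+1 * q.+1)%N => //; exists S, T, X => u; rewrite exprM STE.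
Qed.

Lemma kosJ_vanish s : (forall n, tors_at m (kos s (cpxI M)) n) -> vanish (size s) (kos s cpxJ).
Proof.
move=> ts; apply: (torsion_vanish (ses_kos s (tq_ses m (cpxI M)))); last exact: kosI_vanish.
move=> n; exact: (quotient_exact (ses_kos s (tq_ses m (cpxI M))) (@kosJ_torsion s)
 (@kosQ_torsionfree s) (@kosQ_injective s) (fun k _ => ts k) (ltnSn n)).
Qed.
End LocalCohomology.

(** * Heights and systems of parameters *)

Section Height.
Variables (A : comNzRingType).
Hypothesis Anoeth : noetherian A.
Implicit Types (p q r c K L : regm A -> Prop).

Definition sprec q p := (forall a, q a -> p a) /\ exists2 a, p a & ~ q a.

(* ht c n p: some chain of n + 1 primes containing c ends at p. *)
Fixpoint ht c n p : Prop :=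
  isprime p /\ if n is k.+1 then exists2 q, sprec q p & ht c k q else forall a, c a -> p a.

Lemma ht_prime c n p : ht c n p -> isprime p. Proof. by case: n => [|n] []. Qed.

Lemma ht_sub c n p a : ht c n p -> c a -> p a.
Proof.
elim: n p => [|n IHn] p [_]; first exact.
by move=> [q [qp _] /IHn hq] /hq; apply: qp.
Qed.

Definition pclosed p K := forall t b : A, ~ p t -> K (t * b) -> K b.
Definition pcl p K (b : regm A) := exists2 t : A, ~ p t & K (t * b).

Lemma smod_pcl p K : isprime p -> smod K -> smod (pcl p K).
Proof.
move=> [sp p1 pM] sK; split=> [|a b b' [t nt tb] [t' nt' tb']].
  by exists 1 => //; rewrite mulr0; apply: smod0 sK.
exists (t' * t); first by case/pM.
have -> : t' * t * (a *: b + b') = (t' * a) *: (t * b : regm A) + t *: (t' * b' : regm A).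
  by rewrite !regmE; ring.
by apply: (smodD sK); apply: smodZ.
Qed.

Lemma pcl_closed p K : isprime p -> pclosed p (pcl p K).
Proof.
move=> [sp p1 pM] t b nt [t' nt' tb]; exists (t' * t); first by case/pM.
by rewrite -mulrA.
Qed.

Lemma pcl_sub p K b : isprime p -> K b -> pcl p K b.
Proof. by move=> [_ p1 _] Kb; exists 1 => //; rewrite mul1r. Qed.

Lemma smod_principal (a : A) : smod (fun b : regm A => exists x, b = x * a).
Proof. exact: (smod_line (a : regm A)). Qed.

Lemma minimal_prime_dcc p c (cs : smod c) : isprime p ->
  (forall P, isprime P -> (forall a, c a -> P a) -> (forall a, P a -> p a) ->
     forall a, p a -> P a) ->
  forall L, smod L -> pclosed p L -> (forall a, c a -> L a) ->
  forall K : nat -> regm A -> Prop, (forall n, smod (K n)) -> (forall n, pclosed p (K n)) ->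
    (forall n b, K n.+1 b -> K n b) -> (forall n b, L b -> K n b) ->
  exists n, forall b, K n b -> K n.+1 b.
Proof.
move=> pp minp; have [sp p1 pM] := pp.
pose dcc L := forall K : nat -> regm A -> Prop, (forall n, smod (K n)) ->
  (forall n, pclosed p (K n)) -> (forall n b, K n.+1 b -> K n b) -> (forall n b, L b -> K n b) ->
  exists n, forall b, K n b -> K n.+1 b.
suff H L : smod L -> pclosed p L -> (forall a, c a -> L a) -> dcc L by [].
move=> sL pL cL; apply: contrapT => ndcc.
pose F L := [/\ smod L, pclosed p L, forall a, c a -> L a & ~ dcc L].
have [||{sL pL cL ndcc}L [sL pL cL ndcc] maxL] := @noeth_max A (regm A) F (noethm_ring Anoeth).
- by exists L.
- by move=> D [].
have nL1 : ~ L 1.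
  move=> L1; apply: ndcc => K sK _ _ LK; exists 0%N => b _.
  by rewrite -[b]mulr1; apply: (smodZ (V := regm A)) => //; apply: LK.
have [P mP] := maximal_annihilator_exists Anoeth sL nL1; move=> PL.
have Pp := maximal_annihilator_prime sL mP.
have [[s nLs PE] _] := mP.
have ps a : p a -> L (a * s).
  have : forall a, p a -> P a.
    apply: minp => // b; rewrite PE => Lb.
      by rewrite regmE mulrC; apply: (smodZ (V := regm A)) => //; apply: cL.
    by apply: contrapT => nb; apply: nLs; apply: pL nb Lb.
  by move=> H pa; have := H a pa; rewrite PE.
pose ex K := pcl p (saddp K (fun b : regm A => exists x, b = x * s)).
have sex K : smod K -> smod (ex K).
  by move=> sK; apply: smod_pcl => //; apply: smod_add => //; apply: smod_principal.
have Kex K b : K b -> ex K b.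
  by move=> Kb; apply: pcl_sub => //; exists b => //; exists 0; rewrite subrr mul0r.
have dccL : dcc (ex L).
  apply: contrapT => nd; apply: nLs; apply: (maxL (ex L)); first split.
  - exact: sex.
  - exact: pcl_closed.
  - by move=> a /cL; apply: Kex.
  - exact: nd.
  - by move=> b; apply: Kex.
  by apply: pcl_sub => //; exists 0; [exact: smod0 sL|exists 1; rewrite subr0 mul1r].
apply: ndcc => K sK pK decK LK.
have [allK|[n0 nK]] : (forall n, K n s) \/ exists n, ~ K n s.
  have [|H] := EM (exists n, ~ K n s); [by right|left=> n].
  by apply: contrapT => nK; apply: H; exists n.
  apply: dccL => // n b [t nt [u Lu [x xE]]]; apply: pK nt _.
  rewrite -[t * b](subrK u) xE; apply: (smodD (sK n)); last exact: LK.
  exact: (smodZ (V := regm A)).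
have nK' n : ~ K (n0 + n)%N s by elim: n => [|n IHn]; rewrite ?addn0 // addnS => /decK.
have [||||n nE] := dccL (fun n => ex (K (n0 + n)%N)).
- by move=> n; apply: sex.
- by move=> n; apply: pcl_closed.
- move=> n b [t nt [u Ku ux]]; exists t => //; exists u => //.
  by apply: decK; rewrite -addnS.
- by move=> n b [t nt [u Lu ux]]; exists t => //; exists u => //; apply: LK.
exists (n0 + n)%N => b Kb.
have [t nt [u Ku [x xE]]] := nE b (Kex _ _ Kb).
move: Ku; rewrite addnS => Ku.
have px : p x.
  apply: contrapT => npx; apply: (nK' n); apply: pK npx _.
  rewrite -xE; apply: (smodB (sK _)); first exact: (smodZ (V := regm A)).
  exact: decK.
apply: pK nt _; rewrite -[t * b](subrK u) xE; apply: (smodD (sK _)) => //.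
by apply: LK; apply: ps.
Qed.

Fixpoint pgens (s : seq A) n : seq (regm A) :=
  if n is k.+1 then [seq x * y | x <- s, y <- pgens s k] else [:: 1].

Lemma pgens_exp (s : seq (regm A)) n a : lspan s a -> lspan (pgens s n) (a ^+ n).
Proof.
elim: n => [|n IHn] sa; first by apply: span_mem; rewrite mem_head.
rewrite exprS.
have sm (x : A) : smod (fun v : regm A => lspan (pgens s n.+1) (x * v)).
  split=> [|b u v ux vx]; first by rewrite mulr0; apply: smod0 (smod_span _).
  rewrite mulrDr mulrCA; apply: (smodD (smod_span _)) => //.
  exact: (smodZ (V := regm A) _ (smod_span _)).
have sm' (v : A) : smod (fun x : regm A => lspan (pgens s n.+1) ((x : A) * v)).
  split=> [|b x y ux vx]; first by rewrite mul0r; apply: smod0 (smod_span _).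
  rewrite mulrDl -mulrA; apply: (smodD (smod_span _)) => //.
  exact: (smodZ (V := regm A) _ (smod_span _)).
apply: (span_sub (sm' _) _ sa) => x xs; apply: (span_sub (sm x) _ (IHn sa)) => y ys.
by apply: span_mem; apply/allpairsP; exists (x, y).
Qed.

Lemma pgensS (s : seq (regm A)) q n v : smod q -> (forall x, x \in s -> q x) ->
  lspan (pgens s n.+1) v -> exists2 c : 'I_(size (pgens s n)) -> A, (forall j, q (c j)) &
    v = \sum_j c j *: (pgens s n)`_j.
Proof.
move=> sq qs; pose R v := exists2 c : 'I_(size (pgens s n)) -> A, (forall j, q (c j)) &
  v = \sum_j c j *: ((pgens s n)`_j : regm A).
apply: (span_sub (P := R)) => [|x /allpairsP[[y z] /= [ys zs ->]]].
  split=> [|a u w [c qc ->] [c' qc' ->]].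
    by exists (fun=> 0) => [_|]; [exact: smod0 sq|rewrite big1 // => i _; rewrite scale0r].
  exists (fun j => a * c j + c' j) => [j|]; first exact: sq.2.
  by rewrite scaler_sumr -big_split /=; apply: eq_bigr => i _; rewrite scalerDl scalerA.
have [i iE] : exists i : 'I_(size (pgens s n)), (pgens s n)`_i = z.
  by have := zs; rewrite -index_mem => zi; exists (Ordinal zi); rewrite /= nth_index.
exists (fun j => if j == i then y else 0) => [j|].
  by case: ifP => _; [exact: qs|exact: smod0 sq].
rewrite (bigD1 i) //= eqxx iE big1 ?addr0 // => j /negbTE ->.
by rewrite scale0r.
Qed.

(* Krull's principal ideal theorem in A / r. *)
Lemma principal_ideal_theorem r q p (a : A) :
  isprime r -> isprime q -> isprime p -> sprec r q -> sprec q p -> ~ q a -> p a ->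
  (forall P, isprime P -> (forall b, r b -> P b) -> P a -> (forall b, P b -> p b) ->
     forall b, p b -> P b) -> False.
Proof.
move=> pr pq pp [rq [z qz nrz]] [qp _] nqa pa minp.
have [sr _ _] := pr; have [sq q1 qM] := pq.
have [s qs sE] := noethm_ring Anoeth sq.
pose Q n := pcl q (saddp r (lspan (pgens s n))).
have sQ n : smod (Q n) by apply: smod_pcl => //; apply: smod_add => //; apply: smod_span.
have clQ n : pclosed p (Q n).
  by move=> t b nt; apply: (pcl_closed pq) => /qp.
have decQ n b : Q n.+1 b -> Q n b.
  move=> [t nt [u ru ub]]; exists t => //; exists u => //.
  have [c _ ->] := pgensS sq qs ub; apply: smod_sum => [|j _]; first exact: smod_span.
  by apply: (smodZ (V := regm A) _ (smod_span _)); apply: span_mem; apply: mem_nth.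
pose c := saddp r (fun b : regm A => exists x, b = x * a).
have sc : smod c by apply: smod_add => //; apply: smod_principal.
have rc b : r b -> c b by move=> rb; exists b => //; exists 0; rewrite subrr mul0r.
have rQ n b : r b -> Q n b.
  by move=> rb; apply: pcl_sub => //; exists b => //; rewrite subrr; apply: smod0 (smod_span _).
have ca : c a by exists 0; [exact: smod0 sr|exists 1; rewrite subr0 mul1r].
pose K n := pcl p (saddp (Q n) (fun b : regm A => exists x, b = x * a)).
have [||||||||n nE] := @minimal_prime_dcc p c sc pp _ (pcl p c) _ _ _ K.
- by move=> P pP cP Pp; apply: minp => // [b /rc|]; apply: cP.
- exact: smod_pcl.
- exact: pcl_closed.
- by move=> b; apply: pcl_sub.
- by move=> n; apply: smod_pcl => //; apply: smod_add => //; apply: smod_principal.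
- by move=> n; apply: pcl_closed.
- by move=> n b [t nt [u Qu ux]]; exists t => //; exists u => //; apply: decQ.
- by move=> n b [t nt [u ru ux]]; exists t => //; exists u => //; apply: rQ.
have Qstep b : Q n b -> Q n.+1 b.
  have [g Qg gE] := noethm_ring Anoeth (sQ n).
  move=> /gE; apply: span_sub => // x /(nthP 0)[i ig <-].
  apply: (local_nakayama (u := fun j : 'I_(size g) => g`_j) pp (sQ n.+1) (clQ n.+1) _ (Ordinal ig)).
  move=> {i ig}j.
  have Qj : Q n (g`_j) by apply: Qg; apply: mem_nth.
  have [|t nt [u Qu [y yE]]] := nE (g`_j).
    apply: pcl_sub => //; exists (g`_j) => //.
    by exists 0; rewrite subrr mul0r.
  have Qy : Q n y.
    have : Q n (a * y).
      rewrite mulrC -yE; apply: (smodB (sQ n)); last exact: decQ.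
      exact: (smodZ (V := regm A)).
    exact: (pcl_closed pq nqa).
  have /gE/span_ord[e eE] := Qy.
  exists t => //; exists (fun l => a * e l) => [l|].
    by have [sp _ _] := pp; rewrite mulrC; apply: (smodZ (V := regm A)).
  have -> : \sum_l (a * e l) *: (g`_l : regm A) = y * a.
    rewrite {1}eE mulrC mulr_sumr; apply: eq_bigr => l _; by rewrite !regmE mulrA.
  by rewrite -yE regmE subKr.
have ri i : r ((pgens s n)`_(i : 'I_(size (pgens s n)))).
  apply: (local_nakayama (u := fun j : 'I_(size (pgens s n)) => (pgens s n)`_j) pq sr) i.
    by move=> t v nt; have [_ _ rM] := pr; case/rM => // /rq.
  move=> i; have [|t nt [u ru]] := Qstep (pgens s n)`_i.
    apply: pcl_sub => //; exists 0; first exact: smod0 sr.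
    by rewrite subr0; apply: span_mem; apply: mem_nth.
  move=> /(pgensS sq qs)[e qe eE]; exists t => //; exists e => //.
  by rewrite -eE regmE subKr.
apply: nrz; apply: (prime_exp (n := n) pr).
apply: (span_sub sr) (pgens_exp n (sE z qz)) => x /(nthP 0)[i ig <-].
exact: (ri (Ordinal ig)).
Qed.

Lemma prime_shift r q p (a : A) : isprime r -> isprime q -> isprime p ->
  sprec r q -> sprec q p -> p a -> exists P, [/\ isprime P, P a, sprec r P & sprec P p].
Proof.
move=> pr pq pp rq qp pa; have [qa|nqa] := EM (q a); first by exists q.
apply: contrapT => H.
apply: (principal_ideal_theorem pr pq pp rq qp nqa pa) => P pP rP Pa Pp b pb.
apply: contrapT => nPb; apply: H; exists P; split=> //; last by split=> //; exists b.
by split=> //; exists a => // ra; apply: nqa; apply: rq.1.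
Qed.

Lemma ht_shift c n p (a : A) : smod c -> ht c n.+1 p -> p a ->
  ht (saddp c (fun b : regm A => exists x, b = x * a)) n p.
Proof.
move=> sc; elim: n p => [|n IHn] p [pp [q qp hq]] pa.
  split=> // b [u cu [x xE]]; have [sp _ _] := pp.
  rewrite -[b](subrK u) xE; apply: (smodD sp); first exact: (smodZ (V := regm A)).
  by apply: qp.1; exact: (@ht_sub c 0%N q u hq cu).
have [pq [r rq hr]] := hq.
have [P [pP Pa rP Pp]] := prime_shift (ht_prime hr) pq pp rq qp pa.
by split=> //; exists P => //; apply: IHn => //; split=> //; exists r.
Qed.

Lemma ht_bottom c n p : ht c n p -> exists q, [/\ isprime q, forall a, c a -> q a & forall a, q a -> p a].
Proof.
elim: n p => [|n IHn] p [pp]; first by move=> cp; exists p.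
by move=> [q qp /IHn[r [pr cr rq]]]; exists r; split=> // a /rq; apply: qp.1.
Qed.

Variable m : idealr A.
Hypothesis Aloc : local_ring m.

Lemma prime_sub_m p a : isprime p -> p a -> a \in m.
Proof. by move=> [sp p1 _]; apply: proper_sub_m. Qed.

Theorem height_theorem (s : seq A) c n p : smod c -> (forall y, y \in s -> y \in m) ->
  (forall P, isprime P -> (forall a, c a -> P a) -> (forall x, x \in s -> P x) ->
     forall y, y \in m -> P y) ->
  ht c n p -> (n <= size s)%N.
Proof.
elim: s c n p => [|x s IHs] c [|n] p sc sm H // [pp [q [qp [b pb nqb]] hq]].
  have [r [pr cr rq]] := ht_bottom hq; case: nqb; apply: rq; apply: H => //.
  exact: prime_sub_m pp pb.
have hm : ht c n.+1 (fun a => a \in m).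
  split; first exact: m_prime.
  exists q => //; split=> [a|]; first exact: prime_sub_m (ht_prime hq).
  by exists b => //; apply: prime_sub_m pb.
have xm : x \in m by apply: sm; rewrite mem_head.
have := ht_shift sc hm xm; apply: IHs.
- by apply: smod_add => //; apply: smod_principal.
- by move=> y ys; apply: sm; rewrite inE ys orbT.
move=> P pP cP sP; apply: H => // [a ca|y].
  by apply: cP; exists a => //; exists 0; rewrite subrr mul0r.
rewrite inE => /orP[/eqP ->|/sP //]; apply: cP.
by exists 0; [exact: smod0 sc|exists 1; rewrite subr0 mul1r].
Qed.

Lemma chain_of_ht c n p : ht c n p -> exists P : nat -> prime_idealr A,
  [/\ prime_chain P n, forall a, c a -> a \in P 0%N & forall a, a \in P n <-> p a].
Proof.
elim: n p => [|n IHn] p [pp].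
  by move=> cp; have [I IE] := prime_idealr_of pp; exists (fun=> I); split=> // a /cp/IE.
move=> [q [qp [b pb nqb]] /IHn[P [cP c0 Pq]]]; have [I IE] := prime_idealr_of pp.
exists (fun i => if (i <= n)%N then P i else I); split=> // [i|a]; last by rewrite ltnn.
rewrite /= ltnS [(i <= n)%N]leq_eqVlt => /orP[/eqP ->|ni].
  rewrite eqxx ltnn /=; split=> [a /Pq/qp/IE //|].
  by exists b; [apply/IE|apply/negP => /Pq].
by rewrite ni orbT; apply: cP.
Qed.

Lemma ht_of_chain c n (P : nat -> prime_idealr A) : prime_chain P n ->
  (forall a, c a -> a \in P 0%N) -> ht c n (fun a => a \in P n).
Proof.
elim: n => [|n IHn] cP c0 /=; first by split=> //; apply: isprime_idealr.
split; first exact: isprime_idealr.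
exists (fun a => a \in P n); last by apply: IHn => // i ni; apply: cP; apply: leqW.
by have [sP [b bP nb]] := cP n (ltnSn n); split=> //; exists b => //; apply/negP.
Qed.
End Height.

Section FilterRegularSystems.
Variables (A : comNzRingType) (m : idealr A) (d : nat) (M : lmodType A).
Hypotheses (Anoeth : noetherian A) (Aloc : local_ring m) (Adim : krull_dim A d).
Hypotheses (Mfg : fgm M) (Mfaithful : faithful M).

Definition annp (V : lmodType A) (K : V -> Prop) (a : regm A) := forall v : V, K ((a : A) *: v).
Lemma smod_annp (V : lmodType A) (K : V -> Prop) : smod K -> smod (annp K).
Proof.
move=> sK; split=> [v|a b c Kb Kc v]; first by rewrite scale0r; apply: smod0 sK.
by rewrite scalerDl -scalerA; apply: sK.2.
Qed.

Lemma ht_le_dim n p : ht (fun a : regm A => a = 0) n p -> (n <= d)%N.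
Proof. by move=> /chain_of_ht[P [cP _ _]]; apply: Adim.2 cP. Qed.

Lemma ht_dim : exists p, ht (fun a : regm A => a = 0) d p.
Proof.
have [[P cP] _] := Adim; exists (fun a => a \in P d); apply: ht_of_chain cP _ => a ->.
exact: smod0 (smod_idealr (P 0%N)).
Qed.

Lemma prime_below s x (p : regm A -> Prop) : isprime p ->
  (forall v : M, torm m (smul s) (x *: v) -> torm m (smul s) v) ->
  (forall a, annp (@smul A M s) a -> p a) -> p x -> (exists2 y, y \in m & ~ p y) ->
  exists P, [/\ isprime P, forall a, annp (@smul A M s) a -> P a & sprec P p].
Proof.
move=> pp xreg cp px [y ym npy]; have [sp p1 pM] := pp.
pose S (a : A) := exists t i, ~ p t /\ a = t * x ^+ i.
have sc := smod_annp (@smod_smul A M s).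
have [|a b|a ca|P [pP cP PS]] := @prime_avoiding A Anoeth (annp (@smul A M s)) S sc.
- by exists 1, 0%N; rewrite mulr1.
- move=> [t [i [nt ->]]] [t' [i' [nt' ->]]]; exists (t * t'), (i + i')%N; split.
    by case/pM.
  by rewrite exprD; ring.
- move=> [t [i [nt aE]]].
  have tv v : torm m (smul s) (t *: (v : M)).
    have : torm m (smul s) (x ^+ i *: (t *: v)).
      by rewrite scalerA mulrC -aE; apply: sub_torm; [exact: smod_smul|exact: ca].
    elim: i {aE} => [|i IHi]; first by rewrite scale1r.
    by rewrite exprS -scalerA => /xreg.
  have [N NE] := torm_bounded y (@smod_smul A M s) (noethm_fg Anoeth Mfg).
  have : p (y ^+ N * t).
    by apply: cp => v; rewrite -scalerA; apply: NE; apply: tv.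
  by case/pM => // /(prime_exp pp).
exists P; split=> //; split=> [a Pa|].
  by apply: contrapT => npa; apply: (PS a Pa); exists a, 0%N; rewrite mulr1.
exists x => // Px; apply: (PS x Px); exists 1, 1%N; by rewrite mul1r.
Qed.

Lemma smul_cons x s (v : M) : smul s v -> smul (x :: s) v.
Proof. by exists 0; rewrite scaler0 subr0. Qed.

Lemma ht_cons s x n p :
  (forall v : M, torm m (smul s) (x *: v) -> torm m (smul s) v) ->
  ht (annp (@smul A M (x :: s))) n p -> (exists2 y, y \in m & ~ p y) ->
  ht (annp (@smul A M s)) n.+1 p.
Proof.
move=> xreg; elim: n p => [|n IHn] p [pp].
  move=> cp ny; have [| |P [pP cP Pp]] := @prime_below s x p pp xreg _ _ ny.
  - by move=> a ca; apply: cp => v; apply: smul_cons.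
  - by apply: cp => v; apply: smul_mem; rewrite mem_head.
  by split=> //; exists P.
move=> [q qp hq] _; split=> //; exists q => //; apply: IHn => //.
have [_ [b pb nqb]] := qp; exists b => //; exact: (prime_sub_m Anoeth Aloc) pp pb.
Qed.

Lemma parameters_exist j : (j <= d)%N -> exists s : seq A, [/\ size s = j, forall y, y \in s -> y \in m,
  forall i, filter_regular m M (drop i s) &
  forall n p, ht (annp (@smul A M s)) n p -> n = 0%N \/ (n + j <= d)%N].
Proof.
elim: j => [|j IHj] jd.
  exists [::]; split=> // n p hp; right; rewrite addn0; apply: (@ht_le_dim n p).
  elim: n p hp => [|n IHn] p [pp]; last by move=> [q qp /IHn hq]; split=> //; exists q.
  by move=> cp; split=> // a ->; have [sp _ _] := pp; apply: smod0 sp.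
have [s [sj sm fs hs]] := IHj (ltnW jd).
have [||x xm xreg] := @regular_element A m Anoeth M (torm m (smul s)) (noethm_fg Anoeth Mfg).
- by apply: smod_torm; apply: smod_smul.
- by move=> v vy; apply: torm_torm => //; apply: smod_smul.
exists (x :: s); split=> [|y|[|i] /=|n p].
- by rewrite /= sj.
- by rewrite inE => /orP[/eqP ->|/sm].
- by apply: filter_regular_cons => //; rewrite -[s]drop0.
- exact: fs.
case: n => [|n] H; [by left|right].
move: H => [pp [q qp hq]].
have [_ [b pb nqb]] := qp.
have /hs : ht (annp (@smul A M s)) n.+2 p.
  split=> //; exists q => //; apply: (ht_cons xreg hq).
  by exists b => //; apply: (prime_sub_m Anoeth Aloc) pp pb.
by case=> //; rewrite addnS addSn.
Qed.

Theorem system_of_parameters : exists s : seq A, [/\ size s = d, forall y, y \in s -> y \in m,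
  forall i, filter_regular m M (drop i s) & forall v : M, torm m (smul s) v].
Proof.
have [s [sd sm fs hs]] := parameters_exist (leqnn d); exists s; split=> // v y ym.
suff [k kE] : exists k, annp (@smul A M s) (y ^+ k) by exists k.
apply: contrapT => H.
have [|a b|a ca [k aE]|P [pP cP PS]] := @prime_avoiding A Anoeth (annp (@smul A M s))
  (fun a => exists k, a = y ^+ k) (smod_annp (@smod_smul A M s)).
- by exists 0%N.
- by move=> [k ->] [l ->]; exists (k + l)%N; rewrite exprD.
- by apply: H; exists k; rewrite -aE.
have /hs : ht (annp (@smul A M s)) 1%N (fun a => a \in m).
  split; first exact: m_prime.
  exists P => //; split=> [a|]; first exact: prime_sub_m.
  by exists y => // /PS; apply; exists 1%N.
by case=> //; rewrite add1n ltnn.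
Qed.

Lemma smul_coef (u : seq M) s v : (forall w, lspan u w) -> smul s v ->
  exists2 c : 'I_(size u) -> A, (forall j, lspan (s : seq (regm A)) (c j)) & v = \sum_j c j *: u`_j.
Proof.
move=> uT; pose R w := exists2 c : 'I_(size u) -> A,
  (forall j, lspan (s : seq (regm A)) (c j)) & w = \sum_j c j *: u`_j.
have ss := smod_span (s : seq (regm A)).
have sR : smod R.
  split=> [|a w w' [c qc ->] [c' qc' ->]].
    by exists (fun=> 0) => [_|]; [exact: smod0 ss|rewrite big1 // => i _; rewrite scale0r].
  exists (fun j => a * c j + c' j) => [j|]; first exact: ss.2.
  by rewrite scaler_sumr -big_split /=; apply: eq_bigr => i _; rewrite scalerDl scalerA.
have xR x w : x \in s -> R (x *: w).
  move=> xs; have /span_ord[c ->] := uT w; exists (fun j => c j * x) => [j|].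
    exact: (smodZ (V := regm A) _ ss (span_mem xs)).
  by rewrite scaler_sumr; apply: eq_bigr => i _; rewrite scalerA mulrC.
suff H t w : (forall x, x \in t -> x \in s) -> smul t w -> R w by apply: H.
elim: t w => [|x t IHt] w ts /=; first by move=> ->; apply: smod0 sR.
move=> [w' ww']; rewrite -[w](subrK (x *: w')); apply: (smodD sR).
  by apply: IHt ww' => y yt; apply: ts; rewrite inE yt orbT.
by apply: xR; apply: ts; rewrite mem_head.
Qed.

Lemma power_in_ideal (s : seq A) (y : A) : (forall v : M, torm m (smul s) v) -> y \in m ->
  exists k, lspan (s : seq (regm A)) (y ^+ k).
Proof.
move=> H ym; have [u uT] := Mfg.
have [N NE] := torm_bounded y (@smod_smul A M s) (noethm_fg Anoeth Mfg).
have /choice[c cE] (i : 'I_(size u)) : exists c : 'I_(size u) -> A,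
    (forall j, lspan (s : seq (regm A)) (c j)) /\ y ^+ N *: u`_i = \sum_j c j *: u`_j.
  have [c] := smul_coef uT (NE u`_i (H u`_i y ym)); by exists c.
pose B := (\matrix_(i, j) ((y ^+ N) *+ (i == j) - c i j) : 'M[A]_(size u)).
have detB : \det B = 0.
  apply: Mfaithful => v; have /span_ord[e ->] := uT v; rewrite scaler_sumr big1 // => j _.
  rewrite scalerA mulrC -scalerA.
  suff -> : \det B *: u`_j = 0 by rewrite scaler0.
  apply: (det_trick (K := fun v : M => v = 0) (u := fun j : 'I_(size u) => u`_j)).
    exact: smod_eq0.
  move=> i; under eq_bigr => l _ do rewrite mxE scalerBl.
  rewrite sumrB -(cE i).2 (bigD1 i) //= eqxx mulr1n big1 ?addr0 ?subrr // => l.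
  by rewrite eq_sym => /negbTE ->; rewrite mulr0n scale0r.
exists (N * size u)%N.
have := det_congruent (B := B) (C := (y ^+ N)%:M) (smod_span (s : seq (regm A))).
rewrite detB sub0r det_scalar exprM => K.
have {}K : lspan (s : seq (regm A)) (- (y ^+ N) ^+ (size u)).
  apply: K => i j; rewrite !mxE addrAC subrr sub0r; exact: smodN (smod_span _) ((cE i).1 j).
by have := smodN (smod_span _) K; rewrite opprK.
Qed.

Lemma few_not_parameters (s : seq A) : (forall y, y \in s -> y \in m) -> (size s < d)%N ->
  ~ forall v : M, torm m (smul s) v.
Proof.
move=> sm sd H; have [p hp] := ht_dim.
suff : (d <= size s)%N by rewrite leqNgt sd.
apply: (@height_theorem A Anoeth m Aloc s (fun a : regm A => a = 0) d p) => //.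
  exact: (smod_eq0 (regm A)).
move=> P pP _ sP y ym; have [k kE] := power_in_ideal H ym.
by have [sP' _ _] := pP; apply: (prime_exp pP (n := k)); apply: (span_sub sP' sP kE).
Qed.

End FilterRegularSystems.

(** * Ext and socles *)

Section ExtLink.
Variables (A : comNzRingType) (M : lmodType A).

(* Maps N -> cosyz i vanishing in Ext^i(N, M). *)
Definition null (N : lmodType A) i : {linear N -> cosyz M i} -> Prop :=
  match i return {linear N -> cosyz M i} -> Prop with
  | 0 => fun f => forall x, f x = 0
  | j.+1 => fun f => exists g : {linear N -> mres M j}, forall x, f x = mproj M j (g x)
  end.

Section Shift.
Variables (N' P N : lmodType A) (i0 : {linear N' -> P}) (p : {linear P -> N}).
Hypotheses (i0_inj : injective i0) (p_surj : forall x, exists y, p y = x).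
Hypotheses (p_ex : forall y, p y = 0 <-> exists z, i0 z = y) (Pproj : projective P).

Definition extends (V : lmodType A) (f : {linear N' -> V}) :=
  exists k : {linear P -> V}, forall x, k (i0 x) = f x.

Definition shift i (f' : {linear N' -> cosyz M i}) (f : {linear N -> cosyz M i.+1}) :=
  exists h : {linear P -> mres M i}, (forall y, mproj M i (h y) = f (p y)) /\
    forall x, h (i0 x) = min_in M i (f' x).

Lemma pi0 x : p (i0 x) = 0. Proof. by apply/p_ex; exists x. Qed.

Lemma shift_down i (f : {linear N -> cosyz M i.+1}) : exists f', @shift i f' f.
Proof.
have [h hE] := Pproj (@mproj_surj A M i) (f \o p).
have [x|f' f'E] := lin_factor_inj (@min_in_inj A M i) (g := h \o i0).
  by have := hE (i0 x); rewrite /= pi0 linear0 => /mproj_eq0.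
by exists f', h; split=> x; [apply: hE|rewrite f'E].
Qed.

Lemma shift_up i (f' : {linear N' -> cosyz M i}) : exists f, shift f' f.
Proof.
have [x x0|h hE] := inj_extend (f := i0) (g := min_in M i \o f') (@hull_injective A (cosyz M i)).
  by rewrite (i0_inj (etrans x0 (esym (linear0 i0)))) linear0.
have [y|f fE] := lin_factor_surj (g := mproj M i \o h) p_surj.
  by move=> /p_ex[x <-]; rewrite /= hE mproj_in.
by exists f, h; split=> [y|x]; [rewrite fE|rewrite hE].
Qed.

Lemma shiftB i (f' g' : {linear N' -> cosyz M i}) f g (a : A) : shift f' f -> shift g' g ->
  shift (f' \- a \*: g') (f \- a \*: g).
Proof.
move=> [h [h1 h2]] [k [k1 k2]]; exists (h \- a \*: k); split=> x /=.
  by rewrite linearB (linearZ_LR (mproj M i)) h1 k1.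
by rewrite h2 k2 linearB (linearZ_LR (min_in M i)).
Qed.

Lemma shift_null i (f' : {linear N' -> cosyz M i}) f : shift f' f ->
  null f <-> extends f'.
Proof.
move=> [h [h1 h2]]; split=> [[g gE]|[k kE]].
  have [y|k kE] := lin_factor_inj (@min_in_inj A M i) (g := h \- (g \o p)).
    by apply/mproj_eq0; rewrite /= linearB h1 gE subrr.
  exists k => x; apply: (@min_in_inj A M i).
  by rewrite kE /= pi0 linear0 subr0 h2.
have [y|g gE] := lin_factor_surj (g := h \- (min_in M i \o k)) p_surj.
  by move=> /p_ex[x <-]; rewrite /= h2 kE subrr.
exists g => x; have [y <-] := p_surj x.
by rewrite gE /= linearB mproj_in subr0 h1.
Qed.

Lemma extends_null i (f : {linear N' -> cosyz M i.+1}) : extends f <-> null f.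
Proof.
split=> [[k kE]|[g gE]].
  have [g gE] := Pproj (@mproj_surj A M i) k.
  by exists (g \o i0) => x; rewrite -kE -gE.
have [x x0|g' g'E] := inj_extend (f := i0) (g := g) (@hull_injective A (cosyz M i)).
  by rewrite (i0_inj (etrans x0 (esym (linear0 i0)))) linear0.
by exists (mproj M i \o g') => x; rewrite /= g'E gE.
Qed.

Lemma null_extends i (f : {linear N' -> cosyz M i}) : null f -> extends f.
Proof.
case: i f => [|i] f; last by move/extends_null.
by move=> f0; exists \0 => x; rewrite f0.
Qed.
End Shift.

Definition cyc (N : lmodType A) i := exists f0 : {linear N -> cosyz M i}, ~ null f0 /\
  forall f : {linear N -> cosyz M i}, exists a : A, null (f \- a \*: f0).

Lemma cyc_shift (N' P N : lmodType A) (i0 : {linear N' -> P}) (p : {linear P -> N}) i :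
  injective i0 -> (forall x, exists y, p y = x) ->
  (forall y, p y = 0 <-> exists z, i0 z = y) -> projective P ->
  (exists f0 : {linear N' -> cosyz M i}, ~ extends i0 f0 /\
    forall f : {linear N' -> cosyz M i}, exists a : A, extends i0 (f \- a \*: f0)) ->
  cyc N i.+1.
Proof.
move=> ii ps pe Pp [f0' [nf0' f0'P]]; have [f0 f0E] := shift_up ii ps pe f0'.
exists f0; split=> [|f]; first by move/(shift_null ps pe f0E).
have [f' f'E] := shift_down pe Pp f; have [a aE] := f0'P f'; exists a.
by apply/(shift_null ps pe (shiftB a f'E f0E)).
Qed.

Lemma cyc_shiftS (N' P N : lmodType A) (i0 : {linear N' -> P}) (p : {linear P -> N}) i :
  injective i0 -> (forall x, exists y, p y = x) ->
  (forall y, p y = 0 <-> exists z, i0 z = y) -> projective P ->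
  cyc N' i.+1 -> cyc N i.+2.
Proof.
move=> ii ps pe Pp [f0 [nf0 f0P]]; apply: (cyc_shift ii ps pe Pp).
exists f0; split=> [|f]; first by move/(extends_null ii Pp).
by have [a aE] := f0P f; exists a; apply/(extends_null ii Pp).
Qed.

Fixpoint comb (N : lmodType A) i (t : seq {linear N -> cosyz M i}) f : Prop :=
  if t is g :: t' then exists a : A, comb t' (f \- a \*: g) else null f.
Definition fgext (N : lmodType A) i := exists t, forall f : {linear N -> cosyz M i}, comb t f.

Lemma fgext_shift (N' P N : lmodType A) (i0 : {linear N' -> P}) (p : {linear P -> N}) i :
  injective i0 -> (forall x, exists y, p y = x) ->
  (forall y, p y = 0 <-> exists z, i0 z = y) -> projective P ->
  fgext N' i -> fgext N i.+1.
Proof.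
move=> ii ps pe Pp [t' t'P].
suff [t tP] : exists t, forall (f' : {linear N' -> cosyz M i}) (f : {linear N -> cosyz M i.+1}),
    shift i0 p f' f -> comb t' f' -> comb t f.
  exists t => f; have [f' f'E] := shift_down pe Pp f; exact: tP f'E (t'P f').
elim: t' {t'P} => [|g' t' [t IHt]].
  exists [::] => f' f S /= f'0; apply/(shift_null ps pe S).
  exact: (null_extends ii Pp).
have [g gE] := shift_up ii ps pe g'; exists (g :: t) => f' f S [a ft'].
by exists a; apply: IHt ft'; apply: shiftB.
Qed.

Fixpoint pw (V : lmodType A) n : lmodType A := if n is k.+1 then (V * pw V k)%type else zeroM A.

Lemma pw_obj (Phi : lmodType A -> Prop) V n : obj_closed Phi -> Phi V -> Phi (pw V n).
Proof. by move=> [P0 PP] PV; elim: n => //= n; apply: PP. Qed.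

Lemma fgm_closed : obj_closed (@fgm A).
Proof. by split; [exists [::] => v; apply: zeroM0|exact: fgm_pair]. Qed.

Lemma regm_projective : projective (regm A).
Proof.
move=> U V p ps f; have [u uE] := ps (f (1 : A)).
exists (Lin (mul_linear u)) => a; rewrite /= LinE linearZ_LR uE -linearZ_LR.
by congr (f _); apply: mulr1.
Qed.

Lemma projective_closed : obj_closed (@projective A).
Proof.
split=> [U V p ps f|P Q pP pQ U V p ps f].
  by exists \0 => x; rewrite /= [x]zeroM0 !linear0.
have [g gE] := pP _ _ p ps (f \o Lin (@inl_linear A P Q)).
have [h hE] := pQ _ _ p ps (f \o Lin (@inr_linear A P Q)).
exists ((g \o fst) \+ (h \o snd)) => -[x y]; rewrite /= linearD.
have /= -> := gE x; have /= -> := hE y; rewrite !LinE -linearD; congr (f _).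
by congr (_, _); rewrite /= ?addr0 ?add0r.
Qed.

Fixpoint pwmap (V : lmodType A) (u : seq V) : {linear pw (regm A) (size u) -> V} :=
  if u is x :: u' return {linear pw (regm A) (size u) -> V}
  then ((Lin (mul_linear x) \o fst) \+ (pwmap u' \o snd)) else \0.

Lemma pwmap_surj (V : lmodType A) (u : seq V) v : lspan u v -> exists c, pwmap u c = v.
Proof.
elim: u v => [|x u IHu] v /=; first by move=> ->; exists 0.
move=> [a /IHu[c cE]]; exists ((a, c) : (regm A * pw (regm A) (size u))%type).
by rewrite /= LinE cE subrKC.
Qed.

Lemma free_presentation (N : lmodType A) : noetherian A -> fgm N ->
  exists (N' P : lmodType A) (i0 : {linear N' -> P}) (p : {linear P -> N}),
  [/\ fgm N', injective i0, forall x, exists y, p y = x,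
   forall y, p y = 0 <-> exists z, i0 z = y & projective P].
Proof.
move=> nA [u uT]; pose P := pw (regm A) (size u).
exists (psub (smod_ker (pwmap u))), P, (pval (smod_ker (pwmap u))), (pwmap u); split.
- by apply: fgm_sub => //; apply: pw_obj fgm_closed (fgm_ring A).
- exact: pval_inj.
- by move=> x; apply: pwmap_surj.
- move=> y; split=> [|[z <-]]; first exact: pval_ex.
  exact: (pvalP z).
- by apply: pw_obj projective_closed regm_projective.
Qed.

Fixpoint hev (N : lmodType A) (u : seq N) (f : {linear N -> M}) : pw M (size u) :=
  if u is x :: u' return pw M (size u) then (f x, hev u' f) else 0.

Lemma hevB (N : lmodType A) (u : seq N) (f g : {linear N -> M}) (a : A) :
  hev u (f \- a \*: g) = hev u f - a *: hev u g.
Proof.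
elim: u => [|x u IHu] /=; first by rewrite scaler0 subr0.
by rewrite IHu.
Qed.

Lemma fgext0 (N : lmodType A) : noetherian A -> fgm M -> fgm N -> fgext N 0.
Proof.
move=> nA Mfg [u uT].
pose R (w : pw M (size u)) := exists f, hev u f = w.
have sR : smod R.
  split=> [|a _ _ [f <-] [g <-]].
    exists \0; elim: (u) => //= x v ->; congr (_, _).
  exists (g \- (- a) \*: f); by rewrite hevB scaleNr opprK addrC.
have [s sR' sE] := noethm_fg nA (pw_obj (size u) fgm_closed Mfg) sR.
suff [t tP] : exists t, forall f : {linear N -> cosyz M 0}, lspan s (hev u f) -> comb t f.
  by exists t => f; apply: tP; apply: sE; exists f.
elim: s sR' {sE} => [|x s IHs] sR'.
  exists [::] => f /= f0 v.
  have sf : smod (fun v => f v = 0) by exact: smod_ker.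
  apply: (span_sub sf _ (uT v)) => {uT sR sR' R}.
  elim: u f0 => //= y u IHu [fy fu] z; rewrite inE => /orP[/eqP -> //|]; exact: IHu.
have [|t tP] := IHs; first by move=> y ys; apply: sR'; rewrite inE ys orbT.
have [|g gE] := sR' x; first exact: mem_head.
exists (g :: t) => f [a fs]; exists a; apply: tP.
by rewrite hevB gE.
Qed.

Lemma ext_finite (N : lmodType A) i : noetherian A -> fgm M -> fgm N -> fgext N i.
Proof.
move=> nA Mfg; elim: i N => [|i IHi] N Nfg; first exact: fgext0.
have [N' [P [i0 [p [N'fg ii ps pe Pp]]]]] := free_presentation nA Nfg.
exact: (fgext_shift ii ps pe Pp (IHi _ N'fg)).
Qed.
End ExtLink.

Section Socles.
Variables (A : comNzRingType) (m : idealr A) (M : lmodType A).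
Hypotheses (Anoeth : noetherian A) (Aloc : local_ring m) (Mfg : fgm M).

Definition soc (V : lmodType A) (v : V) := forall y : A, y \in m -> y *: v = 0.
Lemma smod_soc (V : lmodType A) : smod (@soc V).
Proof.
split=> [y _|a u v us vs y ym]; first by rewrite scaler0.
by rewrite scalerDr scalerA mulrC -scalerA us // vs // scaler0 addr0.
Qed.

Lemma soc_tors (V : lmodType A) (v : V) : soc v -> tors m v.
Proof. by move=> vs y ym; exists 1%N; rewrite expr1 vs. Qed.

Lemma soc_lin (U V : lmodType A) (f : {linear U -> V}) u : soc u -> soc (f u).
Proof. by move=> us y ym; rewrite -linearZ_LR us // linear0. Qed.

Definition resk : lmodType A := residue_module m.
Definition res1 : resk := (\pi_({ideal_quot m}) 1 : {ideal_quot m})%qT.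

Lemma resZ (a : A) : a *: res1 = (\pi_({ideal_quot m}) a : {ideal_quot m})%qT.
Proof.
rewrite -[LHS]/(residue_scale a res1) /residue_scale.
by rewrite [X in _ * X]rmorph1 mulr1.
Qed.

Lemma resZ_eq0 (a : A) : a *: res1 = 0 <-> a \in m.
Proof.
split=> [|am]; last exact: residue_module_killed.
rewrite resZ => a0; rewrite -[a]subr0 Quotient.idealrBE a0.
by apply/eqP; rewrite rmorph0.
Qed.

Lemma res_surj (x : resk) : exists a : A, a *: res1 = x.
Proof.
exists (repr (x : {ideal_quot m})); by rewrite resZ reprK.
Qed.

Lemma resk_fg : fgm resk.
Proof.
exists [:: res1] => v; have [a <-] := res_surj v; exists a.
by rewrite /= subrr.
Qed.

Lemma soc_map (V : lmodType A) (s : V) : soc s -> exists f : {linear resk -> V}, f res1 = s.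
Proof.
move=> ss; have [x|a|f fE] := @lin_factor_surj A (regm A) resk V
   (Lin (mul_linear res1)) (Lin (mul_linear s)).
- by have [a <-] := res_surj x; exists a; rewrite LinE.
- by rewrite !LinE => /resZ_eq0/ss.
by exists f; have := fE (1 : A); rewrite !LinE !scale1r.
Qed.

Lemma soc_res1 : soc res1. Proof. by move=> y ym; apply/resZ_eq0. Qed.

Lemma soc_essential (V E : lmodType A) (j : {linear V -> E}) s : essential j -> soc s ->
  exists v, j v = s.
Proof.
move=> ej ss; have [->|s0] := eqVneq s 0; first by exists 0; rewrite linear0.
have [a [as0 [v vE]]] := ej s s0.
have am : a \notin m by apply: contraNN as0 => /ss ->.
have [b ab] := local_unit Anoeth Aloc am; exists (b *: v).
by rewrite linearZ_LR vE scalerA mulrC ab scale1r.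
Qed.

Lemma soc_null i (f : {linear resk -> cosyz M i}) : null f -> f res1 = 0.
Proof.
case: i f => [|i] f; first exact.
move=> [g gE]; rewrite gE; apply/mproj_eq0.
exact: (soc_essential (@hull_essential A (cosyz M i)) (soc_lin g soc_res1)).
Qed.

Lemma soc_finite i : exists t : seq (cosyz M i), forall s, soc s -> lspan t s.
Proof.
have [t tP] := ext_finite i Anoeth Mfg resk_fg.
exists [seq g res1 | g : {linear resk -> cosyz M i} <- t] => s /soc_map[f <-].
elim: t f {tP}(tP f) => [|g t IHt] f /=; first exact: soc_null.
by move=> [a /IHt /= fE]; exists a.
Qed.

Lemma cyc_soc i : cyc M resk i -> exists s0 : cosyz M i, [/\ soc s0, s0 <> 0 &
  forall s, soc s -> exists a : A, s = a *: s0].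
Proof.
move=> [f0 [nf0 f0P]]; exists (f0 res1); split=> [|f00|s].
- exact: soc_lin soc_res1.
- apply: nf0; have fx x : f0 x = 0 by have [a <-] := res_surj x; rewrite linearZ_LR f00 scaler0.
  case: i f0 {f0P f00} fx => [|i] f0 fx //.
  by exists \0 => x; rewrite fx /= linear0.
move=> /soc_map[f <-]; have [a /soc_null /= fE] := f0P f; exists a.
by apply/eqP; rewrite -subr_eq0 fE.
Qed.

Section Bass.
Variable d : nat.
Hypothesis Md : bass_number m M d 1.
Local Notation k := (residue_module m : lmodType A).
Local Notation F := (@std_resolution A k).

Lemma bass_cocycle : exists f0 : {linear free_on (syzygy k d) -> M},
  [/\ forall u, f0 (std_dif k d u) = 0, ~ is_coboundary (P := F) (i := d) f0 &
    forall f : {linear free_on (syzygy k d) -> M}, (forall u, f (std_dif k d u) = 0) ->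
     exists a : A, is_coboundary (P := F) (i := d) (f \- a \*: f0)].
Proof.
have [e eP] := Md.
pose e0 : quotmod (@coboundary A k F M d) := e ord0.
have e_neq : e0 <> 0.
  move=> e00; have [c [cE cU]] := eP 0.
  have c1 := cU [ffun=> 1]; have c0 := cU [ffun=> 0].
  have H : [ffun=> 1] = [ffun=> 0] :> {ffun 'I_1 -> {ideal_quot m}}.
    rewrite -c1 ?c0 //; rewrite big_ord1 ffunE ?scale0r // scale1r.
    exact: esym e00.
  by have /ffunP/(_ ord0)/eqP := H; rewrite !ffunE oner_eq0.
have eZ (v : quotmod (@coboundary A k F M d)) : exists a : A, v = a *: e0.
  have [c [cE _]] := eP v; exists (repr (c ord0)).
  by have := cE; rewrite big_ord1.
move: e0 e_neq eZ; elim/quotmod_ind => -[f fZ] nf fP.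
have /asboolP[fl f0] := fZ.
have [g gf] := mklin fl; exists g; split.
- by move=> u; rewrite gf; apply: f0.
- move=> gB; apply: nf; rewrite -(quotmod_pi0 (@coboundary A k F M d)); apply/quotmod_pi_eq.
  rewrite subr0; apply/asboolP; change (is_coboundary (P := F) (i := d) f).
  by have <- : (g : _ -> _) = f by apply/funext.
move=> h h0; have hZ : (h : _ -> M) \in @cocycle A k F M d.
  by apply/asboolP; split; [exact: linearP|exact: h0].
have [a] := fP (quotmod_pi _ (Submod hZ)).
rewrite -[RHS]/(quotmod_scale a _) quotmod_scale_pi => /quotmod_pi_eq/asboolP hB.
exists a; suff -> : h \- a \*: g = val (Submod hZ - a *: Submod fZ) :> (_ -> _) by [].
by apply/funext => u; rewrite /= gf.
Qed.
Definition ker_val (U V : lmodType A) (f : {linear U -> V}) : {linear kernel f -> U} :=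
  (val : kernel f -> U).

Lemma ker_val_exact (U V : lmodType A) (f : {linear U -> V}) y :
  f y = 0 <-> exists z, ker_val f z = y.
Proof.
split=> [fy|[[z zk] <-]]; last by have := zk; rewrite inE => /eqP.
have yk : y \in ker_pred f by rewrite inE fy.
by exists (Submod yk).
Qed.

Lemma bass_cyc : cyc M resk d.
Proof.
have [f0 [f00 nf0 f0P]] := bass_cocycle.
have factor (f : {linear free_on (syzygy k d) -> M}) : (forall u, f (std_dif k d u) = 0) ->
    exists h : {linear syzygy k d -> M}, forall u, h (free_cover _ u) = f u.
  move=> fd; apply: lin_factor_surj => [v|u /std_exact[z <-] //].
  exact: free_cover_surj.
have [g0 g0E] := factor f0 f00.
have fdc (g : {linear syzygy k d -> M}) u : (g \o free_cover (syzygy k d)) (std_dif k d u) = 0.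
  have -> : (g \o free_cover (syzygy k d)) (std_dif k d u) = g (free_cover _ (std_dif k d u)) by [].
  have -> : free_cover _ (std_dif k d u) = 0 by apply/std_exact; exists u.
  by rewrite linear0.
case: d f0 f00 nf0 f0P factor g0 g0E fdc => [|j] f0 f00 nf0 f0P factor g0 g0E fdc.
  exists g0; split=> [g00|g]; first by apply: nf0 => u; rewrite -g0E g00.
  have [a aE] := f0P (g \o free_cover k) (fdc g); exists a => x.
  have [u <-] := free_cover_surj x; have := aE u.
  by rewrite /= -g0E.
have c1 : cyc M (syzygy k j) 1.
  apply: (cyc_shift (i0 := ker_val (free_cover (syzygy k j))) (p := free_cover (syzygy k j))).
  - exact: val_inj.
  - exact: free_cover_surj.
  - exact: ker_val_exact.
  - exact: free_on_projective.
  exists g0; split=> [[h hE]|g].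
    by apply: nf0; exists h => u; rewrite -g0E -hE.
  have [a [h hE]] := f0P (g \o free_cover (syzygy k j.+1)) (fdc g); exists a, h => x.
  have [u <-] := free_cover_surj x; have := hE u.
  by rewrite /= -g0E.
have step l i : cyc M (syzygy k l) i.+1 -> cyc M k (l + i).+1.
  elim: l i => [|l IHl] i // c; rewrite addSnnS; apply: IHl.
  apply: (cyc_shiftS (i0 := ker_val (free_cover (syzygy k l))) (p := free_cover (syzygy k l)) _ _ _ _ c).
  - exact: val_inj.
  - exact: free_cover_surj.
  - exact: ker_val_exact.
  - exact: free_on_projective.
by rewrite -[j]addn0; apply: step.
Qed.
End Bass.

Lemma soc_tcpx i (s : ob (cpxJ m M) i) : soc s -> exists2 c : cosyz M i, soc c &
  pval (smod_tors m (mres M i)) s = min_in M i c.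
Proof.
move=> ss; have [c cE] := soc_essential (@hull_essential A (cosyz M i))
  (soc_lin (pval (smod_tors m (mres M i))) ss).
exists c => // y ym; apply: (@min_in_inj A M i).
by rewrite linearZ_LR [min_in M i c]cE -linearZ_LR ss // !linear0.
Qed.

Lemma tcpx_soc i (c : cosyz M i) : soc c -> exists2 s : ob (cpxJ m M) i, soc s &
  pval (smod_tors m (mres M i)) s = min_in M i c.
Proof.
move=> sc; have [|s sE] := pval_ex (smod_tors m (mres M i)) (v := min_in M i c).
  exact: soc_tors (soc_lin (min_in M i) sc).
exists s => // y ym; apply: (pval_inj (smod_tors m (mres M i))).
by rewrite linearZ_LR sE -linearZ_LR sc // !linear0.
Qed.

Lemma socJ_finite i : exists t : seq (ob (cpxJ m M) i), (forall s, s \in t -> soc s) /\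
  forall s, soc s -> lspan t s.
Proof.
have [t tE] := soc_finite i.

have [j jE] : exists j : {linear psub (@smod_soc (ob (cpxJ m M) i)) -> psub (smod_span t)},
   forall x, min_in M i (pval (smod_span t) (j x)) =
     pval (smod_tors m (mres M i)) (pval (@smod_soc (ob (cpxJ m M) i)) x).
  have [||j jE] := lin_factor_inj (d := min_in M i \o pval (smod_span t))
    (g := pval (smod_tors m (mres M i)) \o pval (@smod_soc (ob (cpxJ m M) i))).
  - by move=> x y /(@min_in_inj A M i)/(pval_inj (smod_span t)).
  - move=> x; have [c cs cE] := soc_tcpx (pvalP x).
    have [u uE] := pval_ex (smod_span t) (tE c cs).
    by exists u; rewrite /= uE cE.
  by exists j.
have jinj : injective j.
  move=> x y xy; apply: (pval_inj (@smod_soc (ob (cpxJ m M) i))).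
  by apply: (pval_inj (smod_tors m (mres M i))); rewrite -!jE xy.
have [r rE] : fgm (psub (@smod_soc (ob (cpxJ m M) i))).
  apply: (fgm_inj Anoeth jinj); apply: fgp_sub; exists t => // x; exact: span_mem.
exists (map (pval (@smod_soc (ob (cpxJ m M) i))) r); split=> [s|s ss].
  by move/mapP => [x _ ->]; apply: (pvalP x).
have [x <-] := pval_ex (@smod_soc (ob (cpxJ m M) i)) ss.
exact: span_map.
Qed.

Lemma socJ_top d : bass_number m M d 1 -> exists s0 : ob (cpxJ m M) d, [/\ soc s0, s0 <> 0 &
  forall s, soc s -> exists a : A, s = a *: s0].
Proof.
move=> /bass_cyc/cyc_soc[c0 [sc0 c00 c0P]]; have [s0 ss0 s0E] := tcpx_soc sc0.
exists s0; split=> // [s00|s ss].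
  by apply: c00; apply: (@min_in_inj A M d); rewrite -s0E s00 !linear0.
have [c sc cE] := soc_tcpx ss; have [a ac] := c0P c sc; exists a.
apply: (pval_inj (smod_tors m (mres M d))).
by rewrite cE ac !linearZ_LR s0E.
Qed.
End Socles.

(** * Powers of a module with simple socle *)

Section Frames.
Variables (A : comNzRingType) (m : idealr A).
Hypotheses (Anoeth : noetherian A) (Aloc : local_ring m).
Variables (E : lmodType A) (s0 : E).
Hypotheses (Einj : injective_module E) (Etors : forall u : E, tors m u).
Hypotheses (s0_soc : soc m s0) (s0_neq0 : s0 <> 0).
Hypothesis s0_gen : forall s, soc m s -> exists a : A, s = a *: s0.

Lemma tors_nonzero (V : lmodType A) (v : V) : tors m v -> v <> 0 ->
  exists a : A, a *: v <> 0 /\ soc m (a *: v).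
Proof.
move=> tv /eqP v0; have [a [av0 avs]] := torsion_socle Anoeth tv v0.
by exists a; split=> //; apply/eqP.
Qed.

Lemma soc_unit (V : lmodType A) (v : V) (a : A) : soc m v -> a *: v <> 0 -> exists b, b * a = 1.
Proof.
move=> sv av; have am : a \notin m by apply/negP => /sv.
by have [b ab] := local_unit Anoeth Aloc am; exists b; rewrite mulrC.
Qed.

Lemma sub_soc (K : E -> Prop) u : smod K -> K u -> u <> 0 -> K s0.
Proof.
move=> sK Ku u0; have [a [au0 aus]] := tors_nonzero (@Etors u) u0.
have [b bE] := s0_gen aus.
have [|c cb] := @soc_unit E s0 b s0_soc; first by rewrite -bE.
rewrite -[s0]scale1r -cb -scalerA -bE; apply: (smodZ _ sK); exact: (smodZ _ sK).
Qed.

Lemma endo_scalar (f : {linear E -> E}) (I : regm A -> Prop) : smod I ->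
  (forall a : regm A, torm m I a) ->
  exists a : A, forall u, (forall b, I b -> (b : A) *: u = 0) -> f u = a *: u.
Proof.
move=> sI tI; apply: contrapT => H.
pose F I := [/\ smod I, (forall a : regm A, torm m I a) &
  ~ exists a : A, forall u, (forall b, I b -> (b : A) *: u = 0) -> f u = a *: u].
have [||{sI tI H}L [sL tL HL] maxL] := @noeth_max A (regm A) F (noethm_ring Anoeth).
- by exists I.
- by move=> D [].
have nL1 : ~ L 1.
  move=> L1; apply: HL; exists 0 => u /(_ 1 L1).
  by rewrite scale1r => ->; rewrite linear0 scaler0.
have [s [nLs mLs]] : exists s : A, ~ L s /\ forall y, y \in m -> L (y * s).
  pose q := pproj sL.
  have q1 : q 1 <> 0 by move/pproj_eq0.
  have [|a [aq aqs]] := @tors_nonzero (pquo sL) (q 1) _ q1.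
    move=> y ym; have [k kE] := tL 1 y ym; exists k.
    by rewrite -linearZ_LR; apply/pproj_eq0.
  have aE : a *: q 1 = q a by rewrite -linearZ_LR; congr (q _); apply: mulr1.
  exists a; split=> [La|y ym]; first by apply: aq; rewrite aE; apply/pproj_eq0.
  by have := aqs y ym; rewrite aE -linearZ_LR => /pproj_eq0.
pose L' := saddp L (fun b : regm A => exists x, b = x * s).
have sL' : smod L' by apply: smod_add => //; apply: smod_principal.
have LL' b : L b -> L' b by move=> Lb; exists b => //; exists 0; rewrite subrr mul0r.
have L's : L' s by exists 0; [exact: smod0 sL|exists 1; rewrite subr0 mul1r].
have [a aE] : exists a : A, forall u, (forall b, L' b -> (b : A) *: u = 0) -> f u = a *: u.
  apply: contrapT => H; apply: nLs; apply: (maxL L' _ LL' s L's); split=> // a y ym.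
  by have [k kE] := tL a y ym; exists k; apply: LL'.
have L'0 (u : E) : (forall b, L b -> (b : A) *: u = 0) -> s *: u = 0 -> forall b, L' b -> (b : A) *: u = 0.
  move=> Lu su b [c Lc [x xE]].
  by rewrite -[b](subrK c) xE scalerDl (Lu c) // addr0 -scalerA su scaler0.
have goal_ex c : (forall u, (forall b, L b -> (b : A) *: u = 0) -> f u = c *: u) -> False.
  move=> cE. by apply: HL; exists c.
apply: False_ind; have [H|] := EM (forall u : E, (forall b, L b -> (b : A) *: u = 0) -> s *: u = 0).
  by apply: (goal_ex a) => u Lu; apply: aE; apply: L'0 => //; apply: H.
move=> H; have [u0 [Lu0 su0]] : exists u0 : E, (forall b, L b -> (b : A) *: u0 = 0) /\ s *: u0 = s0.
  apply: contrapT => H'; apply: H => u Lu; apply: contrapT => su; apply: H'.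
  have sus : soc m (s *: u) by move=> y ym; rewrite scalerA Lu //; apply: mLs.
  have [c cE] := s0_gen sus.
  have [|e ec] := @soc_unit E s0 c s0_soc; first by rewrite -cE.
  exists (e *: u); split=> [b Lb|].
    by rewrite scalerA mulrC -scalerA Lu // scaler0.
  by rewrite scalerA mulrC -scalerA cE scalerA ec scale1r.
have fs : soc m (f u0 - a *: u0).
  move=> y ym; rewrite scalerBr -linearZ_LR scalerA mulrC -scalerA.
  apply/eqP; rewrite subr_eq0; apply/eqP; apply: aE; apply: L'0.
    by move=> b Lb; rewrite scalerA mulrC -scalerA Lu0 // scaler0.
  by rewrite scalerA mulrC; apply: Lu0; apply: mLs.
have [c cE] := s0_gen fs; apply: (goal_ex (a + c * s)) => u Lu.
have sus : soc m (s *: u) by move=> y ym; rewrite scalerA Lu //; apply: mLs.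
have [e eE] := s0_gen sus.
have uE : f (u - e *: u0) = a *: (u - e *: u0).
  apply: aE; apply: L'0.
    by move=> b Lb; rewrite scalerBr scalerA mulrC -scalerA Lu // Lu0 // scaler0 subrr.
  by rewrite scalerBr eE scalerA mulrC -scalerA su0 subrr.
have fu0 : f u0 = a *: u0 + c *: s0 by rewrite -cE addrCA subrr addr0.
have -> : f u = f (u - e *: u0) + e *: f u0 by rewrite linearB (linearZ_LR f) subrK.
rewrite uE fu0 scalerDl -scalerA eE; lincomb.
Qed.

Lemma endo_at (f : {linear E -> E}) (u : E) : exists a : A,
  forall v, (forall b : A, b *: u = 0 -> b *: v = 0) -> f v = a *: v.
Proof.
have [||a aE] := @endo_scalar f (fun b : regm A => (b : A) *: u = 0).
- exact: (smod_ann u (smod_eq0 E)).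
- move=> a y ym; have [k k0] := Etors u ym; exists k.
  by rewrite regmE mulrC -scalerA k0 scaler0.
by exists a => v; apply: aE.
Qed.

Lemma endoC (f g : {linear E -> E}) u : f (g u) = g (f u).
Proof.
have [a aE] := endo_at f u; have [b bE] := endo_at g u.
rewrite (bE u) // (aE u) // (aE (b *: u)) ?(bE (a *: u)) ?scalerA 1?mulrC //.
all: by move=> c cu; rewrite scalerA mulrC -scalerA cu scaler0.
Qed.

Record frame (V : lmodType A) := Frame {
  fdim : nat;
  fco : 'I_fdim -> {linear V -> E};
  fin : 'I_fdim -> {linear E -> V};
  fcoin : forall a b u, fco a (fin b u) = if a == b then u else 0;
  fsum : forall v, v = \sum_a fin a (fco a v) }.

Lemma zero_frame (V : lmodType A) : (forall v : V, v = 0) -> exists fr : frame V, True.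
Proof.
move=> V0; pose co (a : 'I_0) : {linear V -> E} := \0; pose inn (a : 'I_0) : {linear E -> V} := \0.
have hc a b u : co a (inn b u) = if a == b then u else 0 by case: a.
have sm v : v = \sum_a inn a (co a v) by rewrite big_ord0.
by exists (Frame hc sm).
Qed.

Lemma frame_cons (V V' : lmodType A) (r : {linear V -> E}) (g : {linear E -> V})
   (i : {linear V' -> V}) (p : {linear V -> V'}) (fr : frame V') :
  (forall u, r (g u) = u) -> (forall u, p (i u) = u) -> (forall u, r (i u) = 0) ->
  (forall u, p (g u) = 0) -> (forall v, v = g (r v) + i (p v)) -> exists fr : frame V, True.
Proof.
move=> rg pi ri pg vE; case: fr => n co inn coin sm.
pose T1 := {linear V -> E}; pose T2 := {linear E -> V}.
pose co' (a : 'I_n.+1) : T1 := if unlift ord0 a is Some j then (co j \o p : T1) else r.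
pose in' (a : 'I_n.+1) : T2 := if unlift ord0 a is Some j then (i \o inn j : T2) else g.
have coin' a b u : co' a (in' b u) = if a == b then u else 0.
  rewrite /co' /in'; case: unliftP => [a'|] ->; case: unliftP => [b'|] -> /=.
  - by rewrite pi coin (inj_eq (@lift_inj _ _)).
  - by rewrite pg linear0.
  - by rewrite ri.
  - by rewrite rg.
have sm' v : v = \sum_a in' a (co' a v).
  rewrite big_ord_recl /co' /in' unlift_none {1}[v]vE; congr (_ + _).
  under eq_bigr => j _ do rewrite liftK /=.
  by rewrite -linear_sum -sm.
by exists (Frame coin' sm').
Qed.

Lemma frame_exists n (V : lmodType A) (t : seq V) : size t = n -> injective_module V ->
  (forall v : V, tors m v) -> (forall x, x \in t -> soc m x) ->
  (forall s, soc m s -> lspan t s) -> exists fr : frame V, True.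
Proof.
elim: n V t => [|n IHn] V [|x t] //= sz Vinj Vt ts tE.
  apply: zero_frame => v; apply: contrapT => v0.
  have [a [av0 /tE /=]] := tors_nonzero (@Vt v) v0; exact: av0.
case: sz => sz; have [x0|x0] := EM (x = 0).
  apply: (IHn V t) => // [y yt|s /tE /= [a]]; first by apply: ts; rewrite inE yt orbT.
  by rewrite x0 scaler0 subr0.
have xs : soc m x by apply: ts; rewrite mem_head.
have [a as0|g gs] := inj_cyclic (v := s0) (e := x) Vinj.
  apply: contrapT => ax; have [b ba] := soc_unit xs ax.
  by apply: s0_neq0; rewrite -[s0]scale1r -ba -scalerA as0 scaler0.
have ginj : injective g.
  apply: inj_ker0 => u gu; apply: contrapT => u0.
  by apply: x0; rewrite -gs; apply: (sub_soc (smod_ker g) gu u0).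
have [r rg] := inj_split Einj ginj.
pose V' := psub (smod_ker r); pose i := pval (smod_ker r).
have [v|p pE] := lin_factor_inj (pval_inj (smod_ker r)) (g := idfun \- (g \o r)).
  by apply: pval_ex; rewrite /= linearB rg subrr.
have pi u : p (i u) = u.
  apply: (pval_inj (smod_ker r)); rewrite pE /=.
  by rewrite (pvalP u) linear0 subr0.
have Vi v : v = g (r v) + i (p v) by rewrite /i pE /= addrCA subrr addr0.
have [|||||fr _] := IHn V' (map p t).
- by rewrite size_map.
- exact: (inj_retract Vinj pi).
- move=> u y ym; have [k k0] := Vt (i u) y ym; exists k.
  by apply: (pval_inj (smod_ker r)); rewrite linearZ_LR k0 linear0.
- by move=> y /mapP[z zt ->]; apply: soc_lin; apply: ts; rewrite inE zt orbT.
- move=> s ss; have /tE/= [a aE] := soc_lin i ss.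
  have -> : s = p (i s - a *: x).
    rewrite linearB pi (linearZ_LR p); suff -> : p x = 0 by rewrite scaler0 subr0.
    by apply: (pval_inj (smod_ker r)); rewrite pE /= -gs rg subrr linear0.
  exact: span_map.
apply: (frame_cons fr rg pi _ _ Vi) => u; first exact: (pvalP u).
by apply: (pval_inj (smod_ker r)); rewrite pE /= rg subrr linear0.
Qed.
End Frames.
Arguments fco {A E V} f a.
Arguments fin {A E V} f a.

Section Semilinear.
Variables (A R : comNzRingType) (iota : A -> R).
Implicit Types (C : cpx A) (D : cpx R).

Definition semilin (U : lmodType A) (V : lmodType R) (h : U -> V) :=
  [/\ (forall u v, h (u + v) = h u + h v), (forall a u, h (a *: u) = iota a *: h u),
      (forall u, h u = 0 -> u = 0) & forall v, exists u, h u = v].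

Lemma semilin0 U V h : @semilin U V h -> h 0 = 0.
Proof. by move=> [hD _ _ _]; apply: (addrI (h 0)); rewrite -hD !addr0. Qed.
Lemma semilinB U V h u v : @semilin U V h -> h (u - v) = h u - h v.
Proof.
move=> sh; have [hD _ _ _] := sh; rewrite hD; congr (_ + _).
by apply/eqP; rewrite -addr_eq0 addrC -hD subrr (semilin0 sh).
Qed.

Definition sim C D := exists h : forall n, ob C n -> ob D n,
  forall n, semilin (h n) /\ forall u, h n.+1 (df u) = df (h n u).

Definition semipre C D (h : forall n, ob C n -> ob D n) n : pre C n -> pre D n :=
  if n is k.+1 return pre C n -> pre D n then h k else fun=> 0.

Lemma semipreP C D (h : forall n, ob C n -> ob D n) :
  (forall n, semilin (h n) /\ forall u, h n.+1 (df u) = df (h n u)) ->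
  forall n, semilin (semipre h (n := n)) /\ forall u, h n (dpre u) = dpre (semipre h u).
Proof.
move=> hP [|n]; last exact: hP.
split=> [|u]; last by rewrite /= (semilin0 (hP 0%N).1).
split=> [u v|a u|u _|v] /=; rewrite ?addr0 ?scaler0 //; first exact: zeroM0.
by exists 0; rewrite [v]zeroM0.
Qed.

Lemma sim_cone x C D : sim C D -> sim (cone x C) (cone (iota x) D).
Proof.
move=> [h hP]; exists (fun n p => (h n p.1, semipre h p.2)) => n.
have [[hD hZ hi hs] hdf] := hP n; have [sp pd] := semipreP hP n; have [pD pZ p_i ps] := sp.
split; last first.
  move=> [u v]; rewrite !cone_dfE /= hdf; congr (_, _).
  by rewrite (semilinB _ _ (hP n).1) hZ pd.
split=> [[u v] [u' v']|a [u v]|[u v] [/hi -> /p_i ->]|[u v]] //=.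
- by rewrite hD pD.
- by rewrite hZ pZ.
by have [u' <-] := hs u; have [v' <-] := ps v; exists (u', v').
Qed.

Lemma sim_kos s C D : sim C D -> sim (kos s C) (kos (map iota s) D).
Proof. by move=> CD; elim: s => //= x s; apply: sim_cone. Qed.

Lemma sim_bd C D (h : forall n, ob C n -> ob D n) n (u : ob C n) :
  (forall n, semilin (h n) /\ forall u, h n.+1 (df u) = df (h n u)) ->
  bd u <-> bd (h n u).
Proof.
move=> hP; have [sp pd] := semipreP hP n; split=> [[w <-]|[w' wE]].
  by exists (semipre h w); rewrite pd.
have [_ _ _ ps] := sp; have [w ww] := ps w'; exists w.
apply/eqP; rewrite -subr_eq0; apply/eqP; have [sh _] := hP n; have [_ _ hi _] := sh.
by apply: hi; rewrite (semilinB _ _ sh) pd ww wE subrr.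
Qed.

Lemma sim_cy C D (h : forall n, ob C n -> ob D n) n (u : ob C n) :
  (forall n, semilin (h n) /\ forall u, h n.+1 (df u) = df (h n u)) ->
  df u = 0 <-> df (h n u) = 0.
Proof.
move=> hP; have [_ hd] := hP n; have [sh _] := hP n.+1; have [_ _ hi _] := sh.
by split=> [u0|]; rewrite -hd; [rewrite u0 (semilin0 sh)|exact: hi].
Qed.

Lemma sim_exact C D n : sim C D -> exact_at C n -> exact_at D n.
Proof.
move=> [h hP] exC v v0; have [[_ _ _ hs] _] := hP n; have [u uv] := hs v.
rewrite -uv in v0 *; apply/(sim_bd u hP); apply: exC; exact/(sim_cy u hP).
Qed.

Lemma sim_kill C D n r : sim C D -> kill D n (iota r) -> kill C n r.
Proof.
move=> [h hP] kD u /(sim_cy u hP)/kD; have [[_ hZ _ _] _] := hP n.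
by rewrite -hZ => /(sim_bd _ hP).
Qed.
End Semilinear.

Section EndomorphismRing.
Variables (A : comNzRingType) (E : lmodType A).

Lemma smod_lin : smod (fun f : E -> E => linear f).
Proof.
split=> [a u v|a f g fl gl b u v]; first by rewrite scaler0 addr0.
rewrite !fctE fl gl !scalerDr !scalerA [b * a]mulrC; exact: addrACA.
Qed.

Definition endo := psub smod_lin.
Definition app (r : endo) : {linear E -> E} := Lin (pvalP r).
Lemma appE r : app r =1 pval smod_lin r. Proof. exact: LinE. Qed.
Lemma app_inj r s : app r =1 app s -> r = s.
Proof.
by move=> rs; apply: (pval_inj smod_lin); apply/funext => u; rewrite -!appE.
Qed.
Fact mk_sig (f : {linear E -> E}) : {r : endo | app r =1 f}.
Proof.
apply: cid; have [r rE] := pval_ex smod_lin (linearP f : linear (f : E -> E)).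
by exists r => u; rewrite appE rE.
Qed.
Definition mk f := sval (mk_sig f).
Lemma mkE f : app (mk f) =1 f. Proof. exact: (svalP (mk_sig f)). Qed.

Lemma appD r s u : app (r + s) u = app r u + app s u.
Proof. by rewrite !appE linearD. Qed.
Lemma appZ a r u : app (a *: r) u = a *: app r u.
Proof. by rewrite !appE linearZ_LR. Qed.
Lemma app0 u : app 0 u = 0. Proof. by rewrite appE linear0. Qed.

Hypothesis endoC : forall (f g : {linear E -> E}) u, f (g u) = g (f u).
Hypothesis E_neq0 : exists u : E, u <> 0.

Definition endor of (forall (f g : {linear E -> E}) u, f (g u) = g (f u)) &
  (exists u : E, u <> 0) : Type := endo.
Local Notation R := (endor endoC E_neq0).
HB.instance Definition _ := GRing.Zmodule.on R.
Definition endo_mul (r s : R) : R := mk (app r \o app s).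
Definition endo_one : R := mk idfun.

Fact endo_mulA : associative endo_mul.
Proof. by move=> r s t; apply: app_inj => u; rewrite !mkE /= !mkE. Qed.
Fact endo_mulC : commutative endo_mul.
Proof. by move=> r s; apply: app_inj => u; rewrite !mkE /=; apply: endoC. Qed.
Fact endo_mul1 : left_id endo_one endo_mul.
Proof. by move=> r; apply: app_inj => u; rewrite !mkE /= mkE. Qed.
Fact endo_mulD : left_distributive endo_mul +%R.
Proof. by move=> r s t; apply: app_inj => u; rewrite mkE /= !appD !mkE. Qed.
Fact endo_one_neq0 : endo_one != 0.
Proof.
apply/eqP => e0; have [u] := E_neq0; apply.
by rewrite -[u]/(idfun u) -(mkE idfun) -/endo_one e0 app0.
Qed.
HB.instance Definition _ := GRing.Zmodule_isComNzRing.Build R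
  endo_mulA endo_mulC endo_mul1 endo_mulD endo_one_neq0.

Lemma appM (r s : R) u : app (r * s : R) u = app r (app s u). Proof. exact: mkE. Qed.
Lemma app1 u : app (1 : R) u = u. Proof. exact: mkE. Qed.

Definition scl (a : A) : R := a *: (endo_one : endo).
Lemma sclE a u : app (scl a) u = a *: u. Proof. by rewrite appZ mkE. Qed.
Lemma sclM a b : scl (a * b) = scl a * scl b.
Proof. by apply: app_inj => u; rewrite appM !sclE scalerA. Qed.
Lemma scl1 : scl 1 = 1. Proof. by apply: app_inj => u; rewrite sclE scale1r app1. Qed.
Lemma sclX a n : scl (a ^+ n) = scl a ^+ n.
Proof. by elim: n => [|n IHn]; rewrite ?scl1 // !exprS sclM IHn. Qed.

Section FrameModule.
Variables (V : lmodType A) (fr : frame E V).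
Definition fmod of frame E V : Type := V.
Local Notation VR := (fmod fr).
HB.instance Definition _ := GRing.Zmodule.on VR.
Definition fscale (r : R) (v : VR) : VR := \sum_a fin fr a (app r (fco fr a (v : V))).

Lemma fcoZ (r : R) (v : VR) a : fco fr a (fscale r v : V) = app r (fco fr a (v : V)).
Proof.
rewrite /fscale linear_sum (bigD1 a) //= fcoin eqxx big1 ?addr0 // => b ba.
by rewrite fcoin eq_sym (negbTE ba).
Qed.

Lemma fco_inj (u v : V) : (forall a, fco fr a u = fco fr a v) -> u = v.
Proof.
by move=> uv; rewrite [u](fsum fr) [v](fsum fr); apply: eq_bigr => a _; rewrite uv.
Qed.

Fact fscaleA r s v : fscale r (fscale s v) = fscale (r * s) v.
Proof. by apply: fco_inj => a; rewrite !fcoZ appM. Qed.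
Fact fscale1 : left_id 1 fscale.
Proof. by move=> v; apply: fco_inj => a; rewrite fcoZ app1. Qed.
Fact fscaleDr : right_distributive fscale +%R.
Proof.
move=> r u v; apply: fco_inj => a.
by rewrite fcoZ (linearD (fco fr a)) (linearD (fco fr a)) !fcoZ linearD.
Qed.
Fact fscaleDl v : {morph fscale^~ v : r s / r + s}.
Proof.
by move=> r s; apply: fco_inj => a; rewrite fcoZ (linearD (fco fr a)) !fcoZ appD.
Qed.
HB.instance Definition _ := GRing.Zmodule_isLmodule.Build R VR fscaleA fscale1 fscaleDr fscaleDl.
End FrameModule.
Arguments fscale {V} fr r v.
Arguments fco_inj {V} fr [u v].

(* This is where the commutativity of R is used. *)
Lemma fscale_natural (V W : lmodType A) (fV : frame E V) (fW : frame E W)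
  (f : {linear V -> W}) (r : R) v : f (fscale fV r v) = fscale fW r (f v).
Proof.
apply: (fco_inj fW) => a; rewrite fcoZ {2}[v](fsum fV) /fscale !linear_sum.
apply: eq_bigr => b _.
exact: (endoC (fco fW a \o f \o fin fV b) (app r)).
Qed.

Lemma fscale_scl (V : lmodType A) (fV : frame E V) a v : fscale fV (scl a) v = a *: v.
Proof. by apply: (fco_inj fV) => b; rewrite fcoZ sclE linearZ_LR. Qed.

Fact frame_linear (V W : lmodType A) (fV : frame E V) (fW : frame E W) (f : {linear V -> W}) :
  linear (f : fmod fV -> fmod fW).
Proof. by move=> r u v; rewrite (linearD f); congr (_ + _); apply: fscale_natural. Qed.

Arguments frame_linear {V W} fV fW f.

Section FrameComplex.
Variables (C : cpx A) (fr : forall n, frame E (ob C n)).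
Fact cpxR_df2 i (u : fmod (fr i)) :
  Lin (frame_linear (fr i.+1) (fr i.+2) df) (Lin (frame_linear (fr i) (fr i.+1) df) u) = 0.
Proof. by rewrite !LinE df2. Qed.
Definition cpxR : cpx R := @Cpx R (fun n => fmod (fr n))
  (fun n => Lin (frame_linear (fr n) (fr n.+1) df)) cpxR_df2.

Lemma cpxR_semilin n : semilin scl (fun u : ob C n => u : ob cpxR n) /\
  forall u : ob C n, (df u : ob cpxR n.+1) = df (u : ob cpxR n).
Proof.
split; last by move=> u; rewrite /= LinE.
split=> // [a u|v]; first by symmetry; apply: fscale_scl.
by exists v.
Qed.

Lemma cpxR_sim : sim scl C cpxR.
Proof. exact: ex_intro cpxR_semilin. Qed.
End FrameComplex.
End EndomorphismRing.
Arguments fscale {A E endoC E_neq0 V} fr r v.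
Arguments fco_inj {A E V} fr [u v].

(** * Determinantal identities *)

Section MatrixAlgebra.
Variable R : comNzRingType.

Definition mxpol n (c : seq R) (D : 'M[R]_n) : 'M[R]_n := \sum_(i < size c) c`_i *: D ^+ i.

Lemma mxpol_intertwine n k (D : 'M[R]_n) (S : 'M[R]_k) (P : 'M[R]_(n, k)) c :
  D *m P = P *m S -> mxpol c D *m P = P *m mxpol c S.
Proof.
move=> DP; rewrite /mxpol mulmx_suml mulmx_sumr; apply: eq_bigr => i _.
rewrite -scalemxAl -scalemxAr; congr (_ *: _).
elim: (val i) => [|k' IHk]; first by rewrite !expr0 mul1mx mulmx1.
by rewrite !exprS -!mulmxE mulmxA -DP -!mulmxA IHk.
Qed.

(* Cayley-Hamilton: the adjugate is a polynomial in the matrix. *)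
Lemma det_polynomial n (D : 'M[R]_n) : exists c : seq R,
  mxpol c D *m D = (\det D)%:M /\ D *m mxpol c D = (\det D)%:M.
Proof.
suff [c cE] : exists c, D *m mxpol c D = (\det D)%:M.
  by exists c; split=> //; rewrite (mxpol_intertwine (S := D)).
case: n D => [|n] D.
  by exists [::]; apply/matrixP => i; have := ltn_ord i; rewrite ltn0.
have := Cayley_Hamilton D; set p := char_poly D.
have pE : horner_mx D p = \sum_(i < size p) p`_i *: D ^+ i.
  rewrite -{1}[p]coefK poly_def rmorph_sum /=; apply: eq_bigr => i _.
  by rewrite linearZ /= rmorphXn /= horner_mx_X.
have : (0 < size p)%N by rewrite size_char_poly.
rewrite pE; case sp: (size p) => [|k] // _.
rewrite big_ord_recl char_poly_det expr0 => /eqP.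
rewrite addrC addr_eq0 => /eqP H.
exists [seq (- (-1) ^+ n.+1) * p`_(bump 0 i) | i <- iota 0 k].
rewrite /mxpol size_map size_iota mulmx_sumr.
transitivity ((- (-1) ^+ n.+1) *: \sum_(i < k) p`_(lift ord0 i) *: D ^+ lift ord0 i).
  rewrite scaler_sumr; apply: eq_bigr => i _.
  rewrite (nth_map 0%N) ?size_iota // nth_iota // add0n -scalemxAr scalerA.
  by rewrite /= /bump leq0n add1n [D ^+ _.+1]exprS.
apply: etrans (congr1 (fun X => (- (-1) ^+ n.+1) *: X) H) _.
rewrite scalerN scalerA mulNr scaleNr opprK mulrA -expr2 sqrr_sign mul1r.
exact: scalemx1.
Qed.

(* beta = phi tau has values in the image of phi, so c acts as det D modulo it. *)
Lemma matrix_relations n1 n2 n3 (phi : 'rV[R]_n1) (P : 'M[R]_(n1, n2)) (D3 : 'M[R]_(n2, n3))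
    (sg : 'M[R]_(n2, n1)) (tau : 'cV[R]_n1) (s2 : 'M[R]_(n3, n2)) (t2 : 'M[R]_(n2, n1))
    (D : 'M[R]_n1) (D2 : 'M[R]_n2) :
  D = P *m sg + tau *m phi -> D2 = D3 *m s2 + t2 *m P -> phi *m P = 0 -> P *m D3 = 0 ->
  exists c e delta, [/\ c *: phi = 0, c = \det D + e * (phi *m tau) 0 0, delta *: phi = 0 &
    c * \det D * (delta - \det D2 ^+ n1) = 0].
Proof.
move=> DE D2E pP PD3; pose beta := (phi *m tau) 0 0.
have betaE : phi *m tau = beta%:M by apply/matrixP => i j; rewrite !ord1 [RHS]mxE eqxx mulr1n.
pose M1 := D - beta%:M.
have pM1 : phi *m M1 = 0.
  rewrite mulmxBr DE mulmxDr !mulmxA pP mul0mx add0r betaE.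
  by rewrite mul_scalar_mx mul_mx_scalar subrr.
have cphi : \det M1 *: phi = 0.
  by rewrite -mul_mx_scalar -mul_mx_adj mulmxA pM1 mul0mx.
have [e eE] : exists e, \det M1 - \det D = e * beta.
  apply: (det_congruent (smod_principal beta)) => i j.
  rewrite !mxE; exists (- (i == j)%:R).
  by rewrite addrAC subrr sub0r -mulr_natr; ring.
have [q [qD Dq]] := det_polynomial D2; set b := \det D2 in qD Dq *; set Q := mxpol q D2 in qD Dq.
have QD3 : P *m Q *m D3 = 0.
  rewrite -mulmxA (mxpol_intertwine (S := s2 *m D3)) ?mulmxA ?PD3 ?mul0mx //.
  by rewrite D2E mulmxDl -!mulmxA PD3 mulmx0 addr0.
pose rho := b%:M - P *m Q *m t2.
have rhoP : rho *m P = 0.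
  have -> : rho *m P = b *: P - P *m Q *m (t2 *m P) by rewrite mulmxBl mul_scalar_mx !mulmxA.
  have -> : t2 *m P = D2 - D3 *m s2 by rewrite D2E addrC addKr.
  rewrite mulmxBr [P *m Q *m (D3 *m s2)]mulmxA QD3 mul0mx subr0 -mulmxA qD.
  by rewrite mul_mx_scalar subrr.
have erho : (\det M1 * \det D) *: rho = 0.
  rewrite mulrC -scalerA -mul_mx_scalar -mul_mx_adj mulmxA.
  suff -> : \det M1 *: rho *m D = 0 by rewrite mul0mx.
  rewrite -scalemxAl DE mulmxDr !mulmxA rhoP mul0mx add0r.
  by rewrite scalemxAr cphi mulmx0.
exists (\det M1), e, (\det (P *m Q *m t2)); split => //.
- by rewrite -/beta -eE addrCA subrr addr0.
- by rewrite -mul_mx_scalar -mul_mx_adj !mulmxA pP !mul0mx.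
have sK : smod (fun x : regm R => \det M1 * \det D * (x : R) = 0).
  split=> [|a u v u0 v0]; first by rewrite mulr0.
  by rewrite mulrDr v0 addr0 mulrCA u0 mulr0.
have := det_congruent (B := P *m Q *m t2) (C := b%:M) sK; rewrite det_scalar; apply=> i j.
have /matrixP/(_ i j) := erho; rewrite [RHS]mxE mxE => H.
apply/eqP; rewrite -oppr_eq0 -mulrN opprB; apply/eqP.
by move: H; rewrite [rho i j]mxE [X in _ + X]mxE.
Qed.

End MatrixAlgebra.

Section KoszulStrip.
Variable A : comNzRingType.

Lemma kos_kosC s t (C : cpx A) : chisoc (kos s (kos t C)) (kos t (kos s C)).
Proof.
elim: t => [|x t IHt] /=; first exact: chisoc_refl.
exact: chisoc_trans (kos_move s x (kos t C)) (chisoc_cone x IHt).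
Qed.

Definition locnil (x : A) (C : cpx A) := forall n (u : ob C n), exists k, x ^+ k *: u = 0.

Lemma locnil_kos x s (C : cpx A) : locnil x C -> locnil x (kos s C).
Proof.
move=> nx; apply: (kos_obj (Phi := fun V => forall v : V, exists k, x ^+ k *: v = 0)) => //.
split=> [v|U V nU nV [u v]]; first by exists 0%N; rewrite [v]zeroM0 scaler0.
have [k k0] := nU u; have [l l0] := nV v; exists (l + k)%N.
congr (_, _) => /=; first by rewrite exprD -scalerA k0 scaler0.
by rewrite addnC exprD -scalerA l0 scaler0.
Qed.

Lemma vanish_kos_strip s d (C : cpx A) : (forall x, x \in s -> locnil x C) ->
  vanish d (kos s C) -> vanish d C.
Proof.
elim: s => //= x s IHs ns vC; apply: IHs => [y ys|].
  by apply: ns; rewrite inE ys orbT.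
by apply: vanish_strip vC; apply: locnil_kos; apply: ns; rewrite mem_head.
Qed.

Lemma kill_span (s : seq A) (x : A) (C : cpx A) n : lspan (s : seq (regm A)) x -> kill (kos s C) n x.
Proof.
by apply: (span_sub (smod_kill (kos s C) n)) => y ys; apply: kill_kos_mem.
Qed.
End KoszulStrip.

Section IdentityFrame.
Variables (A : comNzRingType) (E : lmodType A).
Definition idco (a : 'I_1) : {linear E -> E} := idfun.
Fact idcoin a b u : idco a (idco b u) = if a == b then u else 0.
Proof. by rewrite [a]ord1 [b]ord1 eqxx. Qed.
Fact idsum v : v = \sum_a idco a (idco a v). Proof. by rewrite big_ord1. Qed.
Definition idframe : frame E E := Frame idcoin idsum.
End IdentityFrame.

Section FrameMatrices.
Variables (A : comNzRingType) (E : lmodType A).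
Hypothesis endoC : forall (f g : {linear E -> E}) u, f (g u) = g (f u).
Hypothesis E_neq0 : exists u : E, u <> 0.
Local Notation R := (endor endoC E_neq0).
Local Notation scl := (@scl A E endoC E_neq0).

Definition mxf (V W : lmodType A) (fV : frame E V) (fW : frame E W) (f : {linear V -> W}) :
  'M[R]_(fdim fW, fdim fV) := \matrix_(a, b) (mk (fco fW a \o f \o fin fV b) : R).

Lemma app_sum (I : Type) (r : seq I) (P : pred I) (F : I -> R) u :
  app (\sum_(i <- r | P i) F i : R) u = \sum_(i <- r | P i) app (F i) u.
Proof.
apply: (big_morph (fun r : R => app r u)) => [x y|]; [exact: appD|exact: app0].
Qed.

Lemma mxf_mul (U V W : lmodType A) (fU : frame E U) (fV : frame E V) (fW : frame E W)
  (g : {linear V -> W}) (f : {linear U -> V}) :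
  mxf fV fW g *m mxf fU fV f = mxf fU fW (g \o f).
Proof.
apply/matrixP => a c; rewrite !mxE; apply: app_inj => u; rewrite app_sum mkE /=.
rewrite [in RHS](fsum fV (f _)) !linear_sum; apply: eq_bigr => b _.
by rewrite !mxE appM !mkE.
Qed.

Lemma mxf0 (V W : lmodType A) (fV : frame E V) (fW : frame E W) (f : {linear V -> W}) :
  (forall v, f v = 0) -> mxf fV fW f = 0.
Proof.
move=> f0; apply/matrixP => a b; rewrite !mxE; apply: app_inj => u.
by rewrite mkE /= f0 linear0 app0.
Qed.

Lemma mxf_app (V W : lmodType A) (fV : frame E V) (fW : frame E W) (f : {linear V -> W}) v a :
  fco fW a (f v) = \sum_b app (mxf fV fW f a b) (fco fV b v).
Proof.
rewrite {1}[v](fsum fV) !linear_sum; apply: eq_bigr => b _.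
by rewrite mxE mkE.
Qed.

Lemma fscale_endo (fE : frame E E) (r : R) u : fscale (fE : frame E E) (r : R) u = app r u.
Proof.
have := @fscale_natural A E endoC E_neq0 E E fE (idframe E) idfun r u.
by rewrite /= => ->; rewrite /fscale big_ord1.
Qed.

Lemma appN (r : R) u : app (- r : R) u = - app r u.
Proof. by apply/eqP; rewrite -addr_eq0 -appD addNr app0. Qed.
Lemma appMn (r : R) n u : app (r *+ n : R) u = app r u *+ n.
Proof. by elim: n => [|n IHn]; rewrite ?mulr0n ?app0 // !mulrS appD IHn. Qed.

Lemma det_mod_ideal n (D : 'M[R]_n) (x : A) (K : regm R -> Prop) : smod K ->
  (forall i j, K (D i j - scl x *+ (i == j))) -> K (\det D - scl (x ^+ n)).
Proof.
move=> sK KD; rewrite sclX -det_scalar; apply: det_congruent => // i j.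
by rewrite mxE.
Qed.

Lemma homotopy_matrix (U V W : lmodType A) (fU : frame E U) (fV : frame E V) (fW : frame E W)
  (p : {linear U -> V}) (S : {linear V -> U}) (f : {linear V -> W}) (T : {linear W -> V})
  (s : seq A) (X : 'I_(size s) -> {linear V -> V}) (x : A) :
  (forall u, x *: u = p (S u) + T (f u) + \sum_(l < size s) s`_l *: X l u) ->
  lspan (map scl s : seq (regm R))
    (\det (mxf fU fV p *m mxf fV fU S + mxf fW fV T *m mxf fV fW f) - scl (x ^+ fdim fV)).
Proof.
move=> STE; apply: det_mod_ideal; first exact: smod_span.
move=> i j; rewrite !mxf_mul.
have -> : (mxf fV fV (p \o S) + mxf fV fV (T \o f)) i j - scl x *+ (i == j) =
   - \sum_(l < size s) (mk (fco fV i \o X l \o fin fV j) : R) * scl s`_l.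
  apply: (@app_inj A E) => u; rewrite !mxE appD appN appD !mkE appMn sclE appN app_sum.
  under eq_bigr => l _ do rewrite appM mkE sclE /= !linearZ_LR.
  set Y := \sum_(l < size s) _.
  have := congr1 (fco fV i) (STE (fin fV j u)).
  rewrite !(linearD (fco fV i)) linear_sum (linearZ_LR (fco fV i)) fcoin.
  under eq_bigr => l _ do rewrite (linearZ_LR (fco fV i)).
  rewrite -/Y /= => H.
  apply/eqP; rewrite -addr_eq0 addrAC -H subr_eq0; apply/eqP.
  by case: eqP => _; rewrite ?mulr1n ?mulr0n ?scaler0.
pose K := lspan (map scl s : seq (regm R)); have sK : smod K by exact: smod_span.
apply: (smodN sK); apply: (smod_sum (P := K)) => // l _.
apply: (smodZ (V := regm R) _ sK); apply: span_mem.
by apply: map_f; apply: mem_nth.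
Qed.

End FrameMatrices.

(** * The differential into the top module *)

Section Crux.
Variables (A : comNzRingType) (m : idealr A) (M : lmodType A) (d : nat).
Hypotheses (Anoeth : noetherian A) (Aloc : local_ring m) (Mfg : fgm M).
Local Notation J := (cpxJ m M).
Local Notation E := (ob J d).
Variable s0 : E.
Hypotheses (s0_soc : soc m s0) (s0_neq0 : s0 <> 0).
Hypothesis s0_gen : forall s, soc m s -> exists a : A, s = a *: s0.

Lemma J_tors n (u : ob J n) : tors m u. Proof. exact: tcpx_torsion. Qed.
Local Notation eC := (endoC Anoeth Aloc (@J_tors d) s0_soc s0_gen).
Lemma E_neq0 : exists u : E, u <> 0. Proof. by exists s0. Qed.
Local Notation R := (endor eC E_neq0).
Local Notation scl := (@scl A E eC E_neq0).

Lemma app_at (r : R) (u : E) : exists a : A,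
  forall v : E, (forall b : A, b *: u = 0 -> b *: v = 0) -> app r v = a *: v.
Proof. exact: (endo_at Anoeth Aloc (@J_tors d) s0_soc s0_gen (app r) u). Qed.

Lemma app_smod (K : E -> Prop) (r : R) u : smod K -> K u -> K (app r u).
Proof.
by move=> sK Ku; have [a aE] := app_at r u; rewrite (aE u) //; apply: smodZ.
Qed.

Lemma bd_dpre_core (c e delta gam beta b : R) n :
  (forall t : pre J d, app c (dpre t) = 0) -> (forall t : pre J d, app delta (dpre t) = 0) ->
  c = gam + e * beta -> (forall z, bd (app beta z)) -> c * gam * (delta - b ^+ n) = 0 ->
  (forall z : E, df z = 0 -> exists2 w : E, df w = 0 & bd (z - app (gam ^+ 2) w)) ->
  (forall z : E, df z = 0 -> bd (app (gam ^+ 2) z) ->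
     exists z' : E, [/\ df z' = 0, bd (app (gam ^+ 2) z') & bd (z - app b z')]) ->
  (exists2 z : E, df z = 0 & ~ bd z) -> forall t : pre J d, dpre t = 0.
Proof.
move=> cV dV cE bV rel V1 V2 [z1 z10 nz1] t; apply: contrapT => t0.
have sV : smod (@bd A J d) by exact: smod_bd.
have sZ : smod (fun z : E => df z = 0) by exact: smod_ker.
have Vs0 : bd s0.
  by apply: (sub_soc Anoeth Aloc (@J_tors d) s0_soc s0_gen sV _ t0); exists t.
have cgam z : bd (app c z - app gam z).
  rewrite cE appD appM addrAC subrr add0r; exact: (app_smod e sV (bV z)).
pose K u := exists2 z : E, df z = 0 & app (c * gam) z = u.
have sK : smod K by exact: (smod_img (app (c * gam : R)) sZ).
have [z z0 zE] : K s0.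
  have [z z0 zn] : exists2 z : E, df z = 0 & app (c * gam) z <> 0.
    apply: contrapT => H; apply: nz1; have [w w0 wz] := V1 z1 z10.
    rewrite -[z1](subrK (app (gam ^+ 2) w)); apply: (smodD sV) => //.
    have cg0 : app (c * gam) w = 0 by apply: contrapT => nw; apply: H; exists w.
    have := cgam (app gam w); rewrite -appM cg0 sub0r -appM -expr2 => /(smodN sV).
    by rewrite opprK.
  by apply: (sub_soc Anoeth Aloc (@J_tors d) s0_soc s0_gen sK _ zn); exists z.
have gz : bd (app (gam ^+ 2) z).
  have := cgam (app gam z); rewrite -!appM -expr2 zE => H.
  exact: (smodBr sV Vs0 H).
have [z' [z'0 gz' zz']] : exists z', [/\ df z' = 0, bd (app (gam ^+ 2) z') & bd (z - app (b ^+ n) z')].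
  elim: n {rel} => [|n [z' [z'0 gz' zz']]].
    by exists z; split=> //; rewrite expr0 app1 subrr; apply: smod0 sV.
  have [z2 [z20 gz2 zz2]] := V2 z' z'0 gz'; exists z2; split=> //.
  rewrite exprSr appM.
  have -> : z - app (b ^+ n) (app b z2) = (z - app (b ^+ n) z') + app (b ^+ n) (z' - app b z2).
    by rewrite linearB addrA subrK.
  by apply: (smodD sV) => //; apply: app_smod.
apply: s0_neq0; rewrite -zE.
have [v vE] := zz'.
have -> : app (c * gam) z = app (c * gam) (app (b ^+ n) z').
  apply/eqP; rewrite -subr_eq0 -linearB -vE mulrC appM cV linear0; exact: eqxx.
rewrite -appM.
have -> : c * gam * b ^+ n = delta * (c * gam).
  apply/eqP; rewrite -subr_eq0 -oppr_eq0 opprB [delta * _]mulrC -mulrBr; exact/eqP.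
have [w wE] : bd (app (c * gam) z').
  have H := cgam (app gam z'); rewrite -!appM -expr2 in H.
  exact: (smodBl sV gz' H).
by rewrite appM -wE dV.
Qed.

Variable fr : forall n, frame E (ob J n).
Local Notation JR := (cpxR eC E_neq0 fr).

Lemma JR_scale (r : R) (u : ob JR d) : r *: u = app r (u : E).
Proof. exact: fscale_endo. Qed.
Lemma JR_df n (u : ob J n) : (df (u : ob JR n) : ob JR n.+1) = df u.
Proof. by have [_ ->] := cpxR_semilin eC E_neq0 fr n. Qed.
Lemma JR_bd n (u : ob J n) : bd (u : ob JR n) <-> bd u.
Proof.
symmetry; exact: (sim_bd (C := J) (D := JR) (h := fun n u => u) u
  (cpxR_semilin eC E_neq0 fr)).
Qed.

Lemma vanish_JR s : (forall n, tors_at m (kos s (cpxI M)) n) -> size s = d ->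
  vanish d (kos (map scl s) JR).
Proof.
move=> ts sd n dn; apply: (sim_exact (sim_kos s (cpxR_sim eC E_neq0 fr))).
by apply: kosJ_vanish => //; rewrite sd.
Qed.

Lemma vanish_replace (x g : R) (t : seq R) : lspan (t : seq (regm R)) (g - x) ->
  vanish d (cone x (kos t JR)) -> vanish d (cone g (kos t JR)).
Proof.
move=> tx; apply: vanish_congr => n; apply: kill_span; rewrite -opprB.
exact: smodN (smod_span _) tx.
Qed.

Lemma locnil_JR (r : R) : app r s0 = 0 -> locnil r JR.
Proof.
move=> rs0 n u; have [->|/eqP u0] := eqVneq u 0; first by exists 0%N; rewrite scaler0.
have [||a aE] := endo_scalar Anoeth Aloc s0_soc s0_gen (app r)
   (I := fun b : regm A => (b : A) *: (u : ob J n) = 0).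
- exact: (smod_ann (u : ob J n) (smod_eq0 _)).
- move=> a y ym; have [k k0] := J_tors (u : ob J n) ym; exists k.
  by rewrite regmE mulrC -scalerA k0 scaler0.
have ra i : app r (fco (fr n) i (u : ob J n)) = a *: fco (fr n) i (u : ob J n).
  by apply: aE => b bu; rewrite -linearZ_LR bu linear0.
have [i ui] : exists i, fco (fr n) i (u : ob J n) <> 0.
  apply: contrapT => H; apply: u0; apply: (fco_inj (fr n)) => i; rewrite linear0.
  by apply: contrapT => ui; apply: H; exists i.
have am : a \in m.
  apply: contrapT => /negP/(local_unit Anoeth Aloc)[b ab]; apply: s0_neq0.
  have [c cE] := sub_soc Anoeth Aloc (@J_tors d) s0_soc s0_gen
     (smod_line (fco (fr n) i (u : ob J n))) (ex_intro _ 1 (esym (scale1r _))) ui.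
  have as0 : a *: s0 = 0 by rewrite cE scalerA mulrC -scalerA -ra -linearZ_LR -cE rs0.
  by rewrite -[s0]scale1r -ab mulrC -scalerA as0 scaler0.
have ru k : r ^+ k *: u = (a ^+ k *: (u : ob J n)) :> ob J n.
  elim: k => [|k IHk]; first by rewrite !scale1r.
  rewrite exprS -scalerA IHk; apply: (fco_inj (fr n)) => i'.
  rewrite -[r *: _]/(fscale (fr n) r _) fcoZ !linearZ_LR ra.
  by rewrite scalerA -exprSr.
by have [k k0] := J_tors (u : ob J n) am; exists k; rewrite ru.
Qed.

Lemma surjective_mod_bd (g : R) : vanish d (cone g JR) ->
  forall z : E, df z = 0 -> exists2 w : E, df w = 0 & bd (z - app g w).
Proof.
move=> vg z z0; have /vg : df ((0, z) : ob (cone g JR) d.+1) = 0.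
  by apply/cy_cone; rewrite /= linear0 scaler0; split=> //; rewrite JR_df z0.
move=> /(_ (ltnSn d))/bd_cone[w /= w0 wb]; exists (w : E).
  by have := w0; rewrite JR_df.
by apply/JR_bd; have := wb; rewrite JR_scale.
Qed.

Lemma surjective_on_annihilator (b g : R) : vanish d (cone b (cone g JR)) ->
  forall z : E, df z = 0 -> bd (app g z) ->
     exists z' : E, [/\ df z' = 0, bd (app g z') & bd (z - app b z')].
Proof.
move=> vbg z z0 /JR_bd[t tE].
have zt : df ((z, t) : ob (cone g JR) d) = 0.
  by apply/cy_cone => /=; split; [rewrite JR_df|rewrite tE JR_scale].
have /vbg : df ((0, ((z, t) : ob (cone g JR) d)) : ob (cone b (cone g JR)) d.+1) = 0.
  apply/cy_cone; split; first by rewrite /= linear0.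
  by rewrite /= scaler0; symmetry; exact: zt.
move=> /(_ (ltnSn d))/bd_cone[p p0 pb].
have /cy_cone[p10 gp] : df (p : ob (cone g JR) d) = 0 by exact: p0.
have /bd_cone[w wE _] : bd (((z, t) : ob (cone g JR) d) - b *: (p : ob (cone g JR) d)) by exact: pb.
exists ((p : ob (cone g JR) d).1 : E); split; first by have := p10; rewrite JR_df.
  by apply/JR_bd; exists (p : ob (cone g JR) d).2; rewrite -gp JR_scale.
by apply/JR_bd; exists w; rewrite wE /= JR_scale.
Qed.
End Crux.

Section Determinant.
Variables (A : comNzRingType) (E : lmodType A).
Hypothesis endoC : forall (f g : {linear E -> E}) u, f (g u) = g (f u).
Hypothesis E_neq0 : exists u : E, u <> 0.
Local Notation R := (endor endoC E_neq0).
Local Notation mxf := (mxf endoC E_neq0).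

Lemma mxfD (V W : lmodType A) (fV : frame E V) (fW : frame E W) (f g : {linear V -> W}) :
  mxf fV fW (f \+ g) = mxf fV fW f + mxf fV fW g.
Proof.
apply/matrixP => a b; rewrite !mxE; apply: app_inj => u.
by rewrite appD !mkE /= linearD.
Qed.

Variables (V : lmodType A) (fV : frame E V).

Lemma mxf_iter (f : {linear V -> V}) i v a :
  fco fV a (iter i f v) = \sum_b app ((mxf fV fV f ^+ i) a b : R) (fco fV b v).
Proof.
elim: i a => [|i IHi] a /=.
  rewrite (bigD1 a) //= expr0 mxE eqxx mulr1n app1 big1 ?addr0 // => b.
  by rewrite mxE eq_sym => /negbTE ->; rewrite mulr0n app0.
rewrite (mxf_app endoC E_neq0 fV) exprS -mulmxE.
transitivity (\sum_b \sum_c app (mxf fV fV f a b : R) (app ((mxf fV fV f ^+ i) b c : R) (fco fV c v))).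
  by apply: eq_bigr => b _; rewrite IHi linear_sum.
rewrite exchange_big; apply: eq_bigr => c _ /=; rewrite mxE app_sum.
by apply: eq_bigr => b _; rewrite appM.
Qed.

Lemma det_stable (K : fmod fV -> Prop) (f : {linear V -> V}) u : @smod R (fmod fV) K ->
  (forall v, K v -> K (f v)) -> K (f u) -> K (fscale fV (\det (mxf fV fV f)) u).
Proof.
move=> sK fK fu; have [c [cD _]] := det_polynomial (mxf fV fV f).
have -> : fscale fV (\det (mxf fV fV f)) u =
   \sum_(i < size c) fscale fV c`_i (iter i f (f u)).
  apply: (fco_inj fV) => a; rewrite fcoZ linear_sum.
  transitivity (\sum_b app (((\det (mxf fV fV f))%:M : 'M[R]_(fdim fV)) a b) (fco fV b u)).
    rewrite (bigD1 a) //= mxE eqxx mulr1n big1 ?addr0 // => b.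
    by rewrite mxE eq_sym => /negbTE ->; rewrite mulr0n app0.
  rewrite -cD /mxpol mulmx_suml.
  under eq_bigr => b _ do rewrite summxE app_sum.
  rewrite exchange_big; apply: eq_bigr => i _ /=; rewrite fcoZ -iterSr mxf_iter linear_sum.
  apply: eq_bigr => b _; rewrite exprSr -mulmxE -scalemxAl [X in app X]mxE; exact: appM.
apply: (@smod_sum R (fmod fV) K _ _ _ _ sK) => i _; apply: (@smodZ R (fmod fV) K _ _ sK).
by elim: (val i) => //= k; apply: fK.
Qed.
End Determinant.

Section Nonvanishing.
Variables (A : comNzRingType) (m : idealr A) (M : lmodType A) (d : nat).
Hypotheses (Anoeth : noetherian A) (Aloc : local_ring m) (Mfg : fgm M).
Local Notation J := (cpxJ m M).
Local Notation E := (ob J d).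
Variable s0 : E.
Hypotheses (s0_soc : soc m s0) (s0_neq0 : s0 <> 0).
Hypothesis s0_gen : forall s, soc m s -> exists a : A, s = a *: s0.
Local Notation eC := (endoC Anoeth Aloc (@J_tors A m M d) s0_soc s0_gen).
Local Notation E0 := (E_neq0 s0_neq0).
Local Notation R := (endor eC E0).
Local Notation scl := (@scl A E eC E0).
Local Notation mxf := (mxf eC E0).
Variable fr : forall n, frame E (ob J n).
Local Notation JR := (cpxR eC E0 fr).

Lemma dpre_zero_matrices (fj : frame E (pre J d)) n2 n3 (P : 'M[R]_(fdim fj, n2)) (D3 : 'M[R]_(n2, n3))
   (sg : 'M[R]_(n2, fdim fj)) (T : {linear E -> pre J d}) (s2 : 'M[R]_(n3, n2))
   (t2 : 'M[R]_(n2, fdim fj)) (D : 'M[R]_(fdim fj)) (D2 : 'M[R]_n2) :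
  D = P *m sg + mxf (idframe E) fj T *m mxf fj (idframe E) dpre ->
  D2 = D3 *m s2 + t2 *m P -> mxf fj (idframe E) dpre *m P = 0 -> P *m D3 = 0 ->
  (forall z : E, df z = 0 -> exists2 w : E, df w = 0 & bd (z - app (\det D ^+ 2) w)) ->
  (forall z : E, df z = 0 -> bd (app (\det D ^+ 2) z) ->
     exists z' : E, [/\ df z' = 0, bd (app (\det D ^+ 2) z') & bd (z - app (\det D2) z')]) ->
  (exists2 z : E, df z = 0 & ~ bd z) -> forall t : pre J d, dpre t = 0.
Proof.
move=> DE D2E pP PD V1 V2 nv.
have [c [e [delta [c0 cE dl0 rel]]]] := matrix_relations DE D2E pP PD.
have kil (r : R) : r *: mxf fj (idframe E) dpre = 0 -> forall t : pre J d, app r (dpre t) = 0.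
  move=> r0 t; rewrite -[dpre t]/(fco (idframe E) ord0 (dpre t)) (mxf_app eC E0 fj (fW := idframe E)).
  rewrite linear_sum big1 // => b _; have /matrixP/(_ ord0 b) := r0.
  by rewrite -appM [in LHS]mxE [RHS]mxE => ->; rewrite app0.
apply: (bd_dpre_core (kil c c0) (kil delta dl0) cE _ rel V1 V2 nv) => z.
exists (T z); have /matrixP/(_ ord0 ord0) H := mxf_mul eC E0 (idframe E) fj (idframe E) dpre T.
by symmetry; apply: (etrans (congr1 (fun r : R => app r z) H)); rewrite mxE mkE.
Qed.

Variables (y : A) (s' : seq A).
Hypotheses (sd : (size s').+1 = d) (ym : y \in m) (s'm : forall x, x \in s' -> x \in m).
Hypothesis fs' : filter_regular m M s'.
Hypothesis ts : forall M', forall n, tors_at m (kos (y ^+ M' :: s') (cpxI M)) n.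

Definition prefr n : frame E (pre J n) :=
  match n with
  | 0 => projT1 (cid (zero_frame E (@zeroM0 A)))
  | k.+1 => fr k
  end.

Lemma JR_bd_smod n : smod (fun u : ob JR n => bd u). Proof. exact: smod_bd. Qed.

Lemma kill_below q : (q <= d)%N -> exists (c : R) L, lspan (map scl s' : seq (regm R)) (c - scl (y ^+ L)) /\
  forall n, (n < q)%N -> kill JR n c.
Proof.
elim: q => [|q IHq] qd.
  by exists (scl 1), 0%N; rewrite expr0 subrr; split=> //; apply: smod0 (smod_span _).
have [c [L [cL kc]]] := IHq (ltnW qd).
have [|N N0 [S [T [X STE]]]] := cpxJ_homotopy (q := q) Anoeth Mfg fs' ym.
  by rewrite -ltnS sd.
have := homotopy_matrix eC E0 (prefr q) (fr q) (fr q.+1) STE.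
rewrite !mxf_mul -mxfD; set D := mxf _ _ _; set D' := \det D => DL.
have sK := smod_span (map scl s' : seq (regm R)).
exists (D' * c), (N * fdim (fr q) + L)%N; split.
  rewrite exprD exprM sclM.
  have -> : D' * c - scl ((y ^+ N) ^+ fdim (fr q)) * scl (y ^+ L) =
     D' *: (c - scl (y ^+ L) : regm R) + scl (y ^+ L) *: (D' - scl ((y ^+ N) ^+ fdim (fr q)) : regm R).
    by rewrite !regmE; ring.
  by apply: (smodD sK); apply: smodZ.
move=> n; rewrite ltnS leq_eqVlt => /orP[/eqP ->|nq]; last first.
  by apply: (smodZ (V := regm R) _ (smod_kill _ _)); apply: kc.
rewrite mulrC; apply: (smodZ (V := regm R) _ (smod_kill JR q)).
move=> u u0; have sB := @JR_bd_smod q.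
have u0' : df (u : ob J q) = 0 by have := u0; rewrite JR_df.
pose f : {linear ob J q -> ob J q} := (dpre \o S) \+ (T \o df).
have fE v : f v = dpre (S v) + T (df v) by [].
apply: (det_stable (f := f) (K := fun v => bd (v : ob JR q)) sB).
  move=> v /JR_bd[w wv]; apply/JR_bd; exists (S v).
  by rewrite fE -wv df_dpre linear0 addr0.
by apply/JR_bd; exists (S (u : ob J q)); rewrite fE u0' linear0 addr0.
Qed.

Lemma JR_vanish : vanish d JR.
Proof.
apply: (vanish_kos_strip (s := map scl (y :: s'))); last first.
  by apply: vanish_JR => // n; have := @ts 1 n; rewrite expr1.
move=> _ /mapP[x xs ->]; apply: locnil_JR; rewrite sclE; apply: s0_soc.
by move: xs; rewrite inE => /orP[/eqP ->|/s'm].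
Qed.

Lemma expr_congr (K : regm R -> Prop) (c x : R) k : smod K -> K (c - x) -> K (c ^+ k - x ^+ k).
Proof. by move=> sK cx; rewrite subrXX mulrC; apply: (smodZ (V := regm R)). Qed.

Lemma kosJ_killed : (forall z : E, df z = 0 -> bd z) ->
  exists K, forall M' n, kill (kos (y ^+ M' :: s') J) n (y ^+ K).
Proof.
move=> H; have [c [L [cL kc]]] := kill_below (leqnn d).
have kcn n : kill JR n c.
  have [nd|dn|->] := ltngtP n d; first exact: kc.
    by move=> u u0; apply: JR_vanish => //; rewrite linearZ_LR u0 scaler0.
  move=> u u0; apply: (smodZ _ (smod_bd _ _)); apply/JR_bd/H.
  by have := u0; rewrite JR_df.
exists (L * 2 ^ d)%N => M' n.
apply: (sim_kill (sim_kos (y ^+ M' :: s') (cpxR_sim eC E0 fr))).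
have := kill_kos (s := map scl (y ^+ M' :: s')) kcn (n := n).
rewrite size_map [size _]/= sd exprM sclX => kk.
have -> : scl (y ^+ L) ^+ (2 ^ d) = c ^+ (2 ^ d) - (c ^+ (2 ^ d) - scl (y ^+ L) ^+ (2 ^ d)).
  by rewrite subKr.
apply: (smodB (smod_kill _ _)) => //; apply: kill_span.
have := expr_congr (2 ^ d) (smod_span (map scl s' : seq (regm R))) cL.
apply: span_sub; first exact: smod_span.
by move=> x xs; apply: span_mem; rewrite /= inE xs orbT.
Qed.

Lemma top_killed K : (forall M' n, kill (kos (y ^+ M' :: s') J) n (y ^+ K)) ->
  forall M' v, smul (y ^+ M' :: s') (y ^+ K *: (v : M)).
Proof.
move=> kK M' v; set t := y ^+ M' :: s'.
have [tt [tt0 ttE _]] := kosI_top M t.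
have S := ses_kos t (tq_ses m (cpxI M)).
have [|||w w0 wE] := torsion_class_lift S (@kosQ_torsionfree A m M t) (@kosQ_injective A m M Anoeth t) (u := tt v).
- move=> k _; exact: (quotient_exact S (@kosJ_torsion A m M t) (@kosQ_torsionfree A m M t)
    (@kosQ_injective A m M Anoeth t) (fun n _ => @ts M' n) (ltnSn k)).
- exact: tt0.
- exact: ts.
apply/ttE; rewrite linearZ_LR.
have -> : y ^+ K *: tt v = y ^+ K *: (tt v - kos_hom t (tinc m (cpxI M)) _ w) +
   kos_hom t (tinc m (cpxI M)) _ (y ^+ K *: w) by rewrite linearZ_LR; lincomb.
apply: (smodD (smod_bd _ _)); first exact: (smodZ _ (smod_bd _ _)).
by apply: hom_bd; apply: kK.
Qed.

Hypothesis not_tors : ~ forall v : M, torm m (smul s') v.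
Hypothesis tors_full : forall v : M, torm m (smul (y :: s')) v.

Lemma nonvanishing : exists2 z : E, df z = 0 & ~ bd z.
Proof.
apply: contrapT => H; apply: not_tors.
have [|K kK] := kosJ_killed.
  by move=> z z0; apply: contrapT => nz; apply: H; exists z.
have tK := top_killed kK; have ss := @smod_smul A M s'.
have yK (v : M) : smul s' (y ^+ K *: v).
  have [u uT] := Mfg; pose l := map (fun v => y ^+ K *: v) u.
  have lu (v' : M) : lspan u v' -> lspan l (y ^+ K *: v').
    rewrite /l; elim: (u) v' => [|x u' IHu] v' /=; first by move=> ->; rewrite scaler0.
    by move=> [a /IHu h]; exists a; have -> : y ^+ K *: v' - a *: (y ^+ K *: x) =
      y ^+ K *: (v' - a *: x) by lincomb.
  apply: (@nakayama A m Anoeth Aloc M (smul s') l ss _ _ (lu v (uT v))) => i.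
  have iu : (i < size u)%N by rewrite -(size_map (fun v => y ^+ K *: v) u).
  have [w wE] := tK K.+1 u`_i.
  have /lu/span_ord[c cE] := uT w.
  exists (fun j => y * c j) => [j|].
    by rewrite mulrC; exact: (smodZ (V := regm A) _ (smod_idealr m) ym).
  rewrite (nth_map 0) //; under eq_bigr => j _ do rewrite -scalerA.
  by rewrite -scaler_sumr -cE scalerA -exprS.
move=> v y' y'm; have H' j : forall v : M, exists k w, smul s' (y' ^+ k *: v - y ^+ j *: w).
  elim: j => [|j IHj] w.
    by exists 0%N, w; rewrite subrr; apply: smod0 ss.
  have [k [w1 w1E]] := IHj w; have [l [w2 w2E]] := tors_full w1 y'm.
  exists (l + k)%N, w2; rewrite exprD -scalerA.
  have -> : y' ^+ l *: (y' ^+ k *: w) - y ^+ j.+1 *: w2 =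
     y' ^+ l *: (y' ^+ k *: w - y ^+ j *: w1) + y ^+ j *: (y' ^+ l *: w1 - y *: w2).
    by rewrite exprSr; lincomb.
  by apply: (smodD ss); apply: (smodZ _ ss).
have [k [w wE]] := H' K v; exists k; exact: (smodBl ss (yK w) wE).
Qed.
End Nonvanishing.

Definition parameters (A : comNzRingType) (m : idealr A) (M : lmodType A) d (s : seq A) :=
  [/\ size s = d, forall y, y \in s -> y \in m, forall i, filter_regular m M (drop i s),
     forall v : M, torm m (smul s) v &
     forall s' : seq A, (size s' < d)%N -> (forall y, y \in s' -> y \in m) ->
       ~ forall v : M, torm m (smul s') v].

Definition socle_generator (A : comNzRingType) (m : idealr A) (E : lmodType A) (s0 : E) :=
  [/\ soc m s0, s0 <> 0 & forall s, soc m s -> exists a : A, s = a *: s0].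

Section MiddleDifferential.
Variables (A : comNzRingType) (m : idealr A) (M : lmodType A).
Hypotheses (Anoeth : noetherian A) (Aloc : local_ring m) (Mfg : fgm M) (Mfaithful : faithful M).
Local Notation J := (cpxJ m M).

Lemma frames_exist d (s0 : ob J d) : socle_generator m s0 ->
  exists fr : forall n, frame (ob J d) (ob J n), True.
Proof.
move=> [ss s00 sg]; have H n : exists fr : frame (ob J d) (ob J n), True.
  have [t [ts tE]] := socJ_finite Anoeth Aloc Mfg n.
  have [fr _] := frame_exists Anoeth Aloc (@cpxJ_injective A m M Anoeth d) (@J_tors A m M d)
    ss s00 sg erefl (@cpxJ_injective A m M Anoeth n) (@J_tors A m M n) ts tE.
  by exists fr.
by exists (fun n => projT1 (cid (H n))).
Qed.

Lemma parameters_tors d s s' : parameters m M d s -> powers s s' ->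
  forall n, tors_at m (kos s' (cpxI M)) n.
Proof.
move=> [_ _ fs ts _] ss' n; apply: tors_kos_powers ss' _; apply: filter_regular_full => //.
by have := fs 0%N; rewrite drop0.
Qed.

Lemma parameters_nonvanishing d s (s0 : ob J d) : parameters m M d s -> socle_generator m s0 ->
  exists2 z : ob J d, df z = 0 & ~ bd z.
Proof.
move=> ps sg; have [fr _] := frames_exist sg; have [ss s00 sg'] := sg.
have [sd sm fs ts nts] := ps; case: s sd sm fs ts ps => [|y s'] sd sm fs ts ps.
  subst d; apply: contrapT => H.
  suff /eqP : (1 : A) = 0 by rewrite oner_eq0.
  apply: Mfaithful => v.
  have [w wE] := pval_ex (smod_tors m (mres M 0)) (tors_lin (min_in M 0) (ts v)).
  have dw : df (w : ob J 0%N) = 0.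
    apply: (pval_inj (smod_tors m (mres M 1))); rewrite linear0 [LHS]tor_dfE wE.
    by apply/mdif_eq0; exists v.
  have [u uE] : bd (w : ob J 0%N) by apply: contrapT => nb; apply: H; exists w.
  have v0 : v = 0.
    have w0 : w = 0 by rewrite -uE [u]zeroM0; exact: linear0.
    by apply: (@min_in_inj A M 0); rewrite -wE w0 !linear0.
  by rewrite v0 scaler0.
apply: (@nonvanishing A m M d Anoeth Aloc Mfg s0 ss s00 sg' fr y s') => //.
- by apply: sm; rewrite mem_head.
- by move=> x xs; apply: sm; rewrite inE xs orbT.
- by have := fs 1%N; rewrite -[drop _ _]/(drop 0 _) drop0.
- move=> M' n; apply: parameters_tors ps _ n; split; last exact: powers_refl.
  by exists M'.
- by apply: nts; [rewrite -sd|move=> x xs; apply: sm; rewrite inE xs orbT].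
Qed.

Lemma dpre_zero0 (t : pre J 0) : dpre t = 0.
Proof. by rewrite [t]zeroM0 linear0. Qed.

Lemma dpre_zero1 s (s0 : ob J 1) : parameters m M 1 s -> socle_generator m s0 ->
  forall t : pre J 1, dpre t = 0.
Proof.
move=> ps sg; have [fr _] := frames_exist sg; have [ss s00 sg'] := sg.
have nv := parameters_nonvanishing ps sg.
have [sd sm fs ts nts] := ps; case: s sd sm fs ts ps => [|y []] // sd sm fs ts ps.
have ym : y \in m by apply: sm; rewrite mem_head.
have [|N N0 [S [T [X STE]]]] := cpxJ_homotopy (s := [::]) (q := 0) Anoeth Mfg (fs 1%N) ym => //.
set eC := endoC Anoeth Aloc (@J_tors A m M 1) ss sg'; set E0 := E_neq0 s00.
have DL := homotopy_matrix eC E0 (prefr fr 0) (fr 0) (idframe _) STE.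
set D := (X in \det X) in DL.
apply: (@dpre_zero_matrices A m M 1 Anoeth Aloc s0 ss s00 sg' (fr 0) 0 0 0 0 0 T 0 0 D 0).
- rewrite mul0mx add0r /D [X in X + _](_ : _ = 0) ?add0r //.
  rewrite mxf_mul; apply: mxf0 => v; exact: dpre_zero0.
- by apply/matrixP => i; have := ltn_ord i; rewrite ltn0.
- by rewrite mulmx0.
- by rewrite mulmx0.
- apply: (surjective_mod_bd (fr := fr)).
  apply: (vanish_replace (fr := fr) (t := [::]) (x := scl eC E0 (((y ^+ N) ^+ fdim (fr 0)) ^+ 2))).
    by rewrite sclX; apply: expr_congr; [exact: smod_span|exact: DL].
  apply: (@vanish_JR A m M 1 Anoeth Aloc s0 ss s00 sg' fr [:: _]) => // n.
  apply: parameters_tors ps _ n; split=> //.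
  by exists ((N * fdim (fr 0)) * 2)%N; rewrite !exprM.
- move=> z z0 zb; exists z; split=> //; rewrite det_mx00 app1 subrr.
  by apply: smod0; apply: smod_bd.
exact: nv.
Qed.

Lemma dpre_zeroSS i s (s0 : ob J i.+2) : parameters m M i.+2 s -> socle_generator m s0 ->
  forall t : pre J i.+2, dpre t = 0.
Proof.
move=> ps sg; have [fr _] := frames_exist sg; have [ss s00 sg'] := sg.
have nv := parameters_nonvanishing ps sg.
have [sd sm fs ts nts] := ps; case: s sd sm fs ts ps => [|y [|z r]] // [rd] sm fs ts ps.
have ym : y \in m by apply: sm; rewrite mem_head.
have zm : z \in m by apply: sm; rewrite !inE eqxx orbT.
have rm x : x \in r -> x \in m by move=> xr; apply: sm; rewrite !inE xr !orbT.
have fr2 : filter_regular m M r by have := fs 2%N; rewrite -[drop _ _]/(drop 0 r) drop0.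
have fr1 : filter_regular m M (z :: r) by exact: (fs 1%N).
set eC := endoC Anoeth Aloc (@J_tors A m M i.+2) ss sg'; set E0 := E_neq0 s00.
pose R := endor eC E0.
have [|N2 N20 [S2 [T2 [X2 STE2]]]] := cpxJ_homotopy (q := i) Anoeth Mfg fr2 zm.
  by rewrite rd.
have DL2 := homotopy_matrix eC E0 (prefr fr i) (fr i) (fr i.+1) STE2.
set D2 := (X in \det X) in DL2.
pose K := (N2 * fdim (fr i)).+1.
have fK : filter_regular m M (z ^+ K :: r).
  by apply: filter_regular_powers fr1; split; [exists K|exact: powers_refl].
have [|N N0 [S [T [X STE]]]] := cpxJ_homotopy (q := i.+1) Anoeth Mfg fK ym.
  by rewrite /= rd.
have DL := homotopy_matrix eC E0 (fr i) (fr i.+1) (idframe _) STE.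
set D := (X in \det X) in DL.
have dd n (u : pre J n) : df (dpre u) = 0 by apply: df_dpre.
have b1r : lspan (map (scl eC E0) r : seq (regm R)) (\det D2 * scl eC E0 z - scl eC E0 (z ^+ K)).
  rewrite /K exprSr sclM -mulrBl mulrC exprM.
  by apply: (@smodZ R (regm R)) DL2; exact: smod_span.
have sp := @smod_span R (regm R).
have vgb : vanish i.+2 (kos [:: \det D2 * scl eC E0 z; \det D ^+ 2] (cpxR eC E0 fr)).
  apply: (vanish_kos_strip (s := map (scl eC E0) r)).
    move=> _ /mapP[x xr ->]; apply: locnil_kos; apply: locnil_JR; rewrite sclE.
    exact: (ss _ (rm x xr)).
  apply: (chisoc_vanish (kos_kosC _ _ _)); rewrite -kos_cat /=.
  apply: (vanish_replace (fr := fr) (t := _ :: _) (x := scl eC E0 (z ^+ K))).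
    apply: span_sub b1r => [|x xr]; first exact: sp.
    by apply: span_mem; rewrite inE xr orbT.
  apply: (chisoc_vanish (cone_swap _ _ _)).
  apply: (vanish_replace (fr := fr) (t := _ :: _) (x := scl eC E0 (((y ^+ N) ^+ fdim (fr i.+1)) ^+ 2))).
    by have := expr_congr 2 (sp _) DL; rewrite -sclX; apply.
  apply: (@vanish_JR A m M i.+2 Anoeth Aloc s0 ss s00 sg' fr [:: _, _ & _]) => [n|]; last by rewrite /= rd.
  apply: parameters_tors ps _ n; split; last by split; [exists K|exact: powers_refl].
  by exists ((N * fdim (fr i.+1)) * 2)%N; rewrite !exprM.
have nb1 : app (\det D2 * scl eC E0 z : R) s0 = 0.
  by rewrite appM sclE ss // linear0.
apply: (@dpre_zero_matrices A m M i.+2 Anoeth Aloc s0 ss s00 sg' (fr i.+1) _ _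
  (mxf eC E0 (fr i) (fr i.+1) df) (mxf eC E0 (prefr fr i) (fr i) dpre)
  (mxf eC E0 (fr i.+1) (fr i) S) T (mxf eC E0 (fr i) (prefr fr i) S2) (mxf eC E0 (fr i.+1) (fr i) T2) D D2).
- by [].
- by [].
- by rewrite mxf_mul; apply: mxf0 => v; apply: df2.
- by rewrite mxf_mul; apply: mxf0 => v; apply: dd.
- apply: (surjective_mod_bd (fr := fr)).
  apply: (vanish_kos_strip (s := [:: \det D2 * scl eC E0 z])); last exact: vgb.
  by move=> x; rewrite inE => /eqP ->; apply: (locnil_kos (s := [:: _])); apply: locnil_JR.
- move=> w w0 gw; have [w' [w'0 gw' ww']] := surjective_on_annihilator vgb w0 gw.
  exists (z *: w'); split; first by rewrite linearZ_LR w'0 scaler0.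
    rewrite linearZ_LR; apply: smodZ gw'; exact: smod_bd.
  by have := ww'; rewrite appM sclE.
exact: nv.
Qed.

Theorem dpre_zero d s (s0 : ob J d) : parameters m M d s -> socle_generator m s0 ->
  forall t : pre J d, dpre t = 0.
Proof.
case: d s0 => [|[|i]] s0 ps sg t; first exact: dpre_zero0.
  exact: dpre_zero1 ps sg t.
exact: dpre_zeroSS ps sg t.
Qed.
End MiddleDifferential.

(** * Vanishing outside the top degree *)

Section Powers.
Variable A : comNzRingType.
Lemma powers_cat (s1 s2 t1 t2 : seq A) : powers s1 t1 -> powers s2 t2 -> powers (s1 ++ s2) (t1 ++ t2).
Proof. by elim: s1 t1 => [|x s1 IHs] [|y t1] //= [H /IHs K] /K. Qed.
Lemma powers_size (s t : seq A) : powers s t -> size t = size s.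
Proof. by elim: s t => [|x s IHs] [|y t] //= [_ /IHs ->]. Qed.
End Powers.

Section Vanishing.
Variables (A : comNzRingType) (m : idealr A) (M : lmodType A) (d : nat).
Hypotheses (Anoeth : noetherian A) (Aloc : local_ring m) (Mfg : fgm M) (Mfaithful : faithful M).
Local Notation J := (cpxJ m M).
Local Notation E := (ob J d).
Variables (s : seq A) (s0 : E).
Hypotheses (ps : parameters m M d s) (sg : socle_generator m s0).

Lemma socJ_df i (u : ob J i) : soc m u -> df u = 0.
Proof.
move=> /(soc_tcpx Anoeth Aloc)[c _ cE].
apply: (pval_inj (smod_tors m (mres M i.+1))); rewrite linear0 [LHS]tor_dfE cE.
by apply/mdif_eq0; exists c.
Qed.

Lemma J_nonzero i (u : ob J i) : u <> 0 -> exists a : A, a *: u <> 0 /\ soc m (a *: u).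
Proof. exact: (tors_nonzero Anoeth (@J_tors A m M i u)). Qed.

Lemma dpreE0 (t : pre J d) : dpre t = 0.
Proof. exact: (dpre_zero Anoeth Aloc Mfg Mfaithful ps sg). Qed.

Lemma bd0 (u : E) : bd u -> u = 0.
Proof. by move=> [t <-]; apply: dpreE0. Qed.

Lemma df_top i (u : ob J i) : i.+1 = d -> df u = 0.
Proof. by move=> id; have := dpreE0; case: d / id => H; apply: (H u). Qed.

Lemma powers_vanish k t : powers (drop k s) t -> vanish d (kos t J).
Proof.
move=> kt; have [sd sm _ _ _] := ps.
have pf : powers s (take k s ++ t).
  by rewrite -{1}(cat_take_drop k s); apply: powers_cat => //; apply: powers_refl.
apply: (vanish_kos_strip (s := take k s)).
  move=> x /mem_take/sm xm n u; exact: (@kosJ_torsion A m M t n u x xm).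
rewrite -kos_cat -{1}sd -(powers_size pf); apply: kosJ_vanish => // n.
exact: parameters_tors ps pf n.
Qed.

Lemma powers_next k t : (k < d)%N -> powers (drop k.+1 s) t ->
  exists2 x, x \in m & forall a, powers (drop k s) (x ^+ a :: t).
Proof.
have [sd sm _ _ _] := ps; move=> kd kt; exists (nth 0 s k).
  by apply: sm; apply: mem_nth; rewrite sd.
by move=> a; rewrite (drop_nth 0) ?sd //; split=> //; exists a.
Qed.

Lemma coregular x t (h : E) : vanish d (kos (x :: t) J) -> df h = 0 ->
  (forall y, y \in t -> y *: h = 0) ->
  exists h' : E, [/\ df h' = 0, forall y, y \in t -> y *: h' = 0 & x *: h' = h].
Proof.
move=> vx h0 th; have k0 := kin_cocycle h0 th.
have /vx : df ((0, kin t J d h) : ob (cone x (kos t J)) d.+1) = 0.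
  by apply/cy_cone; rewrite /= linear0 scaler0; split=> //; symmetry; exact: k0.
move=> /(_ (ltnSn d))/bd_cone[w w0 wb].
have [w1 w2] := kproj_cocycle (w0 : df (w : ob (kos t J) d) = 0).
exists (kproj t J d w); split=> // [y /w2/bd0 //|].
have {}wb : bd (kin t J d h - x *: (w : ob (kos t J) d)) by exact: wb.
have /bd0 := hom_bd (kproj t J) wb.
by rewrite linearB (linearZ_LR (kproj t J d)) kproj_in => /eqP; rewrite subr_eq0 => /eqP.
Qed.

Variable fr : forall n, frame E (ob J n).

(* The elements with coordinates in Z = ker (J_d -> J_d.+1) form a subcomplex L,
   and claim i says that H^i(0 :_L t) = 0. *)
Definition inL i (u : ob J i) := forall a, df (fco (fr i) a u) = 0.
Definition inLp i : pre J i -> Prop :=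
  if i is k.+1 return pre J i -> Prop then @inL k else fun=> True.

Lemma smod_L i : smod (@inL i).
Proof.
split=> [a|c u v Lu Lv a]; first by rewrite !linear0.
by rewrite (linearP (fco (fr i) a)) linearP Lu Lv scaler0 addr0.
Qed.

Lemma L_lin i k (f : {linear ob J i -> ob J k}) u : inL u -> inL (f u).
Proof.
move=> Lu a; rewrite [u](fsum (fr i)) !linear_sum big1 // => b _.
have [ss _ sg'] := sg.
have [c cE] := endo_at Anoeth Aloc (@J_tors A m M d) ss sg' (fco (fr k) a \o f \o fin (fr i) b)
  (fco (fr i) b u).
by have /= -> := cE (fco (fr i) b u) (fun c H => H); rewrite linearZ_LR Lu scaler0.
Qed.

Lemma L_linp i (f : {linear ob J i -> pre J i}) u : inL u -> inLp (f u).
Proof. by case: i f u => // i f u; apply: L_lin. Qed.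

Lemma L_coregular i x t (u : ob J i) : vanish d (kos (x :: t) J) -> inL u ->
  (forall y, y \in t -> y *: u = 0) ->
  exists u', [/\ inL u', forall y, y \in t -> y *: u' = 0 & x *: u' = u].
Proof.
move=> vx Lu tu.
have /choice[h hE] a : exists h' : E, [/\ df h' = 0, forall y, y \in t -> y *: h' = 0 &
    x *: h' = fco (fr i) a u].
  by apply: coregular => // y yt; rewrite -linearZ_LR tu // linear0.
have cE b : fco (fr i) b (\sum_a fin (fr i) a (h a)) = h b.
  rewrite linear_sum (bigD1 b) //= fcoin eqxx big1 ?addr0 // => a ab.
  by rewrite fcoin eq_sym (negbTE ab).
exists (\sum_a fin (fr i) a (h a)); split=> [b|y yt|].
- by rewrite cE; have [] := hE b.
- rewrite scaler_sumr big1 // => a _; rewrite -linearZ_LR.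
  have [_ th _] := hE a; rewrite (_ : y *: h a = 0) ?linear0 //; exact: th.
apply: (fco_inj (fr i)) => b; rewrite linearZ_LR cE; by have [] := hE b.
Qed.

Definition claim i := forall k t, (k <= d)%N -> (d <= i + k)%N -> powers (drop k s) t ->
  forall u : ob J i, inL u -> (forall y, y \in t -> y *: u = 0) -> df u = 0 ->
  exists w : pre J i, [/\ inLp w, forall y, y \in t -> y *: w = 0 & dpre w = u].

Definition divisible i := forall k t x, (k < d)%N -> (d <= i + k.+1)%N ->
  (forall a, powers (drop k s) (x ^+ a :: t)) ->
  forall a (u : ob J i), inL u -> (forall y, y \in t -> y *: u = 0) -> df u = 0 ->
  exists u', [/\ inL u', forall y, y \in t -> y *: u' = 0, df u' = 0 & x ^+ a *: u' = u].

Lemma divisible_claim i : (i < d)%N -> divisible i -> claim i.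
Proof.
move=> id Di k t kd ik kt; elim: {k}(i + k - d)%N {-2}k t (erefl (i + k - d)%N) kd ik kt
    => [|e IHe] k t ke kd ik kt u Lu tu u0.
  have kE : k = (d - i)%N by lia.
  have [k' k'E] : exists k', k = k'.+1 by exists k.-1; lia.
  have k'd : (k' < d)%N by lia.
  rewrite k'E in kt; have [x xm xP] := powers_next k'd kt.
  have [sd sm fs _ _] := ps.
  have ft : filter_regular m M t by apply: filter_regular_powers kt (fs _).
  have ti : size t = i by rewrite (powers_size kt) size_drop sd; lia.
  have [|N N0 [S [T [X STE]]]] := cpxJ_homotopy (q := i) Anoeth Mfg ft xm; first by rewrite ti.
  have [|u' [Lu' tu' u'0 u'E]] := Di k' t x k'd _ xP N u Lu tu u0; first by lia.
  have tl (l : 'I_(size t)) : t`_l \in t by apply: mem_nth.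
  exists (S u'); split; first exact: L_linp.
    by move=> y yt; rewrite -linearZ_LR tu' // linear0.
  rewrite -u'E STE u'0 linear0 addr0 big1 ?addr0 // => l _.
  by rewrite -linearZ_LR tu' // linear0.
have [k' k'E] : exists k', k = k'.+1 by exists k.-1; lia.
have k'd : (k' < d)%N by lia.
rewrite k'E in kt; have [x xm xP] := powers_next k'd kt.
have [a au] := @J_tors A m M i u x xm.
have e1 : (i + k' - d)%N = e by lia.
have e2 : (k' <= d)%N by lia.
have e3 : (d <= i + k')%N by lia.
have tu' y : y \in x ^+ a :: t -> y *: u = 0 by rewrite inE => /orP[/eqP -> //|/tu].
have [w [Lw tw wE]] := IHe k' (x ^+ a :: t) e1 e2 e3 (xP a) u Lu tu' u0.
by exists w; split=> // y yt; apply: tw; rewrite inE yt orbT.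
Qed.

Lemma claim_divisible i : (i.+1 < d)%N -> claim i.+1 -> divisible i.
Proof.
move=> id Ci k t x kd ik xP a u Lu tu u0.
have [u' [Lu' tu' u'E]] := L_coregular (powers_vanish (xP a)) Lu tu.
have e1 : (d <= i.+1 + k)%N by lia.
have tdu y : y \in x ^+ a :: t -> y *: df u' = 0.
  by rewrite inE => /orP[/eqP ->|yt]; rewrite -linearZ_LR ?u'E // tu' // linear0.
have [w [Lw tw wE]] := Ci k (x ^+ a :: t) (ltnW kd) e1 (xP a) (df u') (L_lin df Lu') tdu (df2 u').
exists (u' - w); split.
- exact: (smodB (@smod_L i)).
- by move=> y yt; rewrite scalerBr tu' // tw ?subrr // inE yt orbT.
- by rewrite linearB; apply/eqP; rewrite subr_eq0; apply/eqP; symmetry; exact: wE.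
by rewrite scalerBr u'E tw ?subr0 // mem_head.
Qed.

Lemma claim_all n i : (i + n.+1)%N = d -> claim i.
Proof.
elim: n i => [|n IHn] i id; apply: divisible_claim; try lia.
  move=> k t x kd ik xP a u Lu tu u0.
  have [u' [Lu' tu' u'E]] := L_coregular (powers_vanish (xP a)) Lu tu.
  by exists u'; split=> //; apply: df_top; lia.
by apply: claim_divisible; [lia|apply: IHn; lia].
Qed.

Lemma s0_cocycle : df s0 = 0.
Proof.
have [z z0 nz] := parameters_nonvanishing Anoeth Aloc Mfg Mfaithful ps sg.
have [ss _ sg'] := sg.
apply: (sub_soc Anoeth Aloc (@J_tors A m M d) ss sg' (smod_ker df) z0) => zz.
by apply: nz; rewrite zz; apply: smod0; apply: smod_bd.
Qed.

Lemma lower_zero i (u : ob J i) : (i < d)%N -> u = 0.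
Proof.
elim: i u => [|i IHi] u id; apply: contrapT => /J_nonzero[a [au aus]]; apply: au.
all: have La : inL (a *: u); [move=> b; have [ss _ sg'] := sg;
  have [c ->] := sg' _ (soc_lin (fco (fr _) b) aus); by rewrite linearZ_LR s0_cocycle scaler0|].
all: have [sd _ _ _ _] := ps.
all: have sp : powers (drop d s) [::] by rewrite drop_oversize ?sd.
all: have tn y : y \in [::] -> y *: (a *: u) = 0 by [].
  have [n nd] : exists n, (0 + n.+1)%N = d by exists d.-1; lia.
  have [w [_ _ <-]] := claim_all nd (leqnn d) (leq_addl 0 d) sp La tn (socJ_df aus).
  by rewrite [w]zeroM0 linear0.
have [n nd] : exists n, (i.+1 + n.+1)%N = d by exists (d - i.+2)%N; lia.
have [w [_ _ <-]] := claim_all nd (leqnn d) (leq_addl i.+1 d) sp La tn (socJ_df aus).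
by rewrite [w]IHi ?linear0 //; lia.
Qed.
End Vanishing.

Section TopDegree.
Variables (A : comNzRingType) (m : idealr A) (M : lmodType A).
Hypotheses (Anoeth : noetherian A) (Aloc : local_ring m) (Mfg : fgm M) (Mfaithful : faithful M).
Local Notation J := (cpxJ m M).

Lemma kproj_inj (C : cpx A) d t : (forall i (u : ob C i), (i < d)%N -> u = 0) ->
  (forall i (u : ob (kos t C) i), (i < d)%N -> u = 0) /\
  forall u : ob (kos t C) d, kproj t C d u = 0 -> u = 0.
Proof.
move=> C0; elim: t => [|x t [IH1 IH2]]; first by split.
have pre0 i (v : pre (kos t C) i) : (i <= d)%N -> v = 0.
  by case: i v => [|i] v id; [exact: zeroM0|exact: IH1].
split=> [i [u v] id|[u v] /= /IH2 ->]; congr (_, _); first exact: IH1.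
  by apply: pre0; apply: ltnW.
exact: pre0.
Qed.

Lemma kosI_lift t (v : M) : filter_regular m M t -> torm m (smul t) v ->
  exists tt : {linear M -> ob (kos t (cpxI M)) (size t)}, (forall v, bd (tt v) <-> smul t v) /\
  exists2 w : ob (kos t J) (size t), df w = 0 &
    bd (tt v - kos_hom t (tinc m (cpxI M)) _ w).
Proof.
move=> ft tv; have [tt [tt0 ttE _]] := kosI_top M t; exists tt; split=> //.
have S := ses_kos t (tq_ses m (cpxI M)).
apply: (torsion_class_lift S (@kosQ_torsionfree A m M t) (@kosQ_injective A m M Anoeth t)).
- by move=> k kt; apply: (kosQ_exact Anoeth ft).
- exact: tt0.
by move=> y /tv[k kE]; exists k; rewrite -linearZ_LR; apply/ttE.
Qed.

Lemma filter_regular_torm x t (v : M) : filter_regular m M (x :: t) -> smul t (x *: v) ->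
  torm m (smul t) v.
Proof.
move=> fx xv y ym; have [tt [tt0 ttE _]] := kosI_top M t.
have [c cE] := (ttE (x *: v)).2 xv.
have cy : df ((tt v, c) : ob (cone x (kos t (cpxI M))) (size t)) = 0.
  by apply/cy_cone; rewrite /= tt0 -linearZ_LR cE.
have [k /bd_cone[w wE _]] := fx (size t) (ltnSn _) _ cy y ym.
by exists k; apply/ttE; exists w; rewrite wE /= linearZ_LR.
Qed.

Lemma parameters_torm d s t : parameters m M d s -> powers s t -> forall v : M, torm m (smul t) v.
Proof.
move=> ps st v y ym; have [tt [tt0 ttE _]] := kosI_top M t.
have [k kb] := parameters_tors ps st (tt0 v) ym.
by exists k; apply/ttE; rewrite linearZ_LR.
Qed.

Lemma J_lower d s (s0 : ob J d) : parameters m M d s -> socle_generator m s0 ->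
  forall i (u : ob J i), (i < d)%N -> u = 0.
Proof.
move=> ps sg i u id; have [fr _] := frames_exist Anoeth Aloc Mfg sg.
exact: (lower_zero Anoeth Aloc Mfg Mfaithful ps sg fr).
Qed.

Lemma top_scalar d s (s0 : ob J d) t (f : {linear ob J d -> ob J d}) (a : A) :
  parameters m M d s -> socle_generator m s0 -> powers s t ->
  (forall u, df u = 0 -> f u = 0) -> (forall u, (forall y, y \in t -> y *: u = 0) -> f u = a *: u) ->
  forall v : M, smul t (a *: v).
Proof.
move=> ps sg st f0 fa v; have td : size t = d by rewrite (powers_size st); case: ps.
have J0 := J_lower ps sg; have bdE := bd0 Anoeth Aloc Mfg Mfaithful ps sg.
have [_ _ fs _ _] := ps.
have ft : filter_regular m M t by apply: filter_regular_powers st _; have := fs 0%N; rewrite drop0.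
have [tt [ttE [w w0 wb]]] := kosI_lift ft (parameters_torm ps st v).
clear sg; subst d; have [h0 hb] := kproj_cocycle w0; have [_ kinj] := kproj_inj t J0.
have aw : a *: w = 0.
  apply: kinj; rewrite linearZ_LR -fa ?f0 // => y /hb; exact: bdE.
apply/ttE; rewrite linearZ_LR.
have -> : a *: tt v = a *: (tt v - kos_hom t (tinc m (cpxI M)) _ w) +
   kos_hom t (tinc m (cpxI M)) _ (a *: w) by rewrite linearZ_LR; lincomb.
apply: (smodD (smod_bd _ _)); first exact: (smodZ _ (smod_bd _ _)).
by rewrite aw linear0; apply: smod0 (smod_bd _ _).
Qed.

Fixpoint uvec (u : seq M) : pw M (size u) :=
  if u is x :: u' return pw M (size u) then (x, uvec u') else 0.

Lemma uvec_eq0 (c : A) u : c *: uvec u = 0 -> forall x, x \in u -> c *: x = 0.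
Proof.
elim: u => //= x u IHu [cx cu] y; rewrite inE => /orP[/eqP -> //|]; exact: IHu.
Qed.

Lemma smul_pw t n (a : A) : (forall v : M, smul t (a *: v)) ->
  forall w : pw M n, smul t (a *: w).
Proof.
move=> H; elim: n => [|n IHn] w; first by rewrite [_ *: _]zeroM0; apply: smod0 (smod_smul _ _).
have E t' (u : M) (w' : pw M n) : smul t' u -> smul t' w' ->
    smul t' ((u, w') : (M * pw M n)%type).
  elim: t' u w' => [|x t' IHt] u w' /=; first by move=> -> ->.
  by move=> [u1 h1] [w1 h2]; exists (u1, w1); apply: IHt.
by case: w => u w; apply: E; [exact: H|exact: IHn].
Qed.

Lemma smul_sub (V : lmodType A) (L : V -> Prop) t (v : V) : smod L ->
  (forall x w, x \in t -> L (x *: w)) -> smul t v -> L v.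
Proof.
move=> sL; elim: t v => [|x t IHt] v tL /=; first by move=> ->; apply: smod0 sL.
move=> [w /IHt h]; rewrite -[v](subrK (x *: w)); apply: (smodD sL).
  by apply: h => y u yt; apply: tL; rewrite inE yt orbT.
by apply: tL; rewrite mem_head.
Qed.

Lemma df_zero d s (s0 : ob J d) : parameters m M d s -> socle_generator m s0 ->
  forall e : ob J d, df e = 0.
Proof.
move=> ps sg e1; apply: contrapT => /(J_nonzero Anoeth)[b [be bs]].
have [ss s00 sg'] := sg.
have [a ab|g gE] := inj_cyclic (v := b *: df e1) (e := s0) (@cpxJ_injective A m M Anoeth d).
  apply: ss; apply: contrapT => /negP/(local_unit Anoeth Aloc)[c ac]; apply: be.
  by rewrite -[_ *: _]scale1r -ac mulrC -scalerA ab scaler0.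
pose f : {linear ob J d -> ob J d} := g \o df; pose e := b *: e1.
have fe : f e = s0 by rewrite /f /= -gE; congr (g _); exact: (linearZ_LR df).
have fZ u : df u = 0 -> f u = 0 by move=> u0; rewrite /f /= [X in g X]u0 linear0.
have [u uT] := Mfg.
pose K0 (w : pw M (size u)) := exists2 c : A, c *: e = 0 & w = c *: uvec u.
have sK0 : smod K0.
  split=> [|c _ _ [c1 h1 ->] [c2 h2 ->]]; first by exists 0; rewrite scale0r.
  by exists (c * c1 + c2); rewrite scalerDl -scalerA // h1 h2 scaler0 addr0.
have pnoeth : noethm (pw M (size u)).
  by apply: noethm_fg => //; apply: pw_obj Mfg; exact: fgm_closed.
have [||L [sL K0L LK tL]] := essential_torsion (m := m) pnoeth (smod_line (uvec u)) sK0.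
- by move=> _ [c _ ->]; exists c.
- move=> _ [c ->] y ym; have [k k0] := @J_tors A m M d e y ym; exists k, (y ^+ k * c).
    by rewrite mulrC -scalerA k0 scaler0.
  by rewrite scalerA.
have [sd sm _ _ _] := ps.
have [t [st tP]] : exists t, powers s t /\ forall x, x \in t -> (forall w, L (x *: w)) /\ x *: e = 0.
  elim: (s) (sm) => [|x r IHr] rm; first by exists [::].
  have [|t [rt tP]] := IHr; first by move=> y yr; apply: rm; rewrite inE yr orbT.
  have xm : x \in m by apply: rm; rewrite mem_head.
  have [N NE] := torm_bounded x sL pnoeth; have [k k0] := @J_tors A m M d e x xm.
  exists (x ^+ (N + k) :: t); split; first by split=> //; exists (N + k)%N.
  move=> y; rewrite inE => /orP[/eqP ->|/tP //]; split=> [w|].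
    by apply: smod_expZ (leq_addr k N) _ => //; apply: NE; apply: tL.
  by rewrite exprD -scalerA k0 scaler0.
have [||a aE] := endo_scalar Anoeth Aloc ss sg' f (I := lspan (t : seq (regm A))).
- exact: smod_span.
- move=> c y ym; have [k kE] := power_in_ideal Anoeth Mfg Mfaithful (parameters_torm ps st) ym.
  by exists k; rewrite regmE mulrC; apply: (smodZ (V := regm A) _ (smod_span _) kE).
have fa w : (forall y, y \in t -> y *: w = 0) -> f w = a *: w.
  move=> tw; apply: aE => c; apply: (span_sub (smod_ann w (smod_eq0 _))) => y yt; exact: tw.
have /smul_pw/(_ (uvec u)) := top_scalar ps sg st fZ fa.
move=> /(smul_sub sL) La; have {}La : L (a *: uvec u) by apply: La => x w /tP[].
have [|c ce auE] := LK _ La; first by exists a.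
have ac : a = c.
  apply/eqP; rewrite -subr_eq0; apply/eqP/Mfaithful => v.
  have sk : smod (fun v : M => (a - c) *: v = 0).
    split=> [|c' v1 v2 h1 h2]; first by rewrite scaler0.
    by rewrite scalerDr scalerA mulrC -scalerA h1 h2 scaler0 addr0.
  apply: (span_sub sk _ (uT v)); apply: uvec_eq0.
  by rewrite scalerBl auE subrr.
apply: s00; rewrite -fe fa ?ac // => y /tP[] //.
Qed.

Lemma J_upper d s (s0 : ob J d) : parameters m M d s -> socle_generator m s0 ->
  forall i (u : ob J i), (d < i)%N -> u = 0.
Proof.
move=> ps sg; have d0 := df_zero ps sg; have [sd _ _ _ _] := ps.
have vJ : vanish d J.
  by apply: (powers_vanish Anoeth ps (k := d) (t := [::])); rewrite drop_oversize ?sd.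
have d0' j : d = j -> forall w : ob J j, df w = 0 by move=> e; subst j.
elim=> [|j IHj] // u dj; apply: contrapT => /(J_nonzero Anoeth)[a [au aus]]; apply: au.
have [w <-] := vJ _ dj _ (socJ_df Anoeth Aloc aus).
move: dj; rewrite ltnS leq_eqVlt => /orP[/eqP /d0' H|dj]; first exact: H.
by rewrite [w]IHj // linear0.
Qed.

Lemma soc_cosyz_zero d s (s0 : ob J d) : parameters m M d s -> socle_generator m s0 ->
  forall i (c : cosyz M i), (d < i)%N -> soc m c -> c = 0.
Proof.
move=> ps sg i c di /(tcpx_soc (m := m))[u _ uE]; apply: (@min_in_inj A M i).
by rewrite -uE (J_upper ps sg (i := i) u di) !linear0.
Qed.
End TopDegree.

(** * Finite injective dimension *)

Section FiniteInjectiveDimension.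
Variables (A : comNzRingType) (m : idealr A) (M : lmodType A) (d : nat).
Hypotheses (Anoeth : noetherian A) (Aloc : local_ring m) (Mfg : fgm M).
Hypothesis soc0 : forall i (c : cosyz M i), (d < i)%N -> soc m c -> c = 0.
Implicit Types I p : regm A -> Prop.

Definition annby I (V : lmodType A) (v : V) := forall a : A, I a -> a *: v = 0.

Definition ext0 i I (c : cosyz M i.+1) := exists2 e : mres M i, annby I e & mproj M i e = c.
(* Ext^i.+1(A / I, M) = 0 *)
Definition good i I := forall c : cosyz M i.+1, annby I c -> ext0 I c.

Lemma smod_ext0 i I : smod (@ext0 i I).
Proof.
split=> [|a _ _ [e1 h1 <-] [e2 h2 <-]]; first by exists 0; rewrite ?linear0 // => a _; rewrite scaler0.
exists (a *: e1 + e2); last by rewrite linearP.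
by move=> b Ib; rewrite scalerDr scalerA mulrC -scalerA h1 // h2 // scaler0 addr0.
Qed.

Lemma cyclic_map I (sI : smod I) (V : lmodType A) (v : V) : annby I v ->
  exists f : {linear pquo sI -> V}, f (pproj sI (1 : A)) = v.
Proof.
move=> Iv; have [|a|f fE] := @lin_factor_surj A (regm A) (pquo sI) V (pproj sI) (Lin (mul_linear v)).
- exact: pproj_surj.
- by move/pproj_eq0 => Ia; rewrite LinE; apply: Iv.
by exists f; rewrite fE LinE scale1r.
Qed.

Lemma annby_map I (sI : smod I) (V : lmodType A) (f : {linear pquo sI -> V}) :
  annby I (f (pproj sI (1 : A))).
Proof.
move=> a Ia; rewrite -!linearZ_LR; rewrite (_ : pproj sI _ = 0) ?linear0 //.
by apply/pproj_eq0; rewrite regmE mulr1.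
Qed.

Lemma solve_over I (sI : smod I) (b : A) (E : lmodType A) (e : E) : injective_module E ->
  annby (fun a => I (a * b)) e -> exists2 e', annby I e' & b *: e' = e.
Proof.
move=> Einj be; have bE : pproj sI (b : regm A) = b *: pproj sI (1 : A).
  by rewrite -linearZ_LR; congr (pproj sI _); rewrite regmE mulr1.
have [a|f fE] := inj_cyclic (v := pproj sI (b : regm A)) (e := e) Einj.
  by rewrite -linearZ_LR => /pproj_eq0 H; apply: be.
exists (f (pproj sI (1 : A))); first exact: annby_map.
by rewrite -linearZ_LR -bE fE.
Qed.

Lemma good_ext i I (b : A) : smod I -> good i (fun a => I (a * b)) ->
  good i (saddp I (fun a : regm A => exists x, a = x * b)) -> good i I.
Proof.
move=> sI gp gb c Ic.
have [|e1 pe1 e1E] := gp (b *: c); first by move=> a; rewrite scalerA; apply: Ic.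
have [e2 Ie2 e2E] := solve_over sI (@hull_injective A (cosyz M i)) pe1.
have [|e3 Ie3 e3E] := gb (c - mproj M i e2).
  move=> a [a1 Ia1 [x xE]]; rewrite -[a](subrK a1) xE scalerDl.
  have -> : a1 *: (c - mproj M i e2) = 0.
    by rewrite scalerBr Ic // -linearZ_LR Ie2 // linear0 subrr.
  by rewrite addr0 -scalerA scalerBr -linearZ_LR e2E e1E subrr scaler0.
exists (e2 + e3); last by rewrite linearD e3E addrC subrK.
move=> a Ia; rewrite scalerDr Ie2 // Ie3 ?addr0 //.
by exists a => //; exists 0; rewrite subrr mul0r.
Qed.

Lemma good_divisible i p (x : A) : isprime p -> ~ p x ->
  good i.+1 (saddp p (fun a : regm A => exists y, a = y * x)) ->
  forall c : cosyz M i.+1, annby p c -> exists2 c', annby p c' & x *: c' = c.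
Proof.
move=> [sp p1 pM] npx gx c pc.
have pj : annby (fun a => p (a * x)) (min_in M i.+1 c).
  by move=> a /pM[pa|//]; rewrite -linearZ_LR pc // linear0.
have [e pe eE] := solve_over sp (@hull_injective A (cosyz M i.+1)) pj.
have [|e' pe' e'E] := gx (mproj M i.+1 e).
  move=> a [a1 pa1 [y yE]]; rewrite -[a](subrK a1) yE -linearZ_LR scalerDl (pe a1) // addr0.
  by rewrite -scalerA [x *: e]eE (linearZ_LR (mproj M i.+1)) mproj_in scaler0.
have /mproj_eq0[c' c'E] : mproj M i.+1 (e - e') = 0 by rewrite linearB e'E subrr.
exists c'.
  move=> a pa; apply: (@min_in_inj A M i.+1); rewrite linearZ_LR [min_in M i.+1 c']c'E.
  rewrite scalerBr pe // pe' ?subrr ?linear0 //.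
  by exists a => //; exists 0; rewrite subrr mul0r.
apply: (@min_in_inj A M i.+1); rewrite linearZ_LR [min_in M i.+1 c']c'E scalerBr eE.
rewrite [x *: e'](pe' x) ?subr0 //.
by exists 0; [exact: smod0 sp|exists 1; rewrite subr0 mul1r].
Qed.

Lemma ext_cyclic_finite i I : smod I -> exists t : seq (cosyz M i.+1),
  (forall c, c \in t -> annby I c) /\ forall c, annby I c -> saddp (lspan t) (@ext0 i I) c.
Proof.
move=> sI; have [t tP] := ext_finite i.+1 Anoeth Mfg (fgm_quo sI (fgm_ring A)).
pose ev (f : {linear pquo sI -> cosyz M i.+1}) := f (pproj sI (1 : A)).
exists (map ev t); split=> [c|c /(cyclic_map sI)[f <-]].
  elim: (t) => //= f t' IHt; rewrite inE => /orP[/eqP ->|/IHt //]; exact: annby_map.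
rewrite -/(ev f); elim: t f {tP}(tP f) => [|g t IHt] f /=.
  move=> [h hE]; exists 0 => //; rewrite subr0.
  by exists (h (pproj sI (1 : A))); [exact: annby_map|rewrite -hE].
move=> [a /IHt[u ut uE]]; exists (u + a *: ev g).
  by exists a; rewrite addrK.
by have -> : ev f - (u + a *: ev g) = ev (f \- a \*: g) - u
  by rewrite /ev /=; lincomb.
Qed.

Lemma good_all i I : (d <= i)%N -> smod I -> good i I.
Proof.
move=> di sI; apply: contrapT => H.
pose F I := smod I /\ exists2 i, (d <= i)%N & ~ good i I.
have [||{di sI H I i}I [sI [i di ngood]] maxI] := @noeth_max A (regm A) F (noethm_ring Anoeth).
- by exists I; split=> //; exists i.
- by move=> D [].
have bigger I' j : smod I' -> (forall a, I a -> I' a) -> (exists2 a, I' a & ~ I a) ->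
    (d <= j)%N -> good j I'.
  move=> sI' II' [a I'a nIa] dj; apply: contrapT => ng; apply: nIa.
  by apply: (maxI I' _ II' a I'a); split=> //; exists j.
have nI1 : ~ I 1.
  move=> I1; apply: ngood => c /(_ 1 I1); rewrite scale1r => ->; exact: smod0 (smod_ext0 i I).
have [P mP _] := maximal_annihilator_exists Anoeth sI nI1.
have Pp := maximal_annihilator_prime sI mP; have [[v nIv PE] _] := mP.
have sadd (x : A) : smod (saddp I (fun a : regm A => exists y, a = y * x)).
  by apply: smod_add => //; apply: smod_principal.
have subadd (x : A) a : I a -> saddp I (fun a : regm A => exists y, a = y * x) a.
  by move=> Ia; exists a => //; exists 0; rewrite subrr mul0r.
have inadd (x : A) : saddp I (fun a : regm A => exists y, a = y * x) x.
  by exists 0; [exact: smod0 sI|exists 1; rewrite subr0 mul1r].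
have IP a : I a -> P a.
  by rewrite PE => Ia; rewrite regmE mulrC; apply: (smodZ (V := regm A)).
have [[b Pb nIb]|PI] := EM (exists2 b, P b & ~ I b).
  apply: ngood; apply: (good_ext (b := v)) => //.
    rewrite -[X in good _ X]/(fun a : regm A => I ((a : A) *: (v : regm A))) -PE.
    by apply: bigger => //; [case: Pp|exists b].
  exact: (bigger _ i (sadd v) (subadd v) (ex_intro2 _ _ v (inadd v) nIv) di).
have Ipr : isprime I.
  suff -> : I = P by [].
  apply/funext => a; apply/propext; split=> [/IP //|Pa].
  by apply: contrapT => nIa; apply: PI; exists a.
have [[x xm nIx]|mI] := EM (exists2 x, x \in m & ~ I x); last first.
  apply: ngood => c Ic; suff -> : c = 0 by exact: smod0 (smod_ext0 i I).
  apply: soc0 => // y ym; apply: Ic; apply: contrapT => nIy; apply: mI; by exists y.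
have dv := good_divisible Ipr nIx (bigger _ i.+1 (sadd x) (subadd x)
   (ex_intro2 _ _ x (inadd x) nIx) (leqW di)).
have [t [tI tE]] := ext_cyclic_finite i sI.
apply: ngood => c /tE[u ut uE]; rewrite -[c](subrK u) addrC.
apply: (smodD (smod_ext0 i I)) => //.
apply: (@nakayama A m Anoeth Aloc _ (@ext0 i I) t (smod_ext0 i I) _ u ut) => j.
have [c' Ic' c'E] := dv _ (tI _ (mem_nth 0 (ltn_ord j))).
have [w /span_ord[e eE] wE] := tE c' Ic'.
exists (fun l => x * e l) => [l|].
  by rewrite mulrC; exact: (smodZ (V := regm A) _ (smod_idealr m) xm).
under eq_bigr => l _ do rewrite -scalerA.
by rewrite -scaler_sumr -eE -c'E -scalerBr; apply: smodZ wE; exact: smod_ext0.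
Qed.

Lemma cosyz_injective : injective_module (cosyz M d).
Proof.
apply: baer => P sP f.
have [u u0|h hE] := inj_extend (f := pval sP) (g := min_in M d \o f) (@hull_injective A (cosyz M d)).
  by rewrite (_ : u = 0) ?linear0 //; apply: (pval_inj sP); rewrite u0 linear0.
pose e0 := h (1 : A); have hA (a : A) : h a = a *: e0.
  by rewrite -linearZ_LR; congr (h _); rewrite regmE mulr1.
have [|e Pe eE] := @good_all d P (leqnn d) sP (mproj M d e0).
  move=> a Pa; have [u uE] := pval_ex sP Pa.
  by rewrite -linearZ_LR -hA -uE hE mproj_in.
have /mproj_eq0[c cE] : mproj M d (e0 - e) = 0 by rewrite linearB eE subrr.
exists c => u; apply: (@min_in_inj A M d); rewrite linearZ_LR [min_in M d c]cE scalerBr.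
by rewrite (Pe _ (pvalP u)) subr0 -hA hE.
Qed.

Lemma mres_zero i (u : mres M i) : (d < i)%N -> u = 0.
Proof.
have [r rE] := inj_split cosyz_injective (@min_in_inj A M d).
have surj v : exists c, min_in M d c = v.
  exists (r v); apply/eqP; rewrite eq_sym -subr_eq0; apply: contraT => w0.
  have [a [aw [c cE]]] := @hull_essential A (cosyz M d) _ w0.
  have c0 : c = 0 by rewrite -[c]rE [min_in M d c]cE linearZ_LR linearB rE subrr scaler0.
  by rewrite -cE c0 linear0 eqxx in aw.
have cos1 (c : cosyz M d.+1) : c = 0.
  by have [v <-] := mproj_surj c; have [c' <-] := surj v; rewrite mproj_in.
have hull0 j : (forall c : cosyz M j, c = 0) -> forall v : mres M j, v = 0.
  move=> c0 v; apply/eqP; apply: contraT => v0.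
  have [a [av [c cE]]] := @hull_essential A (cosyz M j) _ v0.
  by rewrite -cE (c0 c) linear0 eqxx in av.
have all0 n : forall c : cosyz M (d.+1 + n), c = 0.
  elim: n => [|n IHn]; first by rewrite addn0.
  rewrite addnS => c; have [v <-] := mproj_surj c; by rewrite (hull0 _ IHn v) linear0.
by move=> di; move: u; rewrite -(subnKC di); apply: hull0.
Qed.

Lemma finite_injective_dimension_of_socles : finite_injective_dimension M.
Proof.
exists (@InjectiveResolution A M (mres M) (mdif M) (min_in M 0)
  (fun i => @hull_injective A (cosyz M i)) (@min_in_inj A M 0) (@mdif_eq0 A M 0)
  (fun i y => @mdifS_eq0 A M i y)), d => i x; exact: mres_zero.
Qed.
End FiniteInjectiveDimension.

(** * Depth and dimension *)

Section RegularSequences.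
Variables (A : comNzRingType) (m : idealr A) (d : nat).
Hypotheses (Anoeth : noetherian A) (Aloc : local_ring m) (Adim : krull_dim A d).

Lemma smul_mono (V : lmodType A) (s t : seq A) (v : V) : (forall x, x \in s -> x \in t) ->
  smul s v -> smul t v.
Proof.
by move=> st; apply: smul_sub => [|x w xs]; [exact: smod_smul|apply: smul_mem; apply: st].
Qed.

Lemma in_seq_mulE (V : lmodType A) (s : seq A) (v : V) : in_seq_mul s v <-> smul s v.
Proof.
split=> [[z ->]|].
  apply: smod_sum => [|i _]; first exact: smod_smul.
  by apply: smul_mem; apply: mem_nth.
elim: s v => [|x s IHs] v /=; first by move=> ->; exists (fun=> 0); rewrite big_ord0.
move=> [w /IHs[z zE]].
exists (fun i : 'I_(size s).+1 => if unlift ord0 i is Some j then z j else w).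
rewrite big_ord_recl unlift_none /=; under eq_bigr => i _ do rewrite liftK.
by rewrite -zE addrC subrK.
Qed.

Definition chain_regular (V : lmodType A) (s : seq A) := forall k (v : V), (k < size s)%N ->
  smul (drop k.+1 s) (nth 0 s k *: v) -> smul (drop k.+1 s) v.

Lemma regular_sequence_rev (V : lmodType A) (s : seq A) : chain_regular V s ->
  (exists v : V, ~ smul s v) -> regular_sequence V (rev s).
Proof.
move=> rs [v nv]; split; last first.
  exists v => /in_seq_mulE H; apply: nv; apply: smul_mono H => x; by rewrite mem_rev.
move=> i y; rewrite size_rev => si /in_seq_mulE H; apply/in_seq_mulE.
have E : take i (rev s) = rev (drop (size s - i.+1).+1 s).
  by rewrite take_rev subnSK.
rewrite E in H *.
have k_s : (size s - i.+1 < size s)%N by lia.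
have := rs (size s - i.+1)%N y k_s; rewrite nth_rev // in H * => K.
apply: (smul_mono _ (K _)) => [x|]; first by rewrite mem_rev.
by apply: smul_mono H => x; rewrite mem_rev.
Qed.

Lemma chain_regular_of (V : lmodType A) (s : seq A) : regular_sequence V s ->
  chain_regular V (rev s).
Proof.
move=> [rs _] k v; rewrite size_rev => ks; rewrite nth_rev // drop_rev => H.
have i_s : (size s - k.+1 < size s)%N by lia.
apply: (@smul_mono V (take (size s - k.+1) s)) => [x|]; first by rewrite mem_rev.
apply/in_seq_mulE; apply: rs => //; apply/in_seq_mulE.
by apply: smul_mono H => x; rewrite mem_rev.
Qed.

Lemma ht_mono (c c' : regm A -> Prop) n p : (forall a, c' a -> c a) -> ht c n p -> ht c' n p.
Proof.
move=> cc; elim: n p => [|n IHn] p [pp]; first by move=> cp; split=> // a /cc/cp.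
by move=> [q qp /IHn hq]; split=> //; exists q.
Qed.

Lemma chain_regular_ht (V : lmodType A) (r : seq A) p : chain_regular V r -> isprime p ->
  (forall a, annp (@smul A V r) a -> p a) -> ht (annp (@smul A V [::])) (size r) p.
Proof.
elim: r p => [|x r IHr] p cr pp rp; first by split.
pose S (a : A) := exists t i, ~ p t /\ a = t * x ^+ i; have [sp p1 pM] := pp.
have sc := smod_annp (@smod_smul A V r).
have px : p x by apply: rp => v; apply: smul_mem; rewrite mem_head.
have xreg (v : V) : smul r (x *: v) -> smul r v.
  by have := cr 0%N v (ltn0Sn _); rewrite /= drop0.
have [|a b|a ca|P [pP cP PS]] := @prime_avoiding A Anoeth (annp (@smul A V r)) S sc.
- by exists 1, 0%N; rewrite mulr1.
- move=> [t [i [nt ->]]] [t' [i' [nt' ->]]]; exists (t * t'), (i + i')%N; split.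
    by case/pM.
  by rewrite exprD; ring.
- move=> [t [i [nt aE]]]; apply: nt; apply: rp => v; apply: (@smul_mono V r).
    by move=> y yr; rewrite inE yr orbT.
  have : smul r (x ^+ i *: (t *: v)) by rewrite scalerA mulrC -aE; apply: ca.
  elim: i {aE} => [|i IHi]; first by rewrite scale1r.
  by rewrite exprS -scalerA => /xreg.
split=> //; exists P.
  split=> [a Pa|].
    by apply: contrapT => npa; apply: (PS a Pa); exists a, 0%N; rewrite mulr1.
  by exists x => // Px; apply: (PS x Px); exists 1, 1%N; rewrite mul1r.
by apply: IHr => // k v kr; apply: (cr k.+1 v).
Qed.

Lemma regular_sequence_bound (V : lmodType A) (s : seq A) : faithful V -> {subset s <= m} ->
  regular_sequence V s -> (size s <= d)%N.
Proof.
move=> Vf sm rs; have [_ [v nv]] := rs; rewrite -size_rev.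
apply: (ht_le_dim Adim (p := fun a => a \in m)).
apply: (@ht_mono (annp (@smul A V [::]))) => [a -> w|].
  by rewrite scale0r; apply: smod0; apply: smod_smul.
apply: chain_regular_ht; first exact: chain_regular_of.
  exact: (m_prime Anoeth Aloc).
move=> a; apply: (proper_sub_m Anoeth Aloc (smod_annp (@smod_smul A V (rev s)))) => /(_ v).
by rewrite scale1r => H; apply: nv; apply/in_seq_mulE; apply: smul_mono H => x; rewrite mem_rev.
Qed.

Lemma depth_of_chain (V : lmodType A) (s : seq A) : faithful V -> size s = d ->
  (forall y, y \in s -> y \in m) -> chain_regular V s -> (exists v : V, ~ smul s v) ->
  depth m V d.
Proof.
move=> Vf sd sm cs nv; split; last by move=> s' s'm; apply: regular_sequence_bound.
exists (rev s); split; rewrite ?size_rev //; last exact: regular_sequence_rev.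
by move=> x; rewrite mem_rev; apply: sm.
Qed.

Lemma module_dim_faithful (V : lmodType A) : faithful V -> module_dim V d.
Proof.
move=> Vf; have [[p cp] bp] := Adim; split; last by move=> q n cq _; apply: bp cq.
exists p; split=> // a aV; rewrite (Vf a aV); exact: smod0 (smod_idealr (p 0%N)).
Qed.
End RegularSequences.

Section CanonicalModule.
Variables (A : comNzRingType) (m : idealr A) (M : lmodType A) (d : nat).
Hypotheses (Anoeth : noetherian A) (Aloc : local_ring m) (Adim : krull_dim A d).
Hypotheses (Mfg : fgm M) (Mfaithful : faithful M).
Local Notation J := (cpxJ m M).
Variables (s : seq A) (s0 : ob J d).
Hypotheses (ps : parameters m M d s) (sg : socle_generator m s0).

Lemma drop_parameter k : (k < size s)%N -> drop k s = nth 0 s k :: drop k.+1 s.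
Proof. exact: drop_nth. Qed.

Lemma module_chain_regular : chain_regular M s.
Proof.
move=> k v ks xv; have [sd _ fs _ _] := ps; set t := drop k.+1 s in xv *.
have fx := fs k; rewrite drop_parameter // -/t in fx.
have [tt [ttE [w _ wb]]] := kosI_lift Anoeth (fs k.+1) (filter_regular_torm fx xv).
have [K0 _] := kproj_inj t (J_lower Anoeth Aloc Mfg Mfaithful ps sg).
have w0 : w = 0 by apply: K0; rewrite size_drop; lia.
by apply/ttE; move: wb; rewrite w0 linear0 subr0.
Qed.

Lemma ring_chain_regular : chain_regular (regm A) s.
Proof.
move=> k a ks xa; have [sd sm _ _ _] := ps; set t := drop k.+1 s in xa *; set x := nth 0 s k in xa.
apply: contrapT => na.
have [L [sL tL LT nLa]] := krull_separation Anoeth Aloc (@smod_smul A (regm A) t) na.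
have [ss s00 sg'] := sg.
have pa : pproj sL a <> 0 by move/pproj_eq0.
have [|b [bp bs]] := tors_nonzero Anoeth (m := m) _ pa.
  move=> y /(LT a)[k' kE]; exists k'; by rewrite -linearZ_LR; apply/pproj_eq0.
have [c cb|f fE] := inj_cyclic (v := b *: pproj sL a) (e := s0) (@cpxJ_injective A m M Anoeth d).
  apply: ss; apply: contrapT => /negP/(local_unit Anoeth Aloc)[e ce]; apply: bp.
  by rewrite -[_ *: _]scale1r -ce mulrC -scalerA cb scaler0.
pose u := f (pproj sL (1 : A)).
have fu (y : A) : f (pproj sL y) = y *: u.
  by rewrite -!linearZ_LR; congr (f (pproj sL _)); rewrite regmE mulr1.
have Lu y : L y -> (y : A) *: u = 0.
  by move=> Ly; rewrite -fu (_ : pproj sL y = 0) ?linear0 //; apply/pproj_eq0.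
have tu y : y \in t -> y *: u = 0.
  move=> yt; apply: Lu; apply: tL; have := smul_mem (1 : regm A) yt; by rewrite regmE mulr1.
have kt : powers (drop k s) (x :: t).
  by rewrite drop_parameter //; apply: powers_refl.
have [u' [_ tu' xu']] := coregular Anoeth Aloc Mfg Mfaithful ps sg
  (powers_vanish Anoeth ps kt) (df_zero Anoeth Aloc Mfg Mfaithful ps sg u) tu.
have sk : smod (fun y : regm A => (y : A) *: u' = 0) := smod_ann u' (smod_eq0 _).
have xau : (x * a) *: u' = 0.
  apply: (smul_sub sk _ xa) => y w yt; by rewrite regmE mulrC -scalerA tu' // scaler0.
apply: s00; rewrite -fE linearZ_LR fu -xu' scalerA [a * x]mulrC xau scaler0 //.
Qed.

Lemma module_nontrivial : exists v : M, ~ smul s v.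
Proof.
apply: contrapT => H; have [_ sm _ _ _] := ps; have [u uT] := Mfg.
have sM (v : M) : smul s v by apply: contrapT => nv; apply: H; exists v.
suff /eqP : (1 : A) = 0 by rewrite oner_eq0.
apply: Mfaithful => v; rewrite scale1r.
apply: (@nakayama A m Anoeth Aloc M (fun v => v = 0) u (smod_eq0 _) _ _ (uT v)) => i.
have [c cs cE] := smul_coef uT (sM u`_i); exists c; last by rewrite -cE subrr.
by move=> j; apply: (span_sub (smod_idealr m) _ (cs j)).
Qed.

Lemma ring_nontrivial : exists v : regm A, ~ smul s v.
Proof.
have [_ sm _ _ _] := ps; exists 1 => s1; have [_ m1 _] := m_prime Anoeth Aloc; apply: m1.
apply: (smul_sub (smod_idealr m) _ s1) => x w /sm xm.
by rewrite regmE mulrC; exact: (smodZ (V := regm A) _ (smod_idealr m) xm).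
Qed.

Lemma ring_faithful : faithful (regm A).
Proof. by move=> a /(_ 1); rewrite regmE mulr1. Qed.
End CanonicalModule.

Theorem mainTheorem5 (A : comNzRingType) (m : idealr A) (d : nat)
    (M : lmodType A) :
  noetherian A -> local_ring m -> krull_dim A d ->
  finitely_generated M -> faithful M -> bass_number m M d 1 ->
  cohen_macaulay_ring m /\ canonical_module m M.
Proof.
move=> nA lA dA Mgen Mf bM; have Mfg := fgmE Mgen.
have [s [sd sm fs ts]] := system_of_parameters nA lA dA Mfg.
have ps : parameters m M d s.
  by split=> // s' s'd s'm; apply: (few_not_parameters nA lA dA Mfg Mf s'm s'd).
have [s0 sg] := socJ_top nA lA bM.
have depthA : depth m (regm A) d.
  apply: (depth_of_chain nA lA dA (@ring_faithful A) sd sm).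
    exact: (@ring_chain_regular A m M d nA lA Mfg Mf s s0 ps sg).
  exact: (@ring_nontrivial A m M d nA lA s ps).
have depthM : depth m M d.
  apply: (depth_of_chain nA lA dA Mf sd sm).
    exact: (@module_chain_regular A m M d nA lA Mfg Mf s s0 ps sg).
  exact: (@module_nontrivial A m M d nA lA Mfg Mf s ps).
have dimM : module_dim M d := module_dim_faithful dA Mf.
split.
  by exists d; split=> //; exact: (module_dim_faithful dA (@ring_faithful A)).
split=> //; [split|by exists d|].
- by exists d.
- by exists d.
apply: (@finite_injective_dimension_of_socles A m M d nA lA Mfg) => i c.
exact: (soc_cosyz_zero nA lA Mfg Mf ps sg).
Qed.
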